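(* Let $h^*$ be a maximizer in the equation $$V(t,i)=\sup_{\vartheta\ge0}\bigg\{U\big(g(i)-c(t+\vartheta)\big)e^{-q_i\vartheta}+\int_0^\vartheta e^{-q_is}\sum_{j\ne i}q_{ij}V(t+s,j)\,ds\bigg\},\qquad (t,i)\in[0,\infty)\times S,$$ and suppose that $\tau^*:=(h^*,h^*,\ldots)$ satisfies, for all $i\in S$ and $t\ge0$, $\mathbb P_i(\tau^*<\infty)=1$ and $$\lim_{n\to\infty}\mathbb E_i\Big[V(S_n+t,Z_n)1_{\{\tau^*\ge S_n\}}\Big]=0 .$$ Then $\tau^*$ is an optimal stopping time for the infinite-horizon stopping problem, i.e. $\mathbb E_i\big[U\big(g(X_{\tau^*})-c(t+\tau^* )\big)\big]=V(t,i)$.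
   Context: Markov chain: on a probability space $(\Omega,\mathcal F,\mathbb P)$, $(X_t)_{t\ge0}$ is a right-continuous continuous-time Markov chain with countable state space $S$ and intensity matrix $Q=(q_{ij})$, $0<q_i:=-q_{ii}=\sum_{j\ne i}q_{ij}<\infty$. Its jump times are $0=S_0<S_1<S_2<\dots$, $Z_n:=X_{S_n}$, and $X_t=\sum_{k\ge0}Z_k1_{\{S_k\le t<S_{k+1}\}}$ for all $t\ge0$; $S_{k+1}-S_k\sim\exp(q_{Z_k})$ and $\mathbb P(Z_{k+1}=j\mid Z_k=i)=q_{ij}/q_i$ for $j\ne i$. $(\mathcal F^X_t)$ is the natural filtration of $X$; $\mathbb P_i,\mathbb E_i$ denote probability and expectation given $X_0=i$. Utility, reward, cost: $g:S\to\mathbb R$ is a reward function, $c>0$ a cost rate, and $U$ is strictly increasing and strictly concave on $\mathrm{dom}(U)$, where one of the following holds: $\mathrm{dom}(U)=\mathbb R$; or $\mathrm{dom}(U)=[d,\infty)$ with $d<\inf_{i}g(i)$ and $U$ continuous on its domain; or $\mathrm{dom}(U)=(d,\infty)$ with $d<\inf_ig(i)$, $U$ continuous on its domain and $\lim_{x\downarrow d}U(x)=-\infty$. $U:=-\infty$ outside $\mathrm{dom}(U)$; for restricted domains the statement concerns $t$ in the domain $[0,\frac{g(i)-d}{c}]$, respectively $[0,\frac{g(i)-d}{c})$, and $V(t,i)=-\infty$ otherwise. $\Sigma$ is the set of $(\mathcal F^X_t)$-stopping times $\tau:\Omega\to[0,\infty)$ with $\mathbb P_i(\tau<\infty)=1$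 for all $i\in S$. Standing assumptions: (A1) $\sup_{\tau\in\Sigma}\mathbb E_i[g^+(X_\tau)-c\tau]<\infty$ for all $i\in S$; (A2) $\liminf_{n\to\infty}\mathbb E_i[U(g(X_{\tau\wedge S_n})-c(t+\tau\wedge S_n))]\ge\mathbb E_i[U(g(X_\tau)-c(t+\tau))]$ for all $i\in S$, $t\ge0$, $\tau\in\Sigma$. Markovian stopping times: a Markovian stopping time is identified with a sequence $\tau=(h_0,h_1,\dots)$ of measurable maps $h_k:[0,\infty)\times S\to[0,\infty]$; given elapsed time $t\ge0$ it denotes the random time $\tau=S_k+h_k(t+S_k,Z_k)$ for the smallest $k\ge0$ with $S_k+h_k(t+S_k,Z_k)<S_{k+1}$ (and $\tau=\infty$ if there is none). $\Sigma^M$ is the class of such sequences for which $\tau$ is $\mathbb P_i$-a.s. finite for all $i\in S$, $t\ge0$. Value function: $V(t,i):=\sup_{\tau\in\Sigma^M}\mathbb E_i\big[U\big(g(X_\tau)-c(t+\tau)\big)\big]$, with $\tau$ formed with elapsed time $t$; it satisfies the displayed equation. The original problem is the case $t=0$. Maximizer: a measurable function $h^*$ with values in $[0,\infty]$ such that the supremum is attained at $\vartheta=h^*(t,i)$ for all $(t,i)$, where $h^*(t,i)=\infty$ means that the supremum is the limit (limsup) of the expression in braces as $\vartheta\to\infty$. *)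

(* Defs.v *)
From HB Require Import structures.
From mathcomp Require Import all_boot all_order all_algebra.
From mathcomp Require Import all_classical all_reals all_analysis.
From mathcomp Require Import measurable_realfun.

Set Implicit Arguments.
Unset Strict Implicit.
Unset Printing Implicit Defensive.

Import Order.TTheory GRing.Theory Num.Theory.
Import numFieldNormedType.Exports.

Local Open Scope classical_set_scope.
Local Open Scope ring_scope.

(* Throughout, the state space S is a countable type regarded as discrete, so
   that every subset of S is measurable; time is a real number t >= 0, and
   values of a process at negative times are irrelevant.  Extended-real
   integrals are differences of the integrals of the positive and negative
   parts, and +oo - +oo = -oo. *)

Section MarkovChain.
Context {R : realType} {S : countType} {d : measure_display}
  {Omega : measurableType d}.
Variables (q : S -> S -> R) (P : S -> probability Omega R)
  (X : R -> Omega -> S) (J : nat -> Omega -> R).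

Definition rate (i : S) : R := - q i i.

Definition intensity_matrix : Prop :=
  forall i,
  [/\ 0 < rate i, forall j, j != i -> 0 <= q i j &
      \esum_(j in [set j | j != i]) (q i j)%:E = (rate i)%:E].

(* J n is the n-th jump time (J 0 = 0). *)
Definition jump_chain (n : nat) (w : Omega) : S := X (J n w) w.

Definition history (n : nat) : set (set Omega) :=
  <<s [set A | exists2 k, (k <= n)%N &
        (exists B : set S, A = jump_chain k @^-1` B) \/
        (exists2 B : set R, measurable B & A = J k @^-1` B)] >>.

(* P i is the law of the chain started at X_0 = i.  The field [mc_law] says
   that, given the history up to J n and jump_chain n = a, the sojourn time
   J n.+1 - J n is exponential with parameter rate a and is independent of the
   next state, which is b <> a with probability q a b / rate a. *)
Record markov_chain : Prop := MarkovChain {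
  mc_intensity : intensity_matrix ;
  mc_measurable : forall (t : R) (B : set S), 0 <= t -> measurable (X t @^-1` B) ;
  mc_jump_measurable : forall n, measurable_fun setT (J n) ;
  mc_jump0 : forall w, J 0 w = 0 ;
  mc_jump_lt : forall n w, J n w < J n.+1 w ;
  mc_jump_cover : forall (t : R) w, 0 <= t -> exists n, J n w <= t < J n.+1 w ;
  mc_constant : forall n (t : R) w,
    J n w <= t < J n.+1 w -> X t w = jump_chain n w ;
  mc_jump_neq : forall n w, jump_chain n.+1 w != jump_chain n w ;
  mc_start : forall i, P i [set w | X 0 w = i] = 1%E ;
  mc_law : forall i n (A : set Omega) a b (B : set R),
    history n A -> b != a -> measurable B ->
    (P i (A `&` [set w | [/\ jump_chain n w = a, B (J n.+1 w - J n w)%R &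
                             jump_chain n.+1 w = b]]) =
     P i (A `&` [set w | jump_chain n w = a]) *
     exponential_prob (rate a) B * (q a b / rate a)%R%:E)%E }.

Definition natural_filtration (t : R) : set (set Omega) :=
  <<s [set A | exists (s : R) (B : set S), 0 <= s <= t /\ A = X s @^-1` B] >>.

(* The class Sigma of almost surely finite stopping times.  A random time may
   take the value +oo on a null set, as do the Markovian stopping times below;
   on that null set [fine] replaces +oo by 0 wherever X is evaluated. *)
Definition stopping_time (tau : Omega -> \bar R) : Prop :=
  [/\ forall w, (0 <= tau w)%E,
      forall t : R, 0 <= t -> natural_filtration t [set w | (tau w <= t%:E)%E] &
      forall i, P i [set w | (tau w < +oo)%E] = 1%E].

(* A Markovian stopping time (h_0, h_1, ...), h k t i being the value at
   elapsed time t and state i. *)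
Definition measurable_rule (h : R -> S -> \bar R) : Prop :=
  forall i, (forall t : R, 0 <= t -> (0 <= h t i)%E) /\
            measurable_fun [set t : R | 0 <= t] (h ^~ i).

Definition stops_at (h : nat -> R -> S -> \bar R) (t : R) (w : Omega) :
    pred nat :=
  fun k => ((J k w)%:E + h k (t + J k w)%R (jump_chain k w)
            < (J k.+1 w)%:E)%E.

Definition markov_time (h : nat -> R -> S -> \bar R) (t : R) (w : Omega) :
    \bar R :=
  match pselect (exists k, stops_at h t w k) with
  | left ex => let k := ex_minn ex in
      ((J k w)%:E + h k (t + J k w)%R (jump_chain k w))%E
  | right _ => +oo%E
  end.

Definition markov_stopping_time (h : nat -> R -> S -> \bar R) : Prop :=
  (forall k, measurable_rule (h k)) /\
  (forall i (t : R), 0 <= t ->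
     P i [set w | (markov_time h t w < +oo)%E] = 1%E).

End MarkovChain.

Variant utility_domain (R : realType) :=
  | FullLine
  | ClosedHalfLine of R
  | OpenHalfLine of R.
Arguments FullLine {R}.

Section Utility.
Context {R : realType} {S : countType}.

Definition dom (D : utility_domain R) : set R :=
  match D with
  | FullLine => setT
  | ClosedHalfLine a => `[a, +oo[
  | OpenHalfLine a => `]a, +oo[
  end.

Definition utility (g : S -> R) (D : utility_domain R) (U : R -> \bar R) :
    Prop :=
  [/\ forall x, dom D x -> U x \is a fin_num,
      forall x, ~ dom D x -> U x = -oo%E,
      forall x y : R, dom D x -> dom D y -> x < y -> (U x < U y)%E,
      forall x y l : R, dom D x -> dom D y -> x != y -> 0 < l < 1 ->
        (l%:E * U x + (1 - l)%R%:E * U y < U (l * x + (1 - l) * y)%R)%E &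
      match D with
      | FullLine => True
      | ClosedHalfLine a =>
          (a%:E < ereal_inf (range (fun i => (g i)%:E)))%E /\
          {within dom D, continuous U}
      | OpenHalfLine a =>
          [/\ (a%:E < ereal_inf (range (fun i => (g i)%:E)))%E,
              {within dom D, continuous U} &
              U x @[x --> a^'+] --> -oo%E]
      end].

Definition time_domain (g : S -> R) (c : R) (D : utility_domain R)
    (t : R) (i : S) : Prop :=
  0 <= t /\
  match D with
  | FullLine => True
  | ClosedHalfLine a => t <= (g i - a) / c
  | OpenHalfLine a => t < (g i - a) / c
  end.

End Utility.

Section StoppingProblem.
Context {R : realType} {S : countType} {d : measure_display}
  {Omega : measurableType d}.
Variables (q : S -> S -> R) (P : S -> probability Omega R)
  (X : R -> Omega -> S) (J : nat -> Omega -> R).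
Variables (g : S -> R) (c : R) (D : utility_domain R) (U : R -> \bar R).

(* E_i[U(g(X_tau) - c(t + tau))] *)
Definition expected_utility (i : S) (t : R) (tau : Omega -> \bar R) : \bar R :=
  (\int[P i]_w U (g (X (fine (tau w)) w) - c * (t + fine (tau w)))%R)%E.

Definition A1 : Prop :=
  forall i,
  (ereal_sup [set \int[P i]_w
     ((Num.max (g (X (fine (tau w)) w)) 0)%R%:E - c%:E * tau w)
     | tau in [set tau | stopping_time P X tau]] < +oo)%E.

Definition A2 : Prop :=
  forall i (t : R) tau, 0 <= t -> stopping_time P X tau ->
  (expected_utility i t tau <=
   limn_einf (fun n =>
     expected_utility i t (fun w => mine (tau w) (J n w)%:E)))%E.

Definition value (t : R) (i : S) : \bar R :=
  if `[< time_domain g c D t i >] then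
    ereal_sup [set expected_utility i t (markov_time X J h t)
               | h in [set h | markov_stopping_time P X J h]]
  else -oo%E.

(* Sum over an arbitrary set of states of a family of arbitrary sign: [esum]
   is meaningful for nonnegative families only. *)
Definition signed_esum (A : set S) (f : S -> \bar R) : \bar R :=
  (\esum_(j in A) f^\+ j - \esum_(j in A) f^\- j)%E.

Definition bellman (t : R) (i : S) (theta : R) : \bar R :=
  (U (g i - c * (t + theta))%R * (expR (- (rate q i * theta)))%R%:E +
   \int[lebesgue_measure]_(s in `[0%R, theta])
     ((expR (- (rate q i * s)))%R%:E *
      signed_esum [set j | j != i] (fun j => (q i j)%:E * value (t + s)%R j)))%E.

Definition bellman_sup (t : R) (i : S) : \bar R :=
  ereal_sup [set bellman t i theta | theta in [set theta : R | 0 <= theta]].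

Definition maximizer (h : R -> S -> \bar R) : Prop :=
  measurable_rule h /\
  forall t i, time_domain g c D t i ->
  match h t i with
  | theta%:E => bellman t i theta = bellman_sup t i
  | +oo => limf_esup (bellman t i) (pinfty_nbhs R) = bellman_sup t i
  | -oo => False
  end%E.

End StoppingProblem.

(* Main.v *)
Require Import Defs.
From HB Require Import structures.
From mathcomp Require Import all_boot all_order all_algebra.
From mathcomp Require Import all_classical all_reals all_analysis.
From mathcomp Require Import measurable_realfun.
From mathcomp Require Import ring lra.

Set Implicit Arguments.
Unset Strict Implicit.
Unset Printing Implicit Defensive.

Import Order.TTheory GRing.Theory Num.Theory.
Import numFieldNormedType.Exports.

Local Open Scope classical_set_scope.
Local Open Scope ring_scope.

(** Why the theorem holds.

    Everything is expressed through the operator [step]: in state [a] at elapsed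
    time [u], wait for [h u a] and collect [phi], unless the chain jumps first,
    in which case collect [f] at the jump. By the Markov property at the jump
    times ([integral_step], [nestedE]), iterating it along rules [h_0, h_1, ...]
    computes expectations of rewards at the corresponding stopping time, and its
    monotone limit [eventual] does so for nonnegative rewards
    ([integral_reward]). Signed rewards are handled as pairs of a gain and a
    loss; inequalities between them are stated as inequalities between sums of
    nonnegative terms, which avoids differences of infinities.

    Bounds. By (A1), value iteration yields [K >= g^+] whose mean after a jump
    from [a] exceeds [K a] by at most the expected cost [c / q_a] of the sojourn
    ([exists_superharmonic]). If [C + s y] is an affine majorant of [U] with
    [s > 0], then [C + s (K - c u)] is therefore a majorant of the expected
    utility of every stopping time with a horizon in jumps, and by (A2) of every
    Markovian one ([net_le_majorant]). Optimizing over the majorants gives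
    [V (t, i) <= U (K i - c t + 1)] ([value_le_utility]).

    Dynamic programming. Splitting a Markovian stopping time at the first jump
    shows that [V (t, i)] is at most the supremum of the Bellman expression
    ([value_le_bellman_sup]). The delicate case is a first rule that waits for
    ever: the loss of stopping at late dates, weighted by the probability of
    still waiting, becomes arbitrarily small along some dates, because otherwise
    the value after the first jump would already be [-oo] on average
    ([exists_small_loss]).

    Verification. For a maximizer, [V] is thus at most the expectation of one
    step along it ([value_le_step_maximizer]), and by iteration [V (t, i)] is at
    most the expected utility collected before the [n]th jump plus the expected
    value left at that jump ([value_le_nested_maximizer]), which tends to zero by
    hypothesis. The limit in the first term requires the expected positive part
    of the utility to be finite. This follows from the nonnegative
    supermartingale formed by the gap between an affine majorant and [V], since
    this gap, when stopping, controls the utility from above as soon as a second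
    affine majorant of smaller slope exists ([eventual_gain_lty]); strict
    concavity provides one ([two_majorants]). The reverse inequality holds
    because the maximizer is an admissible stopping time from [(t, i)]
    ([value_ge]). *)

(** * Countable sums and integrals *)

Section CountableSums.
Context {R : realType} {S : countType}.
Local Open Scope ereal_scope.

(** Along the enumeration of [S], a sum over [S] becomes a series, that is, an
    integral for the counting measure, to which monotone convergence and
    measurability theorems apply. Codes of no element count for zero. *)
Definition pickled (a : S -> \bar R) (n : nat) : \bar R :=
  oapp a 0 (pickle_inv n).

Lemma pickled_ge0 (a : S -> \bar R) n : (forall b, 0 <= a b) -> 0 <= pickled a n.
Proof. by move=> a0; rewrite /pickled; case: pickle_inv. Qed.

Lemma esum_pickled (a : S -> \bar R) : (forall b, 0 <= a b) ->
  \esum_(b in [set: S]) a b = \sum_(n <oo) pickled a n.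
Proof.
move=> a0; rewrite nneseries_esumT; last by move=> n; exact: pickled_ge0.
pose A := [set n : nat | isSome (@pickle_inv S n)].
rewrite [RHS](_ : _ = \esum_(n in A) pickled a n); last first.
  rewrite esum_mkcond [RHS]esum_mkcond; apply: eq_esum => n _.
  rewrite in_setT; case: ifPn => //; rewrite notin_setE /A /pickled /=.
  by case: pickle_inv.
rewrite (@reindex_esum R S nat [set: S] A pickle).
  by apply: eq_esum => b _; rewrite /pickled pickleK_inv.
split.
- by move=> b _; rewrite /A /= pickleK_inv.
- by move=> x y _ _ /(congr1 (@pickle_inv S)); rewrite !pickleK_inv => -[].
- move=> n; rewrite /A /=; have := @pickle_invK S n.
  by case: pickle_inv => //= b bn _; exists b.
Qed.

Lemma esum_limn (a : nat -> S -> \bar R) :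
  (forall n b, 0 <= a n b) ->
  (forall b, {homo a ^~ b : m n / (m <= n)%N >-> m <= n}) ->
  \esum_(b in [set: S]) limn (a ^~ b) =
  limn (fun n => \esum_(b in [set: S]) a n b).
Proof.
move=> a0 ndA.
have l0 b : 0 <= limn (a ^~ b).
  apply: lime_ge; last by apply: nearW => n.
  exact: ereal_nondecreasing_is_cvgn.
rewrite esum_pickled//.
rewrite [X in _ = limn X](_ : _ =
    fun n => \int[counting]_k pickled (a n) k); last first.
  apply/funext => n; rewrite esum_pickled// ge0_integral_count// => k.
  exact: pickled_ge0.
rewrite -ge0_integral_count; last by move=> k; exact: pickled_ge0.
rewrite -monotone_convergence//.
- apply: eq_integral => k _; rewrite /pickled; case: pickle_inv => //=.
  by rewrite lim_cst.
- by move=> n k _; exact: pickled_ge0.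
- by move=> k _ m n mn; rewrite /pickled; case: pickle_inv => //= b; exact: ndA.
Qed.

End CountableSums.

Section CountableSumsIntegral.
Context {R : realType} {S : countType} {d : measure_display}
  {T : measurableType d}.
Local Open Scope ereal_scope.
Implicit Types (D : set T) (f : S -> T -> \bar R).

Lemma measurable_esum D f : measurable D -> (forall b, measurable_fun D (f b)) ->
  (forall b x, D x -> 0 <= f b x) ->
  measurable_fun D (fun x => \esum_(b in [set: S]) f b x).
Proof.
move=> mD mf f0.
apply: (eq_measurable_fun (fun x => \sum_(n <oo) pickled (f ^~ x) n)).
  by move=> x /set_mem Dx; rewrite esum_pickled// => b; exact: f0.
apply: ge0_emeasurable_sum.
  by move=> n x Dx _; apply: pickled_ge0 => b; exact: f0.
by move=> n _; rewrite /pickled; case: (pickle_inv n) => [b|]; [exact: mf|exact: measurable_cst].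
Qed.

Lemma integral_esum (mu : {measure set T -> \bar R}) D f : measurable D ->
  (forall b, measurable_fun D (f b)) -> (forall b x, D x -> 0 <= f b x) ->
  \int[mu]_(x in D) (\esum_(b in [set: S]) f b x) =
  \esum_(b in [set: S]) \int[mu]_(x in D) f b x.
Proof.
move=> mD mf f0.
rewrite esum_pickled; last by move=> b; apply: integral_ge0 => x; exact: f0.
transitivity (\int[mu]_(x in D) (\sum_(n <oo) pickled (f ^~ x) n)).
  apply: eq_integral => x /set_mem Dx.
  by rewrite esum_pickled// => b; exact: f0.
rewrite integral_nneseries//.
- apply: eq_eseriesr => n _; rewrite /pickled.
  by case: pickle_inv => [b|] //=; rewrite integral0.
- by move=> n; rewrite /pickled; case: pickle_inv => [b|] /=.
- by move=> n x Dx; apply: pickled_ge0 => b; exact: f0.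
Qed.

End CountableSumsIntegral.

(** The superlevel sets of a monotone function are intervals. *)
Lemma measurable_fun_nonincreasing_ereal {R : realType} (D : set R)
    (f : R -> \bar R) : is_interval D ->
  (forall x y, D x -> D y -> (x <= y)%R -> (f y <= f x)%E) ->
  measurable_fun D f.
Proof.
move=> iD nif; have mD : measurable D by exact: is_interval_measurable.
apply: (measurability _ (ErealGenOInfty.measurableE R)) => // _ [_ [x ->] <-].
apply: is_interval_measurable => u v /= [Du] + [Dv].
rewrite /= !in_itv/= !andbT => fu fv z uzv.
have Dz : D z by exact: (iD u v).
split => //; rewrite /= in_itv/= andbT.
by apply: (lt_le_trans fv); apply: nif => //; case/andP: uzv.
Qed.

Section IntegralDensity.
Context {R : realType} d (T : measurableType d).
Variables (m mu : {measure set T -> \bar R}) (w : T -> R).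
Hypotheses (mw : measurable_fun setT w) (w0 : forall x, (0 <= w x)%R).
Hypothesis mE : forall A, measurable A -> m A = (\int[mu]_(x in A) (w x)%:E)%E.
Local Open Scope ereal_scope.
Import HBNNSimple.

Let integral_density_nnsfun (h : {nnsfun T >-> R}) :
  \int[m]_x (h x)%:E = \int[mu]_x ((w x)%:E * (h x)%:E).
Proof.
under [LHS]eq_integral do rewrite fimfunE -fsumEFin//.
rewrite [LHS]ge0_integral_fsum//; last 2 first.
  - by move=> r; exact/measurable_EFinP/measurableT_comp.
  - by move=> n x _; rewrite EFinM nnfun_muleindic_ge0.
under [RHS]eq_integral.
  move=> x xD; rewrite fimfunE -fsumEFin// ge0_mule_fsumr; last first.
    by move=> r; rewrite EFinM nnfun_muleindic_ge0.
  over.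
rewrite [RHS]ge0_integral_fsum//; last 2 first.
  - move=> r; apply/measurable_EFinP; apply: measurable_funM => //.
    exact/measurableT_comp.
  - by move=> n x _; rewrite mule_ge0 ?lee_fin// -lee_fin EFinM nnfun_muleindic_ge0.
apply: eq_fsbigr => r _; rewrite integralZl_indic_nnsfun//=.
rewrite integral_indic// setIT mE//.
have mA : measurable (h @^-1` [set r]) by [].
rewrite [X in _ * X]integral_mkcond/=.
transitivity (\int[mu]_x (r%:E * ((w x)%:E * (\1_(h @^-1` [set r]) x)%:E))); last first.
  by apply: eq_integral => x _; rewrite EFinM muleCA.
have [r0|r0] := leP 0%R r.
  rewrite ge0_integralZl//; last 2 first.
  - by apply: emeasurable_funM; [exact/measurable_EFinP|exact/measurable_EFinP].
  - by move=> x _; rewrite -EFinM lee_fin mulr_ge0.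
  congr (_ * _); apply: eq_integral => x _.
  by rewrite patchE indicE; case: ifPn => xr; rewrite /= ?mule1 ?mule0.
have -> : h @^-1` [set r] = set0.
  apply/seteqP; split => // x /= hr; have : (0 <= h x)%R by [].
  by rewrite hr leNgt r0.
rewrite patch_set0 [X in _ * X]integral0_eq// mule0 integral0_eq// => x _.
by rewrite indic0 /= !mule0.
Qed.

(** For simple functions by linearity, then by monotone approximation. *)
Lemma ge0_integral_density (f : T -> \bar R) : measurable_fun setT f ->
  (forall x, 0 <= f x) -> \int[m]_x f x = \int[mu]_x ((w x)%:E * f x).
Proof.
move=> mf f0; pose f_ := nnsfun_approx measurableT mf.
transitivity (limn (fun n => \int[m]_x (f_ n x)%:E)).
  rewrite -monotone_convergence//=.
  - apply: eq_integral => x /[!inE] xD; apply/esym/cvg_lim => //=.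
    by apply: cvg_nnsfun_approx => //.
  - by move=> n; apply: measurableT_comp => //; exact: measurable_funTS.
  - by move=> n x _; rewrite lee_fin.
  - by move=> x _ a b ab; rewrite lee_fin//; exact/lefP/nd_nnsfun_approx.
under [X in limn X]eq_fun do rewrite integral_density_nnsfun.
rewrite -monotone_convergence//=.
- apply: eq_integral => x /[!inE] xD; apply/cvg_lim => //=.
  apply: cvgeZl => //; exact: cvg_nnsfun_approx.
- move=> n; apply: emeasurable_funM; first exact/measurable_EFinP.
  by apply: measurableT_comp => //; exact: measurable_funTS.
- by move=> n x _; rewrite mule_ge0// lee_fin.
- move=> x _ a b ab; rewrite lee_wpmul2l ?lee_fin//.
  exact/lefP/nd_nnsfun_approx.
Qed.

End IntegralDensity.

Lemma ge0_integral_mrestr {R : realType} d (T : measurableType d)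
    (mu : {measure set T -> \bar R}) (C : set T) (mC : measurable C)
    (f : T -> \bar R) : measurable_fun setT f -> (forall x, 0 <= f x)%E ->
  (\int[mrestr mu mC]_x f x = \int[mu]_(x in C) f x)%E.
Proof.
move=> mf f0; rewrite (@ge0_integral_density R _ _ _ mu (\1_C))//.
- rewrite [RHS]integral_mkcond; apply: eq_integral => x _.
  by rewrite patchE indicE; case: ifPn => xr; rewrite /= ?mul1e ?mul0e.
- by move=> A mA /=; rewrite integral_indic// /mrestr setIC.
Qed.

(** The joint law of a pair is determined by its values on rectangles. The sets
    [A] and [C] and the factor [k] leave room for the events that fix the states
    before and after a jump and for the probability of that transition. *)
Lemma ge0_integral_independent_pair {R : realType} d d1 d2
    (T : measurableType d) (T1 : measurableType d1) (T2 : measurableType d2)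
    (P : probability T R) (A C : set T) (f : T -> T1) (g : T -> T2)
    (m : probability T2 R) (k : R) (psi : T1 * T2 -> \bar R) :
  measurable A -> measurable C -> measurable_fun setT f -> measurable_fun setT g ->
  0 <= k ->
  (forall B1 B2, measurable B1 -> measurable B2 ->
    (P (C `&` (f @^-1` B1 `&` g @^-1` B2)) =
     P (A `&` f @^-1` B1) * m B2 * k%:E)%E) ->
  measurable_fun setT psi -> (forall z, 0 <= psi z)%E ->
  (\int[P]_(w in C) psi (f w, g w) =
   k%:E * \int[P]_(w in A) \int[m]_s psi (f w, s))%E.
Proof.
move=> mA mC mf mg k0 PE mpsi psi0.
have mfg : measurable_fun setT (fun w => (f w, g w)) by exact: measurable_fun_pair.
pose m1' : {measure set T1 -> \bar R} :=
  measure_function_pushforward__canonical__measure_function_Measure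
    (mrestr P mA) mf.
have m1fin : fin_num_fun m1'.
  move=> B mB; rewrite /m1' /= /pushforward /mrestr fin_num_measure//.
  by apply: measurableI => //; rewrite -[X in measurable X]setTI; apply: (mf _ B mB).
pose m1 : {finite_measure set T1 -> \bar R} :=
  HB.pack (m1' : set T1 -> \bar R) (Measure.class m1') (Measure_isFinite.Build _ _ _ m1' m1fin).
pose m2 : {finite_measure set T2 -> \bar R} := mscale (NngNum k0) m.
pose m' : {measure set (T1 * T2) -> \bar R} :=
  measure_function_pushforward__canonical__measure_function_Measure
    (mrestr P mC) mfg.
have mE X : measurable X -> (m1 \x m2)%E X = m' X.
  apply: product_measure_unique => B1 B2 mB1 mB2.
  rewrite /m' /= /m1' /m2 /pushforward /mrestr /mscale /=.
  have -> : ((fun w => (f w, g w)) @^-1` (B1 `*` B2) `&` C = C `&` (f @^-1` B1 `&` g @^-1` B2)).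
    by rewrite setIC.
  by rewrite PE// setIC -muleA; congr (_ * _)%E; rewrite muleC.
transitivity (\int[m']_z psi z)%E.
  rewrite ge0_integral_pushforward// preimage_setT ge0_integral_mrestr//.
  - exact: measurableT_comp.
  - by move=> x; exact: psi0.
transitivity (\int[(m1 \x m2)%E]_z psi z)%E.
  apply: eq_measure_integral => X mX _; exact/esym/mE.
rewrite fubini_tonelli1// /fubini_F.
have mF : measurable_fun setT (fun x => \int[m]_y psi (x, y))%E.
  exact: (@measurable_fun_fubini_tonelli_F _ _ _ _ _ m psi).
transitivity (\int[m1]_x (k%:E * \int[m]_y psi (x, y)))%E.
  apply: eq_integral => x _; rewrite ge0_integral_mscale//.
  exact: measurableT_comp.
rewrite ge0_integralZl//; last by move=> x _; apply: integral_ge0.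
congr (_ * _)%E.
transitivity (\int[m1']_x \int[m]_y psi (x, y))%E; first by [].
rewrite ge0_integral_pushforward//; last by move=> y _; exact: integral_ge0.
rewrite preimage_setT ge0_integral_mrestr//.
- exact: measurableT_comp.
- by move=> x; exact: integral_ge0.
Qed.

Lemma measurable_on_partition {S : countType} d d' (T : measurableType d)
    (T' : measurableType d') (D : set T) (Y : T -> S) (f : S -> T -> T') :
  measurable D -> (forall a, measurable (Y @^-1` [set a])) ->
  (forall a, measurable_fun D (f a)) -> measurable_fun D (fun w => f (Y w) w).
Proof.
move=> mD mY mf _ B mB; rewrite (_ : _ `&` _ = \bigcup_(a : S)
    (D `&` f a @^-1` B `&` Y @^-1` [set a])).
  apply: countable_bigcupT_measurable => // a.
  by apply: measurableI => //; exact: mf.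
apply/seteqP; split => [w [Dw Bw]|w [a _] [[Dw Bw] /= Ya]]; first by exists (Y w).
by split => //=; rewrite Ya.
Qed.

(** * Expectations over one jump *)

Section OneJump.
Context {R : realType} {S : countType}.
Variable q : S -> S -> R.
Hypothesis qI : intensity_matrix q.
Local Open Scope ereal_scope.
Local Notation rate := (rate q).

Lemma rate_gt0 a : (0 < rate a)%R.
Proof. by case: (qI a). Qed.

Definition sojourn_law (a : S) : probability (measurableTypeR R) R :=
  exponential_distribution_exponential_prob__canonical__probability_measure_Probability
    (rate_gt0 a).

Definition jump_prob (a b : S) : R := if b == a then 0%R else (q a b / rate a)%R.

Lemma jump_prob_ge0 a b : (0 <= jump_prob a b)%R.
Proof.
rewrite /jump_prob; case: ifPn => // ba.
by rewrite divr_ge0 ?(ltW (rate_gt0 a))//; case: (qI a) => _ + _; apply.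
Qed.

Definition after_jump (a : S) (F : S -> \bar R) : \bar R :=
  \esum_(b in [set: S]) ((jump_prob a b)%:E * F b).

Lemma after_jump_ge0 a F : (forall b, 0 <= F b) -> 0 <= after_jump a F.
Proof.
move=> F0; apply: esum_ge0 => b _; apply: mule_ge0 => //.
by rewrite lee_fin jump_prob_ge0.
Qed.

Lemma le_after_jump a F G : (forall b, 0 <= F b) -> (forall b, F b <= G b) ->
  after_jump a F <= after_jump a G.
Proof.
move=> F0 FG; apply: le_esum => b _.
by apply: lee_wpmul2l => //; rewrite lee_fin jump_prob_ge0.
Qed.

Lemma after_jumpD a F G : (forall b, 0 <= F b) -> (forall b, 0 <= G b) ->
  after_jump a (fun b => F b + G b) = after_jump a F + after_jump a G.
Proof.
move=> F0 G0; rewrite /after_jump -esumD; first last.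
- by move=> b _; rewrite mule_ge0// lee_fin jump_prob_ge0.
- by move=> b _; rewrite mule_ge0// lee_fin jump_prob_ge0.
by apply: eq_esum => b _; rewrite ge0_muleDr.
Qed.

Lemma esumZl (I : choiceType) (k : R) (F : I -> \bar R) : (0 <= k)%R ->
  (forall b, 0 <= F b) ->
  \esum_(b in [set: I]) (k%:E * F b) = k%:E * \esum_(b in [set: I]) F b.
Proof.
move=> k0 F0; rewrite /esum -ereal_supZl//; last first.
  apply/set0P; exists 0; by exists set0; [split => //; exact: finite_set0|rewrite fsbig_set0].
congr ereal_sup; apply/seteqP; split => [_ [A [fA _] <-]|_ [_ [A [fA _] <-] <-]] /=.
  exists (\sum_(x \in A) F x); first by exists A.
  by rewrite ge0_mule_fsumr.
by exists A => //; rewrite ge0_mule_fsumr.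
Qed.

Lemma esum_rates a : \esum_(b in [set: S]) ((rate a * jump_prob a b)%R%:E) = (rate a)%:E.
Proof.
have [_ _ <-] := qI a; rewrite [RHS]esum_mkcond; apply: eq_esum => b _.
rewrite /jump_prob; case: ifPn => [ba|ba].
  by rewrite ifF ?mulr0//; apply/negP; rewrite inE /= => /eqP; rewrite (eqP ba).
rewrite ifT; last by rewrite inE /=.
by rewrite mulrC divfK// gt_eqF// rate_gt0.
Qed.

Lemma esum_jump_prob a : \esum_(b in [set: S]) (jump_prob a b)%:E = 1.
Proof.
have r0 := rate_gt0 a.
have /(congr1 (fun x => (rate a)^-1%:E * x)) := esum_rates a.
rewrite -esumZl ?invr_ge0 ?(ltW r0)//; last first.
  by move=> b; rewrite lee_fin mulr_ge0 ?jump_prob_ge0// ltW.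
rewrite -EFinM mulVf ?gt_eqF// => <-.
by apply: eq_esum => b _; rewrite -EFinM mulKf// gt_eqF.
Qed.

Lemma exists_jump a : exists b, (0 < jump_prob a b)%R.
Proof.
apply/not_existsP => np; have := esum_jump_prob a.
rewrite esum1 => [/esym/eqP|b _]; first by rewrite onee_eq0.
have /negP := np b; have := jump_prob_ge0 a b.
by rewrite le_eqVlt => /predU1P[<-|->].
Qed.

Lemma after_jump_cst a (k : \bar R) : 0 <= k -> after_jump a (fun=> k) = k.
Proof.
move: k => [k k0|_|//]; rewrite /after_jump.
  rewrite (eq_esum (b := fun b => k%:E * (jump_prob a b)%:E)); last first.
    by move=> b _; rewrite muleC.
  by rewrite esumZl// ?esum_jump_prob ?mule1// => b; rewrite lee_fin jump_prob_ge0.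
apply/eqP; rewrite -leye_eq.
have [b pb] := exists_jump a.
apply: esum_ge; exists [set b]; first by split => //; exact: finite_set1.
by rewrite fsbig_set1 gt0_muley.
Qed.

Lemma limn_after_jump a (F : nat -> S -> \bar R) :
  (forall n b, 0 <= F n b) ->
  (forall b, {homo F ^~ b : m n / (m <= n)%N >-> m <= n}) ->
  after_jump a (fun b => limn (F ^~ b)) = limn (fun n => after_jump a (F n)).
Proof.
move=> F0 ndF; rewrite /after_jump -esum_limn.
- apply: eq_esum => b _; rewrite limeMl//.
  exact: ereal_nondecreasing_is_cvgn.
- by move=> n b; rewrite mule_ge0// lee_fin jump_prob_ge0.
- by move=> b m n mn; rewrite lee_wpmul2l ?lee_fin ?jump_prob_ge0// ndF.
Qed.

Lemma measurable_after_jump d (T : measurableType d) a (F : T -> S -> \bar R) :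
  (forall b, measurable_fun setT (F ^~ b)) -> (forall x b, 0 <= F x b) ->
  measurable_fun setT (fun x => after_jump a (F x)).
Proof.
move=> mF F0; apply: measurable_esum => // b.
  exact: emeasurable_funM.
by move=> x _; rewrite mule_ge0// lee_fin jump_prob_ge0.
Qed.

(** Rewards and rules are functions of the elapsed time and of the state.
    Measurability in time suffices since the states are discrete; working with
    nonnegative rewards only, integrals exist without integrability. *)
Definition nnmeas (f : R -> S -> \bar R) : Prop :=
  (forall a, measurable_fun setT (f ^~ a)) /\ (forall u a, 0 <= f u a).

Lemma nnmeas_cst k : 0 <= k -> nnmeas (fun _ _ => k).
Proof. by move=> k0; split => // a; exact: measurable_cst. Qed.

Lemma nnmeasD f g : nnmeas f -> nnmeas g -> nnmeas (fun u a => f u a + g u a).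
Proof.
move=> [mf f0] [mg g0]; split => [a|u a]; last by rewrite adde_ge0.
exact: emeasurable_funD.
Qed.

Lemma nnmeas_shift f u : nnmeas f -> nnmeas (fun s => f (u + s)%R).
Proof.
move=> [mf f0]; split => // a; apply: (measurableT_comp (mf a)).
by apply: measurable_funD.
Qed.

(** The expected reward until the end of a waiting time [theta] or the first
    jump, whichever is sooner: [x] is collected if the waiting time elapses, and
    [F s b] if the chain jumps to [b] at time [s]. *)
Definition jump_kernel (a : S) (theta x : \bar R) (F : R -> S -> \bar R) : \bar R :=
  \int[exponential_prob (rate a)]_s
    (if s%:E <= theta then after_jump a (F s) else x).

Lemma measurable_jump_kernel (a : S) (theta x : \bar R) F : nnmeas F ->
  measurable_fun setT
    (fun s : R => if s%:E <= theta then after_jump a (F s) else x).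
Proof.
move=> [mF F0]; apply: measurable_fun_ifT => //.
- apply: measurable_fun_lee => //; exact: measurable_cst.
- exact: measurable_after_jump.
Qed.

Lemma jump_kernel_integrand_ge0 (a : S) (theta x : \bar R) F (s : R) : 0 <= x -> nnmeas F ->
  0 <= (if s%:E <= theta then after_jump a (F s) else x).
Proof. by move=> x0 [_ F0]; case: ifP => // _; exact: after_jump_ge0. Qed.

Lemma jump_kernel_ge0 a theta x F : 0 <= x -> nnmeas F ->
  0 <= jump_kernel a theta x F.
Proof.
move=> x0 nF; apply: (@integral_ge0 _ _ _ (sojourn_law a)) => s _.
exact: jump_kernel_integrand_ge0.
Qed.

Lemma jump_kernelD a theta x y F G : 0 <= x -> 0 <= y -> nnmeas F -> nnmeas G ->
  jump_kernel a theta (x + y) (fun s b => F s b + G s b) =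
  jump_kernel a theta x F + jump_kernel a theta y G.
Proof.
move=> x0 y0 nF nG; rewrite /jump_kernel.
rewrite -(@ge0_integralD _ _ _ (sojourn_law a))//.
- apply: eq_integral => s _; case: ifP => // _.
  by rewrite after_jumpD//; [case: nF|case: nG].
- by move=> s _; exact: jump_kernel_integrand_ge0.
- exact: measurable_jump_kernel.
- by move=> s _; exact: jump_kernel_integrand_ge0.
- exact: measurable_jump_kernel.
Qed.

Lemma le_jump_kernel_after a theta x y F G : 0 <= x -> nnmeas F -> nnmeas G ->
  x <= y -> (forall s, (0 <= s)%R -> after_jump a (F s) <= after_jump a (G s)) ->
  jump_kernel a theta x F <= jump_kernel a theta y G.
Proof.
move=> x0 nF nG xy FG; rewrite /jump_kernel.
have y0 := le_trans x0 xy.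
rewrite (@ge0_negligible_integral _ _ _ (sojourn_law a) setT `]-oo, 0%R[)//=; last 3 first.
- exact: measurable_jump_kernel.
- by move=> s _; apply: jump_kernel_integrand_ge0.
- rewrite /exponential_prob integral0_eq// => s /=; rewrite in_itv/= => s0.
  by rewrite lt0_exponential_pdf.
rewrite [leRHS](@ge0_negligible_integral _ _ _ (sojourn_law a) setT `]-oo, 0%R[)//=; last 3 first.
- exact: measurable_jump_kernel.
- by move=> s _; apply: jump_kernel_integrand_ge0.
- rewrite /exponential_prob integral0_eq// => s /=; rewrite in_itv/= => s0.
  by rewrite lt0_exponential_pdf.
apply: (@ge0_le_integral _ _ _ (sojourn_law a)).
- exact: measurableD.
- by move=> s _; exact: jump_kernel_integrand_ge0.
- by apply: measurable_funTS; apply: measurable_jump_kernel.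
- by apply: measurable_funTS; apply: measurable_jump_kernel.
- move=> s [_ /=]; rewrite in_itv/= => /negP; rewrite -leNgt => s0.
  by case: ifP => // _; exact: FG.
Qed.

Lemma le_jump_kernel a theta x y F G : 0 <= x -> nnmeas F -> nnmeas G ->
  x <= y -> (forall s b, (0 <= s)%R -> F s b <= G s b) ->
  jump_kernel a theta x F <= jump_kernel a theta y G.
Proof.
move=> x0 nF nG xy FG; apply: le_jump_kernel_after => // s s0.
by apply: le_after_jump => [b|b]; [case: nF|exact: FG].
Qed.

Lemma eq_jump_kernel a theta x F G : 0 <= x -> nnmeas F -> nnmeas G ->
  (forall s b, (0 <= s)%R -> F s b = G s b) ->
  jump_kernel a theta x F = jump_kernel a theta x G.
Proof.
move=> x0 nF nG FG; apply/eqP; rewrite eq_le.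
by rewrite !le_jump_kernel// => s b s0; rewrite FG.
Qed.

Lemma jump_kernel_cst a theta k : 0 <= k -> jump_kernel a theta k (fun _ _ => k) = k.
Proof.
move=> k0.
transitivity (\int[sojourn_law a]_s (cst k s)).
  congr (integral _ _ _); apply/funext => s; rewrite after_jump_cst//.
  by case: ifP.
rewrite (integral_cst (sojourn_law a) measurableT).
by rewrite [X in _ * X](_ : _ = 1) ?mule1//; exact: (@probability_setT _ _ _ (sojourn_law a)).
Qed.

(** Monotone convergence, in the sojourn time and in the next state. *)
Lemma limn_jump_kernel a theta x (F : nat -> R -> S -> \bar R) :
  0 <= x -> (forall n, nnmeas (F n)) ->
  (forall s b, {homo (fun n => F n s b) : m n / (m <= n)%N >-> m <= n}) ->
  jump_kernel a theta x (fun s b => limn (fun n => F n s b)) =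
  limn (fun n => jump_kernel a theta x (F n)).
Proof.
move=> x0 nF ndF; rewrite /jump_kernel.
rewrite -(@monotone_convergence _ _ _ (sojourn_law a))//.
- apply: eq_integral => s _; case: ifP => _; last by rewrite lim_cst.
  by rewrite limn_after_jump// => n b; case: (nF n).
- by move=> n; exact: measurable_jump_kernel.
- by move=> n s _; exact: jump_kernel_integrand_ge0.
- move=> s _ m n mn; case: ifP => // _; apply: le_after_jump.
    by move=> b; case: (nF m).
  by move=> b; exact: ndF.
Qed.

Lemma nnmeas_limn (F : nat -> R -> S -> \bar R) : (forall n, nnmeas (F n)) ->
  (forall s b, {homo (fun n => F n s b) : m n / (m <= n)%N >-> m <= n}) ->
  nnmeas (fun s b => limn (fun n => F n s b)).
Proof.
move=> nF ndF; split.
  move=> b; apply: (emeasurable_fun_cvg (fun n s => F n s b)).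
    by move=> n; case: (nF n) => + _; exact.
  by move=> s _; exact: ereal_nondecreasing_is_cvgn.
move=> s b; apply: lime_ge; first exact: ereal_nondecreasing_is_cvgn.
by apply: nearW => n; case: (nF n) => _; exact.
Qed.

(** One stage of the decision problem: both the Bellman expression and the
    expectations at Markovian stopping times are instances of it. *)
Definition step (h phi f : R -> S -> \bar R) (u : R) (a : S) : \bar R :=
  jump_kernel a (h u a) (phi (u + fine (h u a))%R a) (fun s => f (u + s)%R).

Lemma measurable_before_jump (h phi : R -> S -> \bar R) (G : R * R -> \bar R)
    (a : S) : nnmeas h -> nnmeas phi -> measurable_fun setT G ->
  measurable_fun setT (fun z : R * R =>
    if z.2%:E <= h z.1 a then G z else phi (z.1 + fine (h z.1 a))%R a).
Proof.
move=> [mh h0] [mphi phi0] mG.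
have mh1 : measurable_fun setT (fun z : R * R => h z.1 a).
  exact: (measurableT_comp (mh a) measurable_fst).
apply: measurable_fun_ifT => //.
- apply: measurable_fun_lee => //.
  by apply/measurable_EFinP; exact: measurable_snd.
- apply: (measurableT_comp (mphi a)); apply: measurable_funD => //.
  apply: measurableT_comp => //; exact: fine_measurable.
Qed.

Lemma measurable_step_integrand (h phi f : R -> S -> \bar R) (a : S) :
  nnmeas h -> nnmeas phi -> nnmeas f ->
  measurable_fun setT (fun z : R * R =>
    if z.2%:E <= h z.1 a then after_jump a (f (z.1 + z.2)%R)
    else phi (z.1 + fine (h z.1 a))%R a).
Proof.
move=> nh nphi [mf f0].
apply: (measurable_before_jump (G := fun z => after_jump a (f (z.1 + z.2)%R))) => //.
apply: measurable_after_jump => [b|x b]; last exact: f0.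
by apply: (measurableT_comp (mf b)); exact: measurable_funD.
Qed.

Lemma nnmeas_step h phi f : nnmeas h -> nnmeas phi -> nnmeas f ->
  nnmeas (step h phi f).
Proof.
move=> nh nphi nf; split => [a|u a].
  apply: (@measurable_fun_fubini_tonelli_F _ _ R (measurableTypeR R) R
    (sojourn_law a) (fun z => if z.2%:E <= h z.1 a then after_jump a (f (z.1 + z.2)%R)
    else phi (z.1 + fine (h z.1 a))%R a)); first exact: measurable_step_integrand.
  move=> [v s]; apply: (@jump_kernel_integrand_ge0 a (h v a) _ (fun r => f (v + r)%R) s).
    by case: nphi.
  exact: nnmeas_shift.
by apply: jump_kernel_ge0; [case: nphi|exact: nnmeas_shift].
Qed.

Lemma stepD h phi psi f g : nnmeas phi -> nnmeas psi -> nnmeas f -> nnmeas g ->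
  step h (fun u a => phi u a + psi u a) (fun u a => f u a + g u a) =
  fun u a => step h phi f u a + step h psi g u a.
Proof.
move=> nphi npsi nf ng; apply/funext => u; apply/funext => a; rewrite /step.
by rewrite jump_kernelD//; [case: nphi|case: npsi|exact: nnmeas_shift|exact: nnmeas_shift].
Qed.

Lemma le_step h phi psi f g u a : nnmeas h -> nnmeas phi -> nnmeas f -> nnmeas g ->
  (forall v b, (u <= v)%R -> phi v b <= psi v b) ->
  (forall v b, (u <= v)%R -> f v b <= g v b) ->
  step h phi f u a <= step h psi g u a.
Proof.
move=> [_ h0] nphi nf ng le1 le2; apply: le_jump_kernel.
- by case: nphi.
- exact: nnmeas_shift.
- exact: nnmeas_shift.
- by apply: le1; rewrite lerDl fine_ge0.
- by move=> s b s0; apply: le2; rewrite lerDl.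
Qed.

(** The finite-horizon value of a sequence of rules, with reward [phi] on
    stopping and terminal reward [f]. *)
Fixpoint nested n (h : nat -> R -> S -> \bar R) phi f : R -> S -> \bar R :=
  if n is m.+1 then step (h 0%N) phi (nested m (fun k => h k.+1) phi f) else f.

Lemma nnmeas_nested n h phi f : (forall k, nnmeas (h k)) -> nnmeas phi ->
  nnmeas f -> nnmeas (nested n h phi f).
Proof.
move=> nh nphi nf; elim: n h nh => //= n IH h nh.
by apply: nnmeas_step => //; apply: IH => k.
Qed.

Let nil0 : R -> S -> \bar R := fun _ _ => 0.

Lemma nested_nd h phi u a : (forall k, nnmeas (h k)) -> nnmeas phi ->
  {homo (fun n => nested n h phi nil0 u a) : m n / (m <= n)%N >-> m <= n}.
Proof.
move=> nh nphi; apply/nondecreasing_seqP => n.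
have n0 : nnmeas nil0 by exact: nnmeas_cst.
elim: n h nh u a => [|n IH] h nh u a.
  rewrite [leLHS]/=.
  by have [_ ->] := nnmeas_nested 1 nh nphi n0.
apply: le_step => //; [exact: nnmeas_nested|exact: (@nnmeas_nested n.+1 (fun k => h k.+1))|].
by move=> v b v0; exact: IH.
Qed.

(** The value of following the rules [h] until they stop, with no reward if
    they never do. *)
Definition eventual h phi (u : R) (a : S) : \bar R :=
  limn (fun n => nested n h phi nil0 u a).

Lemma nnmeas_eventual h phi : (forall k, nnmeas (h k)) -> nnmeas phi ->
  nnmeas (eventual h phi).
Proof.
move=> nh nphi; apply: nnmeas_limn => [n|s b].
  by apply: nnmeas_nested => //; exact: nnmeas_cst.
exact: nested_nd.
Qed.

Lemma eventual_step h phi u a : (forall k, nnmeas (h k)) -> nnmeas phi ->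
  eventual h phi u a = step (h 0%N) phi (eventual (fun k => h k.+1) phi) u a.
Proof.
move=> nh nphi; rewrite /step /eventual limn_jump_kernel.
- have := @nested_nd h phi u a nh nphi; rewrite -/(nondecreasing_seq _) => nd.
  have /cvg_ex[l cl] : cvgn (fun n => nested n h phi nil0 u a).
    exact: ereal_nondecreasing_is_cvgn.
  rewrite (cvg_lim _ cl)//; apply/esym/cvg_lim => //.
  by move: cl; rewrite -cvg_shiftS.
- by case: nphi.
- by move=> n; apply: nnmeas_shift; apply: nnmeas_nested => //; exact: nnmeas_cst.
- by move=> s b; apply: nested_nd.
Qed.

End OneJump.

(** * Jump times and the natural filtration *)

Section NaturalFiltration.
Context {R : realType} {S : countType} {d : measure_display}
  {Omega : measurableType d}.
Variables (q : S -> S -> R) (P : S -> probability Omega R)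
  (X : R -> Omega -> S) (J : nat -> Omega -> R).
Hypothesis chain : markov_chain q P X J.
Local Notation Z := (jump_chain X J).
Local Notation gen t :=
  [set A | exists (s : R) (B : set S), 0 <= s <= t /\ A = X s @^-1` B].
Local Notation FX t := (@measurable _ (g_sigma_algebraType (gen t))).

Lemma natural_filtrationE t : natural_filtration X t = FX t.
Proof. by []. Qed.

Lemma FX_le t u (A : set Omega) : t <= u -> FX t A -> FX u A.
Proof.
move=> tu; apply: (@sub_sigma_algebra2 Omega setT) => B [s [C [/andP[s0 st] ->]]].
by exists s, C; rewrite s0 (le_trans st).
Qed.

Lemma FX_X s t (B : set S) : 0 <= s <= t -> FX t (X s @^-1` B).
Proof. by move=> st; apply: sub_sigma_algebra; exists s, B. Qed.

Lemma FX_bigcup t (I : countType) (F : I -> set Omega) :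
  (forall i, FX t (F i)) -> FX t (\bigcup_i F i).
Proof. by move=> FF; apply: countable_bigcupT_measurable. Qed.

Lemma jump_ge0 k w : 0 <= J k w.
Proof.
elim: k => [|k IH]; first by rewrite (mc_jump0 chain).
by rewrite (le_trans IH)// ltW// (mc_jump_lt chain).
Qed.

Lemma jump_homo w : {homo J ^~ w : m n / (m < n)%N >-> m < n}.
Proof.
apply: homo_ltn => [|n]; first exact: lt_trans.
exact: (mc_jump_lt chain).
Qed.

Lemma jump_mono w : {homo J ^~ w : m n / (m <= n)%N >-> m <= n}.
Proof.
move=> m n; rewrite leq_eqVlt => /predU1P[->//|mn].
by rewrite ltW// jump_homo.
Qed.

Lemma jump_X k t w : J k w <= t < J k.+1 w -> X t w = Z k w.
Proof. exact: (mc_constant chain). Qed.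

(** Rational times together with the horizon [t]: enough instants to see
    every sojourn interval that meets [0, t]. *)
Definition sample (t : R) (r : option rat) : R :=
  if r is Some x then if 0 <= (ratr x : R) <= t then ratr x else t else t.

Lemma sample_itv t r : 0 <= t -> 0 <= sample t r <= t.
Proof.
by move=> t0; rewrite /sample; case: r => [x|]; [case: ifP => //|]; rewrite t0 lexx.
Qed.

Lemma sample_sojourn k t w : J k w <= t ->
  exists r, J k w <= sample t r < J k.+1 w.
Proof.
move=> kt; have [tk|tk] := ltP t (J k.+1 w); first by exists None; rewrite kt.
have [x] := rat_in_itvoo (mc_jump_lt chain k w); rewrite in_itv/= => /andP[x1 x2].
exists (Some x); rewrite /sample ifT ?(ltW x1)//.
by rewrite (le_trans (jump_ge0 k w) (ltW x1))/= (le_trans (ltW x2)).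
Qed.

(** Induction on [k]. The next jump has occurred by time [s] when some sampled
    state differs from the one entered at the jump [k]. The state entered at the
    next jump is read off at a sampled instant such that no sampled state
    between this jump and that instant differs from it. *)
Lemma FX_jump k t (B : set S) : 0 <= t ->
  FX t [set w | J k w <= t /\ B (Z k w)].
Proof.
elim: k t B => [|k IH] t B t0.
  rewrite (_ : [set _ | _] = X 0 @^-1` B); first by apply: FX_X; rewrite lexx.
  apply/seteqP; split => w /=; rewrite /jump_chain (mc_jump0 chain) => //.
  by move=> [].
have FXJ s : 0 <= s -> FX s [set w | J k.+1 w <= s].
  move=> s0; rewrite (_ : [set w | _] = \bigcup_(r : option rat) \bigcup_(a : S)
      ([set w | J k w <= sample s r /\ [set a] (Z k w)] `&`
       X (sample s r) @^-1` [set~ a])); last first.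
    apply/seteqP; split => [w /= Js|w [r _] [a _] /= [[Jr Za] Xa]].
      have [r /andP[r1 r2]] := sample_sojourn Js.
      exists r => //; exists (Z k w) => //=; split.
        by split => //; rewrite (le_trans _ r1)// ltW// (mc_jump_lt chain).
      by rewrite (@jump_X k.+1) ?r1//; apply/eqP; exact: (mc_jump_neq chain).
    rewrite leNgt; apply/negP => sJ; apply: Xa; rewrite (@jump_X k)//.
    rewrite Jr (le_lt_trans _ sJ)//.
    by have /andP[] := sample_itv r s0.
  apply: FX_bigcup => r; apply: FX_bigcup => a.
  have /andP[r0 rs] := sample_itv r s0.
  apply: measurableI; last by apply: FX_X; rewrite r0.
  by apply: (FX_le rs); exact: IH.
rewrite (_ : [set w | _] = \bigcup_(r : option rat) \bigcup_(b : S)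
  ([set w | B b] `&` [set w | J k.+1 w <= sample t r] `&`
   \bigcap_(r' : option rat) (~` [set w | J k.+1 w <= sample (sample t r) r'] `|`
       X (sample (sample t r) r') @^-1` [set b]))); last first.
  apply/seteqP; split => [w [Jt BZ]|w [r _] [b _] [[/= Bb Jr] H]].
    have [r /andP[r1 r2]] := sample_sojourn Jt.
    exists r => //; exists (Z k.+1 w) => //; split; first by split.
    move=> r' _; have [Jr'|Jr'] := leP (J k.+1 w) (sample (sample t r) r'); last first.
      by left => /=; rewrite leNgt Jr'.
    right => /=; apply: jump_X; rewrite Jr' (le_lt_trans _ r2)//.
    have r0 := le_trans (jump_ge0 k.+1 w) r1.
    by have /andP[] := sample_itv r' r0.
  have /andP[r0 rt] := sample_itv r t0.
  split; first by rewrite (le_trans Jr).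
  have [r' /andP[r1 r2]] := sample_sojourn Jr.
  by have [//|/= Xb] := H r' I; rewrite -(@jump_X _ _ _ (introT andP (conj r1 r2))) Xb.
apply: FX_bigcup => r; apply: FX_bigcup => b.
have /andP[r0 rt] := sample_itv r t0.
apply: (FX_le rt); apply: measurableI.
  apply: measurableI; last exact: FXJ.
  have [Bb|Bb] := pselect (B b).
    by rewrite (_ : [set w | B b] = setT)//; apply/seteqP; split.
  by rewrite (_ : [set w | B b] = set0)//; apply/seteqP; split.
rewrite -[X in measurable X]setCK setC_bigcap; apply: measurableC.
apply: FX_bigcup => r'; have /andP[r'0 r'r] := sample_itv r' r0.
apply: measurableC; apply: measurableU.
  by apply: measurableC; apply: (FX_le r'r); exact: FXJ.
by apply: (FX_le r'r); apply: FX_X; rewrite r'0/=.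
Qed.

End NaturalFiltration.

(** * The Markov property at jump times *)

Section OneJumpLaw.
Context {R : realType} {S : countType} {d : measure_display}
  {Omega : measurableType d}.
Variables (q : S -> S -> R) (P : S -> probability Omega R)
  (X : R -> Omega -> S) (J : nat -> Omega -> R).
Hypothesis chain : markov_chain q P X J.
Local Notation Z := (jump_chain X J).
Local Notation gen t :=
  [set A | exists (s : R) (B : set S), 0 <= s <= t /\ A = X s @^-1` B].
Local Notation FX t := (@measurable _ (g_sigma_algebraType (gen t))).
Local Notation hist n := (history X J n).
Let qI : intensity_matrix q := mc_intensity chain.

Lemma historyI n A B : hist n A -> hist n B -> hist n (A `&` B).
Proof.
exact: (@measurableI _ (g_sigma_algebraType [set A | exists2 k, (k <= n)%N &
  (exists B : set S, A = Z k @^-1` B) \/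
  (exists2 B : set R, measurable B & A = J k @^-1` B)])).
Qed.

Lemma history_le m n A : (m <= n)%N -> hist m A -> hist n A.
Proof.
move=> mn; apply: (@sub_sigma_algebra2 Omega setT) => B [k km H].
by exists k => //; exact: leq_trans mn.
Qed.

Lemma history_J k n (B : set R) : (k <= n)%N -> measurable B ->
  hist n (J k @^-1` B).
Proof. by move=> kn mB; apply: sub_sigma_algebra; exists k => //; right; exists B. Qed.

Lemma history_Z k n (B : set S) : (k <= n)%N -> hist n (Z k @^-1` B).
Proof. by move=> kn; apply: sub_sigma_algebra; exists k => //; left; exists B. Qed.

Lemma FX_measurable t (A : set Omega) : FX t A -> d.-measurable A.
Proof.
apply: smallest_sub; first exact: sigma_algebra_measurable.
move=> _ [s [B [/andP[s0 _] ->]]]; exact: (mc_measurable chain).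
Qed.

Lemma measurable_Z k (B : set S) : measurable (Z k @^-1` B).
Proof.
rewrite (_ : _ @^-1` _ = \bigcup_n [set w | J k w <= n%:R /\ B (Z k w)]).
  apply: bigcupT_measurable => n; apply: (@FX_measurable n%:R).
  exact: (FX_jump chain).
apply/seteqP; split => [w BZ|w [n _] [//]].
exists (Num.bound (J k w)) => //; split => //.
by rewrite ltW// archi_boundP// (jump_ge0 chain).
Qed.

Lemma history_measurable n A : hist n A -> measurable A.
Proof.
apply: smallest_sub; first exact: sigma_algebra_measurable.
move=> _ [k kn [[B ->]|[B mB ->]]]; first exact: measurable_Z.
by rewrite -[X in measurable X]setTI; exact: (mc_jump_measurable chain).
Qed.

Lemma measurable_minJ k t : 0 <= t ->
  @measurable_fun _ _ (g_sigma_algebraType (gen t)) R setT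
    (fun w => Num.min (J k w) t).
Proof.
move=> t0; apply: (measurability _ (RGenOInfty.measurableE R)) => // _ [_ [r ->] <-].
rewrite setTI.
have [tr|rt] := leP t r.
  rewrite (_ : _ @^-1` _ = set0)//; apply/seteqP; split => // w /=.
  by rewrite in_itv/= andbT lt_min => /andP[_]; rewrite ltNge tr.
have [r0|r0] := ltP r 0.
  rewrite (_ : _ @^-1` _ = setT)//; apply/seteqP; split => // w _ /=.
  by rewrite in_itv/= andbT lt_min rt (lt_le_trans r0)// (jump_ge0 chain).
rewrite (_ : _ @^-1` _ = ~` [set w | J k w <= r /\ setT (Z k w)]).
  by apply: measurableC; apply: (FX_le (ltW rt)); exact: (FX_jump chain).
apply/seteqP; split => w /=; rewrite in_itv/= andbT lt_min rt andbT ltNge.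
  by move=> /negP wr [].
by move=> H; apply/negP => ?; apply: H.
Qed.

(** The information carried by the first [n] jumps is available at time [t]
    once the [n]th jump has occurred. *)
Lemma history_FX n t A : 0 <= t -> hist n A -> FX t (A `&` [set w | J n w <= t]).
Proof.
move=> t0.
have FJ : FX t [set w | J n w <= t].
  rewrite (_ : [set w | _] = [set w | J n w <= t /\ setT (Z n w)]).
    exact: (FX_jump chain).
  by apply/seteqP; split => w /= => [|[]].
suff : hist n `<=` [set A | FX t (A `&` [set w | J n w <= t])] by apply.
apply: smallest_sub.
  split => [|B FB|F FF] /=.
  - by rewrite set0I.
  - rewrite setTD (_ : _ `&` _ = [set w | J n w <= t] `\` (B `&` [set w | J n w <= t])).
      exact: measurableD.
    rewrite setDE setCI setIUr [X in _ `|` X]setICr setU0.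
    by rewrite setIC.
  - by rewrite setI_bigcupl; exact: bigcupT_measurable.
move=> _ [k kn [[B ->]|[B mB ->]]] /=.
  rewrite (_ : _ `&` _ = [set w | J k w <= t /\ B (Z k w)] `&` [set w | J n w <= t]).
    by apply: measurableI => //; exact: (FX_jump chain).
  apply/seteqP; split => w /= [] => [BZ Jn|[]//].
  by split => //; split => //; rewrite (le_trans _ Jn)// (jump_mono chain).
rewrite (_ : _ `&` _ = (fun w => Num.min (J k w) t) @^-1` B `&` [set w | J n w <= t]).
  apply: measurableI => //; rewrite -[X in measurable X]setTI.
  exact: measurable_minJ.
have E w : J n w <= t -> Num.min (J k w) t = J k w.
  by move=> Jn; apply/min_idPl; rewrite (le_trans _ Jn)// (jump_mono chain).
by apply/seteqP; split => w /= [] + Jn; rewrite E.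
Qed.

Lemma esum_pick (f : S -> \bar R) b : (forall c, 0 <= f c)%E ->
  (\esum_(c in [set: S]) (if b == c then f c else 0) = f b)%E.
Proof.
move=> f0; rewrite -[RHS]esum_set1// esum_mkcond.
rewrite [RHS]esum_mkcond; apply: eq_esum => c _.
rewrite in_setT; case: ifPn => [/eqP<-|bc]; first by rewrite ifT// inE.
by rewrite ifF//; apply/negP; rewrite inE /= => /esym/eqP; rewrite (negbTE bc).
Qed.

Lemma integral_partition (mu : {measure set Omega -> \bar R}) (A : set Omega)
    (Y : Omega -> S) (f : Omega -> \bar R) :
  measurable A -> (forall a, measurable (Y @^-1` [set a])) ->
  measurable_fun A f -> (forall w, A w -> 0 <= f w)%E ->
  (\int[mu]_(w in A) f w =
   \esum_(a in [set: S]) \int[mu]_(w in A `&` Y @^-1` [set a]) f w)%E.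
Proof.
move=> mA mY mf f0.
have E a : (\int[mu]_(w in A `&` Y @^-1` [set a]) f w =
    \int[mu]_(w in A) (if Y w == a then f w else 0))%E.
  rewrite integral_mkcondr; apply: eq_integral => w _.
  by rewrite patchE; case: eqP => [Ya|Ya]; [rewrite mem_set|rewrite memNset].
under eq_esum do rewrite E.
rewrite -integral_esum//.
- by apply: eq_integral => w /set_mem Aw; rewrite (@esum_pick (fun=> f w))// => _; exact: f0.
- move=> a; apply: measurable_fun_if => //.
    apply: measurable_funTS; apply: (measurable_fun_bool true) => //; rewrite setTI.
    rewrite (_ : _ @^-1` _ = Y @^-1` [set a])//.
    by apply/seteqP; split => w /= /eqP.
  by apply: measurable_funS mf => // w [].
- by move=> a w Aw; case: ifP => // _; exact: f0.
Qed.

Local Open Scope ereal_scope.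

Lemma step_esum h phi f u a : nnmeas h -> nnmeas phi -> nnmeas f ->
  step q h phi f u a =
  \esum_(b in [set: S]) ((jump_prob q a b)%:E * \int[sojourn_law qI a]_s
    (if s%:E <= h u a then f (u + s)%R b else phi (u + fine (h u a))%R a)).
Proof.
move=> nh [mphi phi0] [mf f0]; rewrite /step /jump_kernel.
have mif b : measurable_fun setT (fun s : measurableTypeR R =>
    if s%:E <= h u a then f (u + s)%R b else phi (u + fine (h u a))%R a).
  apply: measurable_fun_ifT => //.
    by apply: measurable_fun_lee => //; exact: measurable_cst.
  by apply: (measurableT_comp (mf b)); exact: measurable_funD.
transitivity (\int[sojourn_law qI a]_s \esum_(b in [set: S])
    ((jump_prob q a b)%:E * (if s%:E <= h u a then f (u + s)%R b
      else phi (u + fine (h u a))%R a))).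
  congr (integral _ _ _); apply/funext => s; case: ifP => // _.
  by rewrite -/(after_jump q a (fun=> _)) (after_jump_cst qI).
rewrite integral_esum//.
- apply: eq_esum => b _; rewrite ge0_integralZl ?lee_fin ?(jump_prob_ge0 qI)//.
  by move=> s _; case: ifP.
- by move=> b; apply: emeasurable_funM.
- move=> b s _; rewrite mule_ge0 ?lee_fin ?(jump_prob_ge0 qI)//.
  by case: ifP.
Qed.

(** The Markov property at the [k]th jump. Fixing the states before and after
    the jump, the law of the chain makes the date of the [k]th jump and the
    following sojourn time an independent pair on each event of the history. *)
Lemma integral_step i k A h phi f t : hist k A ->
  nnmeas h -> nnmeas phi -> nnmeas f ->
  \int[P i]_(w in A) step q h phi f (t + J k w)%R (Z k w) =
  \int[P i]_(w in A)
    (if (J k.+1 w - J k w)%:E <= h (t + J k w)%R (Z k w)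
     then f (t + J k.+1 w)%R (Z k.+1 w)
     else phi (t + J k w + fine (h (t + J k w)%R (Z k w)))%R (Z k w)).
Proof.
move=> hA nh nphi nf; have [mphi phi0] := nphi; have [mf f0] := nf.
have mA := history_measurable hA.
have mJ n : measurable_fun setT (J n) by exact: (mc_jump_measurable chain).
have mZ n a : measurable (Z n @^-1` [set a]) by exact: measurable_Z.
have mtJ n : measurable_fun setT (fun w => t + J n w)%R by exact: measurable_funD.
have mD : measurable_fun setT (fun w => J k.+1 w - J k w)%R by exact: measurable_funB.
pose Psi a b (z : R * R) :=
  if z.2%:E <= h (t + z.1)%R a then f (t + (z.1 + z.2))%R b
  else phi (t + (z.1 + fine (h (t + z.1)%R a)))%R a.
have Psi0 a b z : 0 <= Psi a b z by rewrite /Psi; case: ifP.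
have mPsi a b : measurable_fun setT (Psi a b).
  apply: (measurable_before_jump (h := fun r => h (t + r)%R)
    (phi := fun r => phi (t + r)%R) (G := fun z => f (t + (z.1 + z.2))%R b)).
  - exact: nnmeas_shift.
  - exact: nnmeas_shift.
  - apply: (measurableT_comp (mf b)); apply: measurable_funD => //.
    exact: measurable_funD.
have mPsiJ a b : measurable_fun setT (fun w => Psi a b (J k w, (J k.+1 w - J k w)%R)).
  apply: (measurableT_comp (mPsi a b)); exact: measurable_fun_pair.
have mG a b : measurable_fun setT (fun r => \int[sojourn_law qI a]_s Psi a b (r, s)).
  apply: (@measurable_fun_fubini_tonelli_F _ _ R (measurableTypeR R) R
    (sojourn_law qI a) (Psi a b)); [exact: mPsi|by move=> z; exact: Psi0].
have G0 a b r : 0 <= \int[sojourn_law qI a]_s Psi a b (r, s).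
  by apply: integral_ge0 => s _; exact: Psi0.
transitivity (\int[P i]_(w in A)
    Psi (Z k w) (Z k.+1 w) (J k w, (J k.+1 w - J k w)%R)); last first.
  apply: eq_integral => w _; rewrite /Psi /=.
  by rewrite -[(J k w + _)%R in X in f X]addrC subrK addrA.
have nst : nnmeas (step q h phi f) by exact: nnmeas_step.
rewrite (integral_partition _ mA (mZ k)); last 2 first.
- apply: measurable_funTS.
  apply: (measurable_on_partition (Y := Z k) (f := fun a w => step q h phi f (t + J k w)%R a)) => // a.
  by apply: (measurableT_comp (proj1 nst a)).
- by move=> w _; exact: (proj2 nst).
rewrite [RHS](integral_partition _ mA (mZ k)); last 2 first.
- apply: measurable_funTS.
  apply: (measurable_on_partition (Y := Z k) (f := fun a w =>
    Psi a (Z k.+1 w) (J k w, (J k.+1 w - J k w)%R))) => // a.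
  exact: (measurable_on_partition (Y := Z k.+1) (f := fun b w =>
    Psi a b (J k w, (J k.+1 w - J k w)%R))).
- by move=> w _; exact: Psi0.
apply: eq_esum => a _; set Aa := A `&` _.
have hAa : hist k Aa by apply: historyI => //; exact: history_Z.
have mAa := history_measurable hAa.
rewrite [RHS](integral_partition _ mAa (mZ k.+1)); last 2 first.
- apply: measurable_funTS.
  apply: (measurable_on_partition (Y := Z k) (f := fun a w =>
    Psi a (Z k.+1 w) (J k w, (J k.+1 w - J k w)%R))) => // c.
  exact: (measurable_on_partition (Y := Z k.+1) (f := fun b w =>
    Psi c b (J k w, (J k.+1 w - J k w)%R))).
- by move=> w _; exact: Psi0.
transitivity (\int[P i]_(w in Aa) \esum_(b in [set: S])
    ((jump_prob q a b)%:E * \int[sojourn_law qI a]_s Psi a b (J k w, s))).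
  apply: eq_integral => w /set_mem [_ /= ->]; rewrite step_esum//.
  apply: eq_esum => b _; congr (_ * _); apply: eq_integral => s _.
  by rewrite /Psi /= !addrA.
rewrite integral_esum//; last 2 first.
- move=> b; apply: emeasurable_funM => //.
  by apply: measurable_funTS; exact: (measurableT_comp (mG a b)).
- by move=> b w _; rewrite mule_ge0// lee_fin (jump_prob_ge0 qI).
apply: eq_esum => b _.
rewrite ge0_integralZl ?lee_fin ?(jump_prob_ge0 qI)//; last first.
  by apply: measurable_funTS; exact: (measurableT_comp (mG a b)).
transitivity (\int[P i]_(w in Aa `&` Z k.+1 @^-1` [set b])
    Psi a b (J k w, (J k.+1 w - J k w)%R)); last first.
  by apply: eq_integral => w /set_mem [[_ /= ->] /= ->].
rewrite (@ge0_integral_independent_pair R _ _ _ Omega R (measurableTypeR R)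
  (P i) Aa _ (J k) (fun w => J k.+1 w - J k w)%R (sojourn_law qI a) (jump_prob q a b))//.
- exact: measurableI.
- exact: (jump_prob_ge0 qI).
move=> B1 B2 mB1 mB2; rewrite /jump_prob; case: ifPn => [/eqP ba|ba].
  rewrite mule0 (_ : _ `&` _ = set0) ?measure0//; apply/seteqP; split => // w.
  move=> [[[_ /= Za] /= Zb] _]; have := mc_jump_neq chain k w.
  by rewrite Za Zb ba eqxx.
have hAB : hist k (A `&` J k @^-1` B1) by apply: historyI => //; exact: history_J.
have := mc_law chain i hAB ba mB2.
rewrite [X in P i X = _](_ : _ = Aa `&` Z k.+1 @^-1` [set b] `&`
  (J k @^-1` B1 `&` (fun w => J k.+1 w - J k w)%R @^-1` B2)); last first.
  by apply/seteqP; split => w /=; [move=> [[? ?] []]|move=> [[[? ?] ?] []]].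
rewrite [X in _ = P i X * _ * _](_ : _ = Aa `&` J k @^-1` B1)//.
by apply/seteqP; split => w /=; [move=> [[? ?] ?]|move=> [[? ?] ?]].
exact: mPsi.
Qed.

End OneJumpLaw.

(** * Markovian stopping times *)

Section MarkovTimes.
Context {R : realType} {S : countType} {d : measure_display}
  {Omega : measurableType d}.
Variables (q : S -> S -> R) (P : S -> probability Omega R)
  (X : R -> Omega -> S) (J : nat -> Omega -> R).
Hypothesis chain : markov_chain q P X J.
Local Notation Z := (jump_chain X J).
Local Notation gen t :=
  [set A | exists (s : R) (B : set S), 0 <= s <= t /\ A = X s @^-1` B].
Local Notation FX t := (@measurable _ (g_sigma_algebraType (gen t))).
Local Notation hist n := (history X J n).
Local Notation hgen n := [set A | exists2 k, (k <= n)%N &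
        (exists B : set S, A = Z k @^-1` B) \/
        (exists2 B : set R, measurable B & A = J k @^-1` B)].
Local Notation HT n := (g_sigma_algebraType (hgen n)).
Let qI : intensity_matrix q := mc_intensity chain.
Local Open Scope ereal_scope.

Section OneRule.
Variables (h : nat -> R -> S -> \bar R) (t : R).
Hypothesis nh : forall k, nnmeas (h k).

Definition wait (k : nat) (w : Omega) : \bar R := h k (t + J k w)%R (Z k w).
Definition stops (k : nat) : set Omega := [set w | stops_at X J h t w k].
Definition alive (n : nat) : set Omega := \bigcap_(k in [set k | (k < n)%N]) ~` stops k.
Definition first_stop (k : nat) : set Omega := alive k `&` stops k.

Lemma wait_ge0 k w : 0 <= wait k w.
Proof. exact: (proj2 (nh k)). Qed.

Lemma stopsP k w : stops k w <-> (J k w)%:E + wait k w < (J k.+1 w)%:E.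
Proof. exact: iff_refl. Qed.

Lemma alive0 : alive 0 = setT.
Proof. by apply/seteqP; split. Qed.

Lemma aliveS n : alive n.+1 = alive n `\` stops n.
Proof.
apply/seteqP; split => [w Aw|w [Aw nw] k /= kn].
  by split => [k /= kn|]; apply: Aw => //=; rewrite ltnS ltnW.
by move: kn; rewrite ltnS leq_eqVlt => /predU1P[->//|kn]; exact: Aw.
Qed.

Lemma stops_fin k w : stops k w -> wait k w \is a fin_num.
Proof.
move=> /stopsP; have := wait_ge0 k w; case: (wait k w) => //.
Qed.

Lemma markov_time_first k w : first_stop k w ->
  markov_time X J h t w = (J k w)%:E + wait k w.
Proof.
move=> [Aw sw]; rewrite /markov_time; case: pselect => [ex|nex]; last first.
  by exfalso; apply: nex; exists k.
case: ex_minnP => m sm minm; suff -> : m = k by [].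
apply/eqP; rewrite eqn_leq minm//= leqNgt; apply/negP => mk.
exact: (Aw m mk).
Qed.

Lemma markov_time_never w : (forall k, ~ stops k w) -> markov_time X J h t w = +oo.
Proof.
move=> ns; rewrite /markov_time; case: pselect => // -[k sk].
by have := ns k.
Qed.

Lemma first_or_never w : (exists k, first_stop k w) \/ (forall k, ~ stops k w).
Proof.
have [ex|nex] := pselect (exists k, stops_at X J h t w k); last first.
  by right => k sk; apply: nex; exists k.
left; case: (ex_minnP ex) => m sm minm; exists m; split => // k /= km sk.
by have := minm _ sk; rewrite leqNgt km.
Qed.

Lemma markov_time_finite w : markov_time X J h t w < +oo <-> exists k, first_stop k w.
Proof.
split => [|[k fk]].
  have [//|ns] := first_or_never w.
  by rewrite markov_time_never.
rewrite (markov_time_first fk).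
by have := stops_fin fk.2; case: (wait k w) => // r _; rewrite -EFinD ltry.
Qed.

Lemma trivIset_first_stop : trivIset setT first_stop.
Proof.
apply: ltn_trivIset => m n mn; apply/seteqP; split => // w [[_ sn] [Am _]].
exact: (Am n mn sn).
Qed.

Lemma alive_le_markov_time n w :
  alive n w <-> (J n w)%:E <= markov_time X J h t w.
Proof.
have [[k fk]|ns] := first_or_never w; last first.
  rewrite markov_time_never// leey; split => // _ k _; exact: ns.
rewrite (markov_time_first fk); split => [An|Jn].
  have nk : (n <= k)%N.
    by rewrite leqNgt; apply/negP => kn; exact: (An k kn fk.2).
  by rewrite (@le_trans _ _ (J k w)%:E)// ?lee_fin ?(jump_mono chain)// leeDl// wait_ge0.
move=> m /= mn sm; have mk : ~ (m < k)%N by move=> mk; exact: (fk.1 m mk).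
have kn : (k < n)%N by rewrite (leq_ltn_trans _ mn)// leqNgt; apply/negP.
have := lt_le_trans fk.2 (_ : (J k.+1 w)%:E <= (J n w)%:E).
rewrite lee_fin (jump_mono chain)// => /(_ isT) /(le_lt_trans Jn).
by rewrite ltxx.
Qed.

Lemma measurable_HT_J k n : (k <= n)%N -> @measurable_fun _ _ (HT n) R setT (J k).
Proof. by move=> kn _ B mB; rewrite setTI; exact: history_J. Qed.

Lemma measurable_HT_Z k n (B : set S) : (k <= n)%N ->
  @measurable _ (HT n) (Z k @^-1` B).
Proof. by move=> kn; exact: history_Z. Qed.

Lemma measurable_HT_wait k n : (k <= n)%N ->
  @measurable_fun _ _ (HT n) (\bar R) setT (wait k).
Proof.
move=> kn; apply: (measurable_on_partition (T := HT n) (Y := Z k)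
  (f := fun a w => h k (t + J k w)%R a)) => // a.
  exact: (measurable_HT_Z [set a]).
apply: (measurableT_comp (proj1 (nh k) a)); apply: measurable_funD => //.
exact: measurable_HT_J.
Qed.

Lemma hist_stops k n : (k < n)%N -> hist n (stops k).
Proof.
move=> kn; have := @measurable_lte _ (HT n) R setT measurableT
  (fun w => (J k w)%:E + wait k w) (fun w => (J k.+1 w)%:E).
rewrite setTI; apply.
- apply: emeasurable_funD; last by apply: measurable_HT_wait; exact: ltnW.
  by apply/measurable_EFinP; by apply: measurable_HT_J; exact: ltnW.
- by apply/measurable_EFinP; exact: measurable_HT_J.
Qed.

Lemma hist_alive n : hist n (alive n).
Proof.
elim: n => [|n IH]; first by rewrite alive0; exact: (@measurableT _ (HT 0)).
rewrite aliveS; apply: (@measurableD _ (HT n.+1)); last exact: hist_stops.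
exact: (history_le (leqnSn n) IH).
Qed.

Lemma hist_first_stop k : hist k.+1 (first_stop k).
Proof.
apply: (@measurableI _ (HT k.+1)); last exact: hist_stops.
exact: (history_le (leqnSn k) (@hist_alive k)).
Qed.

(** Whether a stop planned at the [k]th jump takes place is known at its date,
    since it only depends on the next jump not having happened before. *)
Lemma markov_time_adapted (s : R) : (0 <= s)%R ->
  natural_filtration X s [set w | markov_time X J h t w <= s%:E].
Proof.
move=> s0; rewrite natural_filtrationE.
pose r k w := (J k w)%:E + wait k w.
have mr k n : (k <= n)%N -> @measurable_fun _ _ (HT n) (\bar R) setT (r k).
  move=> kn; apply: emeasurable_funD; last exact: measurable_HT_wait.
  by apply/measurable_EFinP; exact: measurable_HT_J.
pose E k := alive k `&` [set w | r k w <= s%:E].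
have hE k : hist k (E k).
  apply: (@measurableI _ (HT k)); first exact: hist_alive.
  rewrite -[X in measurable X]setTI.
  apply: (@measurable_lee _ (HT k) R setT measurableT (r k) (cst s%:E)).
    exact: mr.
  exact: measurable_cst.
pose L k := [set w | (J k.+1 w)%:E <= r k w].
have hL k : hist k.+1 (L k).
  rewrite -[X in history _ _ _ X]setTI.
  apply: (@measurable_lee _ (HT k.+1) R setT measurableT
    (fun w => (J k.+1 w)%:E) (r k)); last exact: mr.
  by apply/measurable_EFinP; exact: measurable_HT_J.
rewrite (_ : [set w | _] = \bigcup_k ((E k `&` [set w | (J k w <= s)%R]) `\`
    (L k `&` E k `&` [set w | (J k.+1 w <= s)%R]))); last first.
  apply/seteqP; split => [w /= ts|w [k _] [[[Ak rk] /= Jk] nL]].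
    have /markov_time_finite [k fk] : markov_time X J h t w < +oo.
      by rewrite (le_lt_trans ts)// ltry.
    move: ts; rewrite (markov_time_first fk) => rs; exists k => //.
    split; first split; first by split => //; exact: fk.1.
      rewrite /= -lee_fin (le_trans _ rs)//.
      by rewrite leeDl// wait_ge0.
    by move=> [[Lw _] _]; have := lt_le_trans fk.2 Lw; rewrite ltxx.
  have fk : first_stop k w.
    split => //; apply/stopsP; rewrite ltNge; apply/negP => Lw.
    apply: nL; split; first by split.
    by rewrite /= -lee_fin (le_trans Lw).
  by rewrite /= (markov_time_first fk).
apply: bigcupT_measurable => k; apply: measurableD.
  exact: (history_FX chain).
apply: (history_FX chain) => //; apply: historyI => //.
exact: (history_le (leqnSn k) (hE k)).
Qed.

Definition payoff (phi : R -> S -> \bar R) (k : nat) (w : Omega) : \bar R :=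
  phi (t + J k w + fine (wait k w))%R (Z k w).

Lemma first_stop_payoff phi k w : first_stop k w ->
  phi (t + fine (markov_time X J h t w))%R (X (fine (markov_time X J h t w)) w) =
  payoff phi k w.
Proof.
move=> fk; rewrite (markov_time_first fk) fineD ?stops_fin//; last exact: fk.2.
rewrite /= addrA (_ : X _ w = Z k w)//.
apply: (jump_X chain); rewrite lerDl fine_ge0 ?wait_ge0//=.
have := fk.2; rewrite /stops /stops_at /= -/(wait k w).
by rewrite -[wait k w]fineK ?stops_fin//; exact: fk.2.
Qed.

Lemma measurable_J k : measurable_fun setT (J k).
Proof. exact: (mc_jump_measurable chain). Qed.

Lemma measurable_at_jump (f : R -> S -> \bar R) k :
  (forall a, measurable_fun setT (f ^~ a)) ->
  measurable_fun setT (fun w => f (t + J k w)%R (Z k w)).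
Proof.
move=> mf; apply: (measurable_on_partition (Y := Z k) (f := fun a w => f (t + J k w)%R a)) => // a.
  exact: (measurable_Z chain).
apply: (measurableT_comp (mf a)); apply: measurable_funD => //; exact: measurable_J.
Qed.

Lemma measurable_wait k : measurable_fun setT (wait k).
Proof. by apply: measurable_at_jump; case: (nh k). Qed.

Lemma measurable_payoff (phi : R -> S -> \bar R) k :
  (forall a, measurable_fun setT (phi ^~ a)) ->
  measurable_fun setT (payoff phi k).
Proof.
move=> mphi; apply: (measurable_on_partition (Y := Z k)
  (f := fun a w => phi (t + J k w + fine (wait k w))%R a)) => // a.
  exact: (measurable_Z chain).
apply: (measurableT_comp (mphi a)); apply: measurable_funD.
  by apply: measurable_funD => //; exact: measurable_J.
by apply: measurableT_comp; [exact: fine_measurable|exact: measurable_wait].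
Qed.

Lemma measurable_first_stop k : measurable (first_stop k).
Proof. exact: (history_measurable chain (@hist_first_stop k)). Qed.

Lemma measurable_alive k : measurable (alive k).
Proof. exact: (history_measurable chain (@hist_alive k)). Qed.

Lemma setIUD_stops k : alive k = first_stop k `|` alive k.+1.
Proof.
rewrite aliveS; apply/seteqP; split => [w Aw|w [] []//].
by have [sw|sw] := pselect (stops k w); [left|right].
Qed.

Lemma integral_alive_step i k phi f : nnmeas phi -> nnmeas f ->
  \int[P i]_(w in alive k) step q (h k) phi f (t + J k w)%R (Z k w) =
  \int[P i]_(w in first_stop k) payoff phi k w +
  \int[P i]_(w in alive k.+1) f (t + J k.+1 w)%R (Z k.+1 w).
Proof.
move=> nphi nf; have [mphi phi0] := nphi; have [mf f0] := nf.
rewrite (integral_step chain) //; last exact: hist_alive.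
have stopsE w : alive k w ->
    stops k w <-> ~ ((J k.+1 w - J k w)%:E <= wait k w).
  move=> Aw; rewrite stopsP EFinB leeBlDr// addeC.
  by split => [H|/negP]; [apply/negP; rewrite -ltNge|rewrite -ltNge].
transitivity (\int[P i]_(w in first_stop k `|` alive k.+1)
  (if w \in stops k then payoff phi k w else f (t + J k.+1 w)%R (Z k.+1 w))).
  rewrite -setIUD_stops; apply: eq_integral => w /set_mem Aw.
  rewrite -/(wait k w) -/(payoff phi k w).
  case: ifPn => [c|/negP c]; first by rewrite memNset// => /(stopsE _ Aw).
  by rewrite mem_set//; exact/stopsE.
rewrite ge0_integral_setU//.
- congr (_ + _); apply: eq_integral => w; rewrite ?aliveS => /set_mem[_ ws].
    by rewrite mem_set.
  by rewrite memNset.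
- exact: measurable_first_stop.
- exact: measurable_alive.
- rewrite -setIUD_stops.
  apply: measurable_fun_if; first exact: measurable_alive.
  + apply: measurable_funTS; apply: (measurable_fun_bool true) => //; rewrite setTI.
    rewrite (_ : _ @^-1` _ = stops k).
      exact: (history_measurable chain (@hist_stops k k.+1 (ltnSn k))).
    by apply/seteqP; split => w /=; [move=> /set_mem|move=> /mem_set].
  + by apply: measurable_funTS; exact: measurable_payoff.
  + by apply: measurable_funTS; exact: measurable_at_jump.
- by move=> w _; case: ifP => _; [exact: phi0|exact: f0].
- rewrite aliveS; apply/eqP/seteqP; split => // w [[_ ws] [_ nws]].
  exact: nws.
Qed.

End OneRule.

Lemma integral_alive_nested m k i h t phi f : (forall k, nnmeas (h k)) ->
  nnmeas phi -> nnmeas f ->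
  \int[P i]_(w in alive h t k)
    nested q m (fun l => h (k + l)%N) phi f (t + J k w)%R (Z k w) =
  \sum_(0 <= l < m) \int[P i]_(w in first_stop h t (k + l)%N) payoff h t phi (k + l)%N w +
  \int[P i]_(w in alive h t (k + m)%N) f (t + J (k + m)%N w)%R (Z (k + m)%N w).
Proof.
move=> nh nphi nf; elim: m k => [|m IH] k.
  by rewrite big_nil add0e addn0.
rewrite /= addn0 integral_alive_step//; last first.
  by apply: nnmeas_nested.
have := IH k.+1; rewrite (_ : (fun l => h (k.+1 + l)%N) = (fun l => h (k + l.+1)%N)).
  move=> ->; rewrite addSnnS [in RHS]big_nat_recl// addn0 -[RHS]addeA.
  congr adde; congr adde.
  by apply: eq_bigr => l _; rewrite addSnnS.
by apply/funext => l; rewrite addSnnS.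
Qed.

(** Iterating the Markov property turns the nested value into expectations
    along the chain: of the rewards collected by the rules which stop before the
    [n]th jump, and of the terminal reward on the event that none does. *)
Lemma nestedE n i h t phi f : (forall k, nnmeas (h k)) ->
  nnmeas phi -> nnmeas f ->
  nested q n h phi f t i =
  \sum_(0 <= l < n) \int[P i]_(w in first_stop h t l) payoff h t phi l w +
  \int[P i]_(w in alive h t n) f (t + J n w)%R (Z n w).
Proof.
move=> nh nphi nf; have := integral_alive_nested n 0 i t nh nphi nf.
rewrite add0n => <-; rewrite alive0.
have nn : nnmeas (nested q n h phi f) by exact: nnmeas_nested.
have mX0 : measurable (X 0%R @^-1` [set i]) by exact: (mc_measurable chain).
have PN0 : P i (~` (X 0%R @^-1` [set i])) = 0.
  rewrite probability_setC// [X in 1 - X](_ : _ = 1) ?subee//.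
  exact: (mc_start chain).
rewrite (ge0_negligible_integral (N := ~` (X 0%R @^-1` [set i])))//; last 3 first.
- exact: measurableC.
- by apply: measurable_at_jump; case: nn.
- by move=> w _; case: nn.
rewrite setDE setCK setTI -[LHS]mule1 -(mc_start chain i) -integral_cst//.
apply: eq_integral => w /set_mem /= Xi.
by rewrite /jump_chain (mc_jump0 chain) addr0 Xi.
Qed.

(** Random times evaluate the chain at a random date; splitting along the
    countably many values of this index makes such rewards measurable. *)
Definition stop_index h t (w : Omega) : option nat :=
  if pselect (exists k, first_stop h t k w) is left ex then Some (projT1 (cid ex))
  else None.

Lemma stop_index_preimage h t o : (forall k, nnmeas (h k)) ->
  stop_index h t @^-1` [set o] =
  if o is Some k then first_stop h t k else ~` \bigcup_k first_stop h t k.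
Proof.
move=> nh; rewrite /stop_index; case: o => [k|]; apply/seteqP; split => w /=.
- by case: pselect => // ex; case: cid => /= m fm [<-].
- move=> fk; case: pselect => [ex|nex]; last by exfalso; apply: nex; exists k.
  case: cid => /= m fm; congr Some.
  by apply: (@trivIset_first_stop h t m k I I); exists w.
- by case: pselect => // nex _ [m _ fm]; apply: nex; exists m.
- move=> nw; case: pselect => // -[m fm]; exfalso; apply: nw.
  by exists m.
Qed.

Definition reward h t (phi : R -> S -> \bar R) (w : Omega) : \bar R :=
  phi (t + fine (markov_time X J h t w))%R (X (fine (markov_time X J h t w)) w).

Lemma measurable_reward h t phi : (forall k, nnmeas (h k)) ->
  (forall a, measurable_fun setT (phi ^~ a)) ->
  measurable_fun setT (reward h t phi).
Proof.
move=> nh mphi.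
pose f (o : option nat) w := if o is Some k then payoff h t phi k w
  else phi (t + J 0 w)%R (Z 0 w).
have -> : reward h t phi = fun w => f (stop_index h t w) w.
  apply/funext => w; rewrite /reward /stop_index; case: pselect => [ex|nex] /=.
    by case: cid => /= k fk; rewrite -(first_stop_payoff nh phi fk).
  have [[k fk]|ns] := first_or_never h t w; first by exfalso; apply: nex; exists k.
  by rewrite markov_time_never//= /jump_chain (mc_jump0 chain).
apply: (measurable_on_partition (Y := stop_index h t) (f := f)) => //.
- move=> o; rewrite stop_index_preimage//.
  case: o => [k|]; first exact: measurable_first_stop.
  by apply/measurableC/bigcupT_measurable => k; exact: measurable_first_stop.
- case=> [k|]; first exact: measurable_payoff.
  exact: measurable_at_jump.
Qed.

Lemma finite_markov_timeE h t : (forall k, nnmeas (h k)) ->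
  [set w | markov_time X J h t w < +oo] = \bigcup_k first_stop h t k.
Proof.
by move=> nh; apply/seteqP; split => [w /= /(markov_time_finite t nh)[k fk]|w [k _ fk]];
  [exists k|apply/(markov_time_finite t nh); exists k].
Qed.

(** The terminal contributions vanish, so that the partial sums of [nestedE]
    converge to the sum over all the possible indices of the stopping jump. *)
Lemma eventualE i h t phi : (forall k, nnmeas (h k)) -> nnmeas phi ->
  eventual q h phi t i =
  \int[P i]_(w in [set w | markov_time X J h t w < +oo]) reward h t phi w.
Proof.
move=> nh nphi; rewrite finite_markov_timeE// ge0_integral_bigcup//.
- rewrite /eventual; congr (limn _); apply/funext => n.
  rewrite nestedE//.
  rewrite [X in _ + X]integral0_eq// adde0; apply: eq_bigr => l _.
  by apply: eq_integral => w /set_mem fl; rewrite -(first_stop_payoff nh phi fl).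
- by move=> k; exact: measurable_first_stop.
- by apply: measurable_funTS; apply: measurable_reward => //; case: nphi.
- by move=> w _; case: nphi => _; exact.
- exact: trivIset_first_stop.
Qed.

Lemma probability_markov_time_finite i h t : (forall k, nnmeas (h k)) ->
  P i [set w | markov_time X J h t w < +oo] = eventual q h (fun _ _ => 1) t i.
Proof.
move=> nh; rewrite eventualE//.
have mfin : measurable [set w | markov_time X J h t w < +oo].
  rewrite finite_markov_timeE//; apply: bigcupT_measurable => k.
  exact: measurable_first_stop.
rewrite [RHS](_ : _ = \int[P i]_(w in [set w | markov_time X J h t w < +oo]) (cst 1 w))//.
by rewrite integral_cst// mul1e.
Qed.

Lemma integral_reward i h t phi : (forall k, nnmeas (h k)) -> nnmeas phi ->
  P i [set w | markov_time X J h t w < +oo] = 1 ->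
  \int[P i]_w reward h t phi w = eventual q h phi t i.
Proof.
move=> nh nphi P1; rewrite eventualE//.
have mfin : measurable [set w | markov_time X J h t w < +oo].
  rewrite finite_markov_timeE//; apply: bigcupT_measurable => k.
  exact: measurable_first_stop.
have PN0 : P i (~` [set w | markov_time X J h t w < +oo]) = 0.
  by rewrite probability_setC// P1 subee.
rewrite (ge0_negligible_integral (N := ~` [set w | markov_time X J h t w < +oo]))//.
- by rewrite setDE setCK setTI.
- exact: measurableC.
- by apply: measurable_reward => //; case: nphi.
- by move=> w _; case: nphi => _; exact.
Qed.

Lemma markov_time_ge0 h t w : (forall k, nnmeas (h k)) ->
  0 <= markov_time X J h t w.
Proof.
move=> nh; apply: le_trans (_ : (J 0 w)%:E <= _).
  by rewrite (mc_jump0 chain).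
apply/(alive_le_markov_time t nh); rewrite alive0//.
Qed.

Lemma stopping_time_markov h t : (forall k, nnmeas (h k)) ->
  (forall i, P i [set w | markov_time X J h t w < +oo] = 1) ->
  stopping_time P X (markov_time X J h t).
Proof.
move=> nh P1; split => [w|s s0|//]; first exact: markov_time_ge0.
exact: markov_time_adapted.
Qed.

End MarkovTimes.

(** * Computations with exponential sojourn times *)

Section KernelComputations.
Context {R : realType} {S : countType}.
Variable q : S -> S -> R.
Hypothesis qI : intensity_matrix q.
Local Open Scope ereal_scope.
Local Notation rate := (rate q).
Local Notation mu := lebesgue_measure.

Lemma sojourn_tail a (x : R) : (0 <= x)%R ->
  sojourn_law qI a [set s | (x <= s)%R] = (expR (- (rate a * x)))%:E.
Proof.
move=> x0.
have r0 := rate_gt0 qI a.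
have mS : measurable [set s : R | (x <= s)%R].
  by rewrite (_ : [set s | _] = `[x, +oo[%classic)//; apply/seteqP; split => s /=; rewrite in_itv/= andbT.
have E0 : sojourn_law qI a `]-oo, 0%R[%classic = 0.
  rewrite /= /exponential_prob integral0_eq// => s /=; rewrite in_itv/= => s0.
  by rewrite lt0_exponential_pdf.
have E1 : sojourn_law qI a `[0%R, x[%classic = 1 - (expR (- (rate a * x)))%:E.
  move: x0; rewrite le_eqVlt => /predU1P[<-|x0].
    by rewrite set_itvco0 measure0 mulr0 oppr0 expR0 subee.
  rewrite -mulNr -(exponential_prob_itv0c (rate a) x0) /= /exponential_prob.
  rewrite -integral_itv_bndo_bndc//.
  apply/measurable_EFinP; apply: measurable_funTS; exact: measurable_exponential_pdf.
have -> : [set s : R | (x <= s)%R] = ~` (`]-oo, 0%R[%classic `|` `[0%R, x[%classic).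
  apply/seteqP; split => s /=; rewrite !in_itv/=.
    by move=> xs [|/andP[_]]; rewrite ltNge ?(le_trans x0 xs)// xs.
  move=> H; rewrite leNgt; apply/negP => sx; apply: H.
  by have [s0|s0] := ltP s 0%R; [left|right].
rewrite probability_setC//; last exact: measurableU.
rewrite measureU//; last first.
  by apply/seteqP; split => // s /= []; rewrite !in_itv/= => s0 /andP[]; rewrite leNgt s0.
transitivity (1 - (0 + (1 - (expR (- (rate a * x)))%:E))).
  by congr (_ - _); congr (_ + _).
by rewrite add0e -!EFinB opprB addrC subrK.
Qed.

(** The mean of the sojourn time truncated at [theta] is the probability of a
    jump before [theta] divided by the rate: integrate the tail over [0, theta]
    and recognise the density. *)
Lemma jump_kernel_time a theta : 0 <= theta ->
  (rate a)%:E * jump_kernel q a theta (fine theta)%:E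
    (fun s _ => (Num.max s 0)%:E) =
  jump_kernel q a theta 0 (fun _ _ => 1).
Proof.
move=> theta0; have r0 := rate_gt0 qI a.
pose I : set R := [set x | (0 <= x)%R /\ x%:E <= theta].
have mI : measurable I.
  apply: measurableI.
    by rewrite [X in measurable X](_ : _ = `[0%R, +oo[%classic)//; apply/seteqP; split => s /=; rewrite in_itv/= andbT.
  rewrite -[X in measurable X]setTI; apply: measurable_lee => //; exact: measurable_cst.
pose f (z : R * R) : \bar R := (\1_I z.2)%:E * (\1_[set z | (z.2 <= z.1)%R] z)%:E.
have mle : measurable [set z : R * R | (z.2 <= z.1)%R].
  rewrite -[X in measurable X]setTI; apply: measurable_fun_le => //.
have mf : measurable_fun setT f.
  apply: emeasurable_funM; apply/measurable_EFinP; last exact: measurable_indic.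
  by apply: measurableT_comp; [exact: measurable_indic|exact: measurable_snd].
have f0 z : 0 <= f z by rewrite mule_ge0// lee_fin.
have L s : \int[mu]_x f (s, x) =
    if s%:E <= theta then (Num.max s 0)%:E else (fine theta)%:E.
  have -> : \int[mu]_x f (s, x) = mu [set x | I x /\ (x <= s)%R].
    rewrite -[X in _ = mu X]setIT -integral_indic//; last first.
      apply: measurableI => //.
      by rewrite [X in measurable X](_ : _ = `]-oo, s]%classic)//; apply/seteqP; split => r /=; rewrite in_itv.
    apply: eq_integral => x _; rewrite /f /= !indicE -EFinM -natrM mulnb.
    congr ((nat_of_bool _)%:R%:E); apply/idP/idP.
      by move=> /andP[/set_mem Ix /set_mem xs]; apply/mem_set; split.
    by move=> /set_mem[Ix xs]; apply/andP; split; apply/mem_set.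
  have muI b : (0 <= b)%R -> mu `[0%R, b]%classic = b%:E.
    move=> b0; rewrite lebesgue_measure_itv/= lte_fin; case: ltP => b1.
      by rewrite oppr0 addr0.
    by apply/eqP; rewrite eqe eq_le b0 b1.
  have [s0|s0] := ltP s 0%R.
    rewrite ifT; last by rewrite (le_trans _ theta0)// lee_fin ltW.
    rewrite (_ : [set x | _] = set0) ?measure0 ?(max_r (ltW s0))//.
    apply/seteqP; split => // x [[x0 _] xs].
    by move: (lt_le_trans s0 x0); rewrite ltNge xs.
  case: ifPn => sth.
    rewrite (_ : [set x | _] = `[0%R, s]%classic) ?muI// ?(max_l s0)//.
    apply/seteqP; split => x /=; rewrite in_itv/=; first by move=> [[-> _] ->].
    by move=> /andP[x0 xs]; do 2!split => //; rewrite (le_trans _ sth)// lee_fin.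
  have thf : theta \is a fin_num.
    rewrite ge0_fin_numE//; move: sth; rewrite -ltNge => /lt_trans; apply.
    exact: ltry.
  move: sth; rewrite -(fineK thf) lee_fin -ltNge => ths.
  rewrite (_ : [set x | _] = `[0%R, fine theta]%classic) ?muI// ?fine_ge0//.
  apply/seteqP; split => [x [[x0 xth] _]|x]; rewrite /= in_itv/=.
    by rewrite x0 -lee_fin fineK.
  move=> /andP[x0 xth]; split; last by rewrite (le_trans xth)// ltW.
  by split => //; rewrite -(fineK thf) lee_fin.
have -> : jump_kernel q a theta (fine theta)%:E (fun s _ => (Num.max s 0)%:E) =
    \int[sojourn_law qI a]_s \int[mu]_x f (s, x).
  congr (integral _ _ _); apply/funext => s; rewrite L.
  by rewrite (after_jump_cst qI)// lee_fin le_max lexx orbT.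
rewrite (fubini_tonelli (m1 := sojourn_law qI a) (m2 := mu))//.
transitivity (\int[mu]_(x in I) (exponential_pdf (rate a) x)%:E).
  rewrite -ge0_integralZl ?lee_fin ?(ltW r0)//; last 2 first.
  - exact: (@measurable_fun_fubini_tonelli_G _ _ _ _ _ (sojourn_law qI a)).
  - by move=> x _; exact: integral_ge0.
  rewrite [RHS]integral_mkcond; apply: eq_integral => x _; rewrite patchE.
  rewrite /f /=; case: ifPn => xI; last first.
    rewrite integral0_eq ?mule0// => s _.
    by rewrite indicE (negbTE xI) mul0e.
  have x0 : (0 <= x)%R by move: xI => /set_mem[].
  rewrite exponential_pdfE// EFinM; congr (_ * _).
  rewrite mulNr -(sojourn_tail a x0).
  transitivity (\int[sojourn_law qI a]_s (\1_[set s | (x <= s)%R] s)%:E).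
    congr (integral _ _ _); apply/funext => s.
    by rewrite indicE xI mul1e !indicE.
  rewrite integral_indic ?setIT//.
  by rewrite [X in measurable X](_ : _ = `[x, +oo[%classic)//; apply/seteqP; split => s /=; rewrite in_itv/= andbT.
pose V : set R := [set s | s%:E <= theta].
transitivity (\int[sojourn_law qI a]_s (\1_V s)%:E); last first.
  congr (integral _ _ _); apply/funext => s; rewrite (after_jump_cst qI)// indicE.
  by case: ifPn => sth; [rewrite mem_set|rewrite memNset//; exact/negP].
rewrite integral_indic//; last first.
  rewrite -[X in measurable X]setTI; apply: measurable_lee => //; exact: measurable_cst.
rewrite setIT /= /exponential_prob [LHS]integral_mkcond [RHS]integral_mkcond.
apply: eq_integral => x _; rewrite !patchE.
have [x0|x0] := ltP x 0%R; first by rewrite lt0_exponential_pdf//; case: ifP; case: ifP.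
congr (if _ then _ else _); apply/idP/idP => /set_mem.
  by move=> [_ xth]; rewrite inE.
by move=> xth; rewrite inE.
Qed.

Lemma jump_kernelZl a theta x F k : (0 <= k)%R -> 0 <= x -> nnmeas F ->
  jump_kernel q a theta (k%:E * x) (fun s b => k%:E * F s b) =
  k%:E * jump_kernel q a theta x F.
Proof.
move=> k0 x0 nF; rewrite /jump_kernel.
rewrite -(@ge0_integralZl _ _ _ (sojourn_law qI a))//; last 2 first.
- exact: (measurable_jump_kernel qI).
- by move=> s _; apply: (jump_kernel_integrand_ge0 qI).
congr (integral _ _ _); apply/funext => s; case: ifP => // _.
rewrite /after_jump -esumZl//; last first.
  by move=> b; rewrite mule_ge0 ?lee_fin ?(jump_prob_ge0 qI)//; case: nF.
by apply: eq_esum => b _; rewrite muleCA.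
Qed.

Lemma after_jumpZl a k (F : S -> \bar R) : (0 <= k)%R -> (forall b, 0 <= F b) ->
  after_jump q a (fun b => k%:E * F b) = k%:E * after_jump q a F.
Proof.
move=> k0 F0; rewrite /after_jump -esumZl//; last first.
  by move=> b; rewrite mule_ge0 ?lee_fin ?(jump_prob_ge0 qI).
by apply: eq_esum => b _; rewrite muleCA.
Qed.

Lemma jump_kernel0 a x F : 0 <= x -> nnmeas F -> jump_kernel q a 0 x F = x.
Proof.
move=> x0 nF; pose N : set R := [set s | s%:E <= 0].
have mN : measurable N.
  rewrite -[X in measurable X]setTI; apply: measurable_lee => //; exact: measurable_cst.
have N0 : sojourn_law qI a N = 0.
  transitivity (jump_kernel q a 0 0 (fun _ _ => 1)).
    transitivity (sojourn_law qI a (N `&` setT)); first by rewrite setIT.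
    rewrite -integral_indic//.
    congr (integral _ _ _); apply/funext => s; rewrite (after_jump_cst qI)// indicE.
    by case: ifPn => sth; [rewrite mem_set|rewrite memNset//; exact/negP].
  rewrite -jump_kernel_time// [X in _ * X](_ : _ = 0) ?mule0//.
  apply: (@integral0_eq _ _ _ (sojourn_law qI a)) => s _; rewrite (after_jump_cst qI).
    by case: ifPn => //; rewrite lee_fin => s0; rewrite max_r.
  by rewrite lee_fin le_max lexx orbT.
rewrite -[RHS](jump_kernel_cst qI a 0 x0) /jump_kernel.
rewrite (@ge0_negligible_integral _ _ _ (sojourn_law qI a) setT N)//=; last 2 first.
- exact: (measurable_jump_kernel qI).
- by move=> s _; exact: (jump_kernel_integrand_ge0 qI).
rewrite [RHS](@ge0_negligible_integral _ _ _ (sojourn_law qI a) setT N)//=; last 2 first.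
- by apply: (measurable_jump_kernel qI); exact: nnmeas_cst.
- by move=> s _; apply: (jump_kernel_integrand_ge0 qI) => //; exact: nnmeas_cst.
apply: (@eq_integral _ _ _ (sojourn_law qI a)) => s /set_mem [_ /= /negP]; rewrite /N /=.
by move=> /negbTE ->.
Qed.

Lemma step_stop (h phi f : R -> S -> \bar R) u a : nnmeas phi -> nnmeas f -> h u a = 0 ->
  step q h phi f u a = phi u a.
Proof.
move=> nphi nf h0; rewrite /step h0 jump_kernel0 ?addr0//.
  by case: nphi.
exact: nnmeas_shift.
Qed.

(** A rule that stops at once in every state makes what follows irrelevant. *)
Lemma nested_horizon n m h phi f f' u a : (forall k, nnmeas (h k)) ->
  nnmeas phi -> nnmeas f -> nnmeas f' -> (forall v b, h n v b = 0) ->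
  nested q (n.+1 + m) h phi f u a = nested q n.+1 h phi f' u a.
Proof.
move=> nh nphi nf nf'; elim: n h nh u a => [|n IH] h nh u a h0.
  rewrite /= !step_stop//; apply: nnmeas_nested => // k; exact: nh.
have E : nested q (n.+1 + m) (fun k => h k.+1) phi f =
    nested q n.+1 (fun k => h k.+1) phi f'.
  by apply/funext => v; apply/funext => b; apply: IH => // k; exact: nh.
exact: (congr1 (fun F => step q (h 0%N) phi F u a) E).
Qed.

Lemma eventual_horizon n h phi u a : (forall k, nnmeas (h k)) ->
  nnmeas phi -> (forall v b, h n v b = 0) ->
  eventual q h phi u a = nested q n.+1 h phi (fun _ _ => 0) u a.
Proof.
move=> nh nphi h0; apply/cvg_lim => //; apply: cvg_near_cst.
exists n.+1 => // m /= nm; rewrite -(subnKC nm).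
by apply: nested_horizon => //; exact: nnmeas_cst.
Qed.

Lemma jump_kernel_infty a x y F : jump_kernel q a +oo x F = jump_kernel q a +oo y F.
Proof. by congr (integral _ _ _); apply/funext => s; rewrite leey. Qed.

(** A process which gains at most the running cost at each jump is still at
    most compensated by that cost when it is stopped between jumps. *)
Lemma step_supermartingale (K gp : S -> R) (c A B sigma : R) h (u : R) (a : S) :
  (0 <= c)%R -> (0 <= A)%R -> (0 <= B)%R -> (0 <= sigma)%R -> (0 <= u)%R ->
  (forall b, 0 <= gp b)%R -> (forall b, gp b <= K b)%R ->
  after_jump q a (fun b => (K b)%:E) <= (K a + c / rate a)%:E ->
  nnmeas h ->
  step q h (fun v _ => (B + sigma * c * Num.max v 0)%:E)
           (fun v _ => (B + sigma * c * Num.max v 0)%:E) u a < +oo /\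
  step q h (fun _ b => (A + sigma * gp b)%:E) (fun _ b => (A + sigma * K b)%:E) u a +
    (B + sigma * c * Num.max u 0)%:E <=
  step q h (fun v _ => (B + sigma * c * Num.max v 0)%:E)
           (fun v _ => (B + sigma * c * Num.max v 0)%:E) u a +
    (A + sigma * K a)%:E.
Proof.
move=> c0 A0 B0 s0 u0 gp0 gpK Ksup [_ h0].
have r0 := rate_gt0 qI a.
have K0 b : (0 <= K b)%R by exact: le_trans (gpK b).
set theta := h u a; have th0 : 0 <= theta by exact: h0.
pose T := jump_kernel q a theta (fine theta)%:E (fun s _ => (Num.max s 0)%:E).
have nT : nnmeas (fun s (_ : S) => (Num.max s (0 : R))%:E).
  split => [b|s b]; last by rewrite lee_fin le_max lexx orbT.
  by apply/measurable_EFinP; apply: measurable_maxr.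
have T0 : 0 <= T by apply: (jump_kernel_ge0 qI) => //; rewrite lee_fin fine_ge0.
have sc0 : (0 <= sigma * c)%R by rewrite mulr_ge0.
have AK0 b : (0 <= A + sigma * K b)%R by rewrite addr_ge0// mulr_ge0.
have AKr0 : (0 <= sigma * (c / rate a))%R by rewrite mulr_ge0// divr_ge0// ltW.
have lhs : step q h (fun _ b => (A + sigma * gp b)%:E)
    (fun _ b => (A + sigma * K b)%:E) u a <= (A + sigma * K a)%:E + (sigma * c)%:E * T.
  apply: (@le_trans _ _ (jump_kernel q a theta ((A + sigma * K a)%:E + 0)
    (fun _ _ => (A + sigma * K a)%:E + (sigma * (c / rate a))%:E))).
    apply: (le_jump_kernel_after qI).
    - by rewrite lee_fin addr_ge0// mulr_ge0.
    - by split => [b|s b]; [exact: measurable_cst|rewrite lee_fin].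
    - by apply: nnmeas_cst; rewrite -EFinD lee_fin addr_ge0.
    - by rewrite adde0 lee_fin lerD2l ler_wpM2l.
    - move=> s _; rewrite (after_jump_cst qI); last by rewrite -EFinD lee_fin addr_ge0.
      have -> : (fun b => (A + sigma * K b)%:E) = (fun b => A%:E + sigma%:E * (K b)%:E).
        by apply/funext => b; rewrite EFinD EFinM.
      rewrite (after_jumpD qI)//; last by move=> b; rewrite mule_ge0// lee_fin.
      rewrite (after_jump_cst qI)// after_jumpZl//.
      rewrite EFinD -addeA leeD2l// -EFinD -mulrDr EFinM.
      by apply: lee_wpmul2l.
  rewrite (jump_kernelD qI) ?lee_fin//; last by apply: nnmeas_cst; rewrite lee_fin.
  rewrite (jump_kernel_cst qI) ?lee_fin// leeD2l//.
  rewrite (_ : (fun=> _) = fun (_ : R) (_ : S) => (sigma * (c / rate a))%:E * 1); last first.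
    by apply/funext => ?; apply/funext => ?; rewrite mule1.
  rewrite -[X in jump_kernel _ _ _ X _](mule0 (sigma * (c / rate a))%:E).
  rewrite jump_kernelZl//.
  rewrite -jump_kernel_time// -/T muleA -EFinM.
  by rewrite mulrA -[(_ / _ * _)%R]mulrA mulVf ?mulr1// gt_eqF.
have rhs : step q h (fun v _ => (B + sigma * c * Num.max v 0)%:E)
           (fun v _ => (B + sigma * c * Num.max v 0)%:E) u a =
    (B + sigma * c * u)%:E + (sigma * c)%:E * T.
  rewrite /T -jump_kernelZl//; last by rewrite lee_fin fine_ge0.
  rewrite -[X in _ = X + _](jump_kernel_cst qI a theta) ?lee_fin ?addr_ge0 ?mulr_ge0//.
  have nsT : nnmeas (fun s (_ : S) => (sigma * c)%:E * (Num.max s (0 : R))%:E).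
    split => [b|s b]; last by rewrite mule_ge0 ?lee_fin// le_max lexx orbT.
    by apply: emeasurable_funM; [exact: measurable_cst|exact: (proj1 nT b)].
  rewrite -(jump_kernelD qI)//; last 3 first.
  - by rewrite lee_fin addr_ge0// mulr_ge0.
  - by rewrite mule_ge0 ?lee_fin// fine_ge0.
  - by apply: nnmeas_cst; rewrite lee_fin addr_ge0// mulr_ge0.
  rewrite /step -/theta (_ : (_ + _)%:E = (B + sigma * c * u)%:E +
      (sigma * c)%:E * (fine theta)%:E); last first.
    rewrite max_l ?addr_ge0 ?fine_ge0//.
    by rewrite -EFinM -EFinD mulrDr addrA.
  apply: (eq_jump_kernel qI).
  - by rewrite -EFinM -EFinD lee_fin !addr_ge0 ?mulr_ge0// fine_ge0.
  - split => [b|s b]; last by rewrite lee_fin addr_ge0// mulr_ge0// le_max lexx orbT.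
    apply/measurable_EFinP; apply: measurable_funD => //; apply: measurable_funM => //.
    by apply: measurable_maxr => //; exact: measurable_funD.
  - apply: nnmeasD => //; apply: nnmeas_cst.
    by rewrite lee_fin addr_ge0// mulr_ge0.
  - move=> s b s1; rewrite max_l ?addr_ge0// max_l//.
    by rewrite -EFinM -EFinD mulrDr addrA.
have Tfin : T < +oo.
  have : (rate a)%:E * T <= 1.
    rewrite jump_kernel_time// -[leRHS](jump_kernel_cst qI a theta)//.
    by apply: (le_jump_kernel qI) => //; exact: nnmeas_cst.
  move: T0 => T0 rT; rewrite ltey; apply: contraTneq rT => ->.
  by rewrite gt0_muley ?lte_fin// -ltNge ltry.
split; first by rewrite rhs lte_add_pinfty ?ltry// lte_mul_pinfty.
rewrite rhs max_l//; apply: (le_trans (leeD2r _ lhs)).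
by rewrite addeC addeA [leLHS]addeAC.
Qed.

End KernelComputations.

(** * Inequalities between differences of extended reals *)

Section ExtendedDifferences.
Context {R : realType}.
Local Open Scope ereal_scope.
Implicit Types a b p m : \bar R.

Lemma ge0_subeE p m a b : 0 <= p -> 0 <= m -> 0 <= a -> 0 <= b ->
  p + b = a + m -> p <= a -> m <= b -> (a < +oo) || (b < +oo) -> p - m = a - b.
Proof.
case: p => [p||] //; case: m => [m||] //; case: a => [a||] //;
  case: b => [b||] // _ _ _ _.
by rewrite -!EFinD => -[E] _ _ _; congr (_%:E); move: E; clear; lra.
Qed.

(** [p - m <= a - b] is implied by its rearrangement without differences: when
    [m] is infinite the left-hand side is [-oo]. *)
Lemma ge0_lee_sub p m a b : 0 <= p -> 0 <= m -> 0 <= a -> 0 <= b ->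
  a < +oo -> p + b <= m + a -> p - m <= a - b.
Proof.
case: m => [m||] //; last by move=> *; rewrite addeNy leNye.
case: a => [a||] //; case: p => [p||] //; case: b => [b||] //.
by rewrite -!EFinD !lee_fin => _ _ _ _ _; clear; lra.
Qed.

Lemma lee_sub_ge0 p m a b : 0 <= p -> 0 <= m -> 0 <= a -> 0 <= b ->
  a < +oo -> p - m <= a - b -> p + b <= m + a.
Proof.
case: m => [m||] //; last by case: a => [a||] // *; rewrite addye// leey.
case: a => [a||] //; case: p => [p||] //; case: b => [b||] //.
by rewrite -!EFinD !lee_fin => _ _ _ _ _; clear; lra.
Qed.

(** Adding the two inequalities and cancelling [y] and [z]: if [z] is infinite
    then so is [a], and nothing remains to be proved. *)
Lemma lee_cancel_add (x m y z a b : \bar R) :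
  0 <= x -> 0 <= m -> 0 <= z -> 0 <= y -> 0 <= a -> 0 <= b -> y < +oo ->
  x + y <= m + z -> z + b <= y + a -> x + b <= m + a.
Proof.
case: y => [y||] //; case: m => [m||] //; last by case: a => [a||] // *; rewrite addye// leey.
case: a => [a||] //; last by move=> *; rewrite addey// leey.
case: z => [z||] //; case: x => [x||] //; case: b => [b||] //.
by rewrite -!EFinD !lee_fin => _ _ _ _ _ _ _; clear; lra.
Qed.

(** In the application, [p - n] is the value function, [ra - rb] a majorant of
    it, [e] their gap and [x] the expected gap after one step; the other letters
    are the expectations after one step of gains, losses and majorants. *)
Lemma lee_of_balance (x l y b a e p n : \bar R) (ra rb : R) :
  0 <= x -> 0 <= l -> 0 <= y -> 0 <= b -> 0 <= a -> 0 <= e -> 0 <= n ->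
  p \is a fin_num -> b < +oo -> y < +oo ->
  x + b + y = a + l -> p + l <= n + y -> a + rb%:E <= b + ra%:E ->
  e + rb%:E + p = ra%:E + n -> x <= e.
Proof.
case: e => [e||] //; last by move=> *; rewrite leey.
case: p => [p||] //; case: b => [b||] //; case: y => [y||] //; case: n => [n||] //.
case: l => [l||] //; case: a => [a||] //; case: x => [x||] //.
rewrite -!EFinD !lee_fin => _ _ _ _ _ _ _ _ _ _ [e1] e2 e3 [e4].
by move: e1 e2 e3 e4; clear; lra.
Qed.

(** The positive and negative parts of a difference of nonnegative numbers are
    at most its terms, even when [+oo - +oo] is read as [-oo]. *)
Lemma maxe_subE (x y : \bar R) : 0 <= x -> 0 <= y ->
  [/\ maxe (x - y) 0 + y = x + maxe (- (x - y)) 0, maxe (x - y) 0 <= x &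
      maxe (- (x - y)) 0 <= y].
Proof.
case: x => [x||] //; case: y => [y||] //.
- rewrite !lee_fin -!EFinD -!EFinN -!EFin_max !lee_fin -!EFinD => x0 y0.
  have [xy|xy] := leP 0%R (x - y)%R.
    by rewrite max_r ?oppr_le0//; split; [congr (_%:E)| |]; move: x0 y0 xy; clear; lra.
  rewrite max_l ?oppr_ge0 ?(ltW xy)//.
  by split; [congr (_%:E)| |]; move: x0 y0 xy; clear; lra.
- by move=> x0 _; rewrite addeNy (_ : - -oo = +oo)// maxNye maxye !addey// leey; split.
- by move=> _ y0; rewrite addye// maxye (_ : - +oo = -oo)// maxNye addye// adde0 leey; split.
- by move=> _ _; rewrite addeNy (_ : - -oo = +oo)// maxNye maxye addey// leey; split.
Qed.

Lemma ge0_integralB_cond d (T : measurableType d) (mu : {measure set T -> \bar R})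
    (D : set T) (f1 f2 : T -> \bar R) : measurable D ->
  measurable_fun D f1 -> measurable_fun D f2 ->
  (forall x, D x -> 0 <= f1 x) -> (forall x, D x -> 0 <= f2 x) ->
  (\int[mu]_(x in D) f1 x < +oo) || (\int[mu]_(x in D) f2 x < +oo) ->
  \int[mu]_(x in D) (f1 x - f2 x) =
  \int[mu]_(x in D) f1 x - \int[mu]_(x in D) f2 x.
Proof.
move=> mD mf1 mf2 f10 f20 fin; rewrite integralE.
have mB : measurable_fun D (fun x => f1 x - f2 x) by exact: emeasurable_funB.
have mp := measurable_funepos mB; have mn := measurable_funeneg mB.
have E x : D x -> _ := fun Dx => maxe_subE (f10 x Dx) (f20 x Dx).
apply: ge0_subeE => //; try by apply: integral_ge0.
- rewrite -!ge0_integralD//; apply: eq_integral => x /set_mem Dx.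
  by rewrite funeposE funenegE; case: (E x Dx).
- by apply: ge0_le_integral => // x Dx; rewrite funeposE; case: (E x Dx).
- by apply: ge0_le_integral => // x Dx; rewrite funenegE; case: (E x Dx).
Qed.

Lemma le_integral_ereal d (T : measurableType d) (mu : {measure set T -> \bar R})
    (D : set T) (f1 f2 : T -> \bar R) : measurable D ->
  measurable_fun D f1 -> measurable_fun D f2 ->
  (forall x, D x -> f1 x <= f2 x) ->
  \int[mu]_(x in D) f1 x <= \int[mu]_(x in D) f2 x.
Proof.
move=> mD mf1 mf2 f12; rewrite integralE [leRHS]integralE; apply: leeB.
- apply: ge0_le_integral => //; try exact: measurable_funepos.
  by move=> x Dx; rewrite !funeposE ge_max !le_max lexx orbT f12.
- apply: ge0_le_integral => //; try exact: measurable_funeneg.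
  by move=> x Dx; rewrite !funenegE ge_max !le_max lexx orbT leeN2 f12.
Qed.

End ExtendedDifferences.

(** * Rules at negative times *)

Section TotalRules.
Context {R : realType} {S : countType} {d : measure_display}
  {Omega : measurableType d}.
Variables (q : S -> S -> R) (P : S -> probability Omega R)
  (X : R -> Omega -> S) (J : nat -> Omega -> R).
Hypothesis chain : markov_chain q P X J.
Local Open Scope ereal_scope.

(** Rules are constrained at nonnegative times only. Stopping at once at negative
    times makes them measurable on the whole line and changes no stopping time. *)
Definition total_rule (h : R -> S -> \bar R) (u : R) (a : S) : \bar R :=
  if (0 <= u)%R then h u a else 0.

Lemma nnmeas_total_rule (h : R -> S -> \bar R) : measurable_rule h -> nnmeas (total_rule h).
Proof.
move=> mh; split => [a|u a]; last first.
  by rewrite /total_rule; case: ifP => // u0; case: (mh a) => + _; exact.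
have [_ ma] := mh a.
rewrite /total_rule; apply: measurable_fun_if => //.
- by apply: measurable_fun_ler.
- by rewrite setTI; apply: eq_measurable_fun ma => u; rewrite inE.
Qed.

Lemma markov_time_total h t w : (0 <= t)%R ->
  markov_time X J (fun k => total_rule (h k)) t w = markov_time X J h t w.
Proof.
move=> t0.
have E k a : total_rule (h k) (t + J k w)%R a = h k (t + J k w)%R a.
  by rewrite /total_rule ifT// addr_ge0// (jump_ge0 chain).
rewrite /markov_time (_ : stops_at X J (fun k => total_rule (h k)) t w = stops_at X J h t w).
  by case: pselect => // ex; rewrite E.
by apply/funext => k; rewrite /stops_at E.
Qed.

Lemma measurable_rule_nnmeas (h : R -> S -> \bar R) : nnmeas h -> measurable_rule h.
Proof.
move=> [mh h0] a; split=> [t _|]; first exact: h0.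
exact: measurable_funTS.
Qed.

End TotalRules.

(** * A superharmonic majorant of the reward *)

Section Superharmonic.
Context {R : realType} {S : countType} {d : measure_display}
  {Omega : measurableType d}.
Variables (q : S -> S -> R) (P : S -> probability Omega R)
  (X : R -> Omega -> S) (J : nat -> Omega -> R) (g : S -> R) (c : R).
Hypothesis chain : markov_chain q P X J.
Hypothesis c_gt0 : 0 < c.
Hypothesis hA1 : A1 P X g c.
Local Notation Z := (jump_chain X J).
Let qI : intensity_matrix q := mc_intensity chain.
Local Open Scope ereal_scope.

Definition gpos (a : S) : R := Num.max (g a) 0%R.

Lemma gpos_ge0 a : (0 <= gpos a)%R.
Proof. by rewrite /gpos le_max lexx orbT. Qed.

(** Value iteration for the linear reward with at most [n] jumps, moving on
    only from the finitely many states of code below [n]: finiteness keeps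
    the expected cost of every iterate finite. *)
Fixpoint iterate (n : nat) (a : S) : \bar R :=
  if n is m.+1 then
    if (pickle a < m)%N then
      maxe (gpos a)%:E (after_jump q a (iterate m) - (c / rate q a)%:E)
    else (gpos a)%:E
  else (gpos a)%:E.

Lemma gpos_le_iterate n a : (gpos a)%:E <= iterate n a.
Proof. by case: n => //= n; case: ifP => // _; rewrite le_max lexx. Qed.

Lemma iterate_ge0 n a : 0 <= iterate n a.
Proof. by apply: le_trans (gpos_le_iterate n a); rewrite lee_fin gpos_ge0. Qed.

Lemma iterate_nd a : {homo iterate ^~ a : m n / (m <= n)%N >-> m <= n}.
Proof.
apply/nondecreasing_seqP => n; elim: n a => [|n IH] a; first exact: (gpos_le_iterate 1).
rewrite [leLHS]/= [leRHS]/=; case: ifPn => an; last first.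
  by case: ifP => // _; rewrite le_max lexx.
rewrite ltnS (ltnW an) le_max2//.
by rewrite leeD2r//; apply: (le_after_jump qI) => // b; exact: iterate_ge0.
Qed.

Definition moves_on (n : nat) (a : S) : bool :=
  if n is m.+1 then
    (pickle a < m)%N && ((gpos a)%:E < after_jump q a (iterate m) - (c / rate q a)%:E)
  else false.

(** [iterate n.+1] is attained by waiting for the next jump in the states where
    this beats the immediate reward, and [n - k] iterations remain after [k]
    jumps. *)
Definition iterate_rule (n k : nat) : R -> S -> \bar R :=
  fun _ a => if moves_on (n - k) a then +oo else 0.

Lemma nnmeas_iterate_rule n k : nnmeas (iterate_rule n k).
Proof.
split => [a|u a]; first exact: measurable_cst.
by rewrite /iterate_rule; case: ifP.
Qed.

Let nil0 : R -> S -> \bar R := fun _ _ => 0.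
Definition clock : R -> S -> \bar R := fun u _ => (Num.max u 0)%:E.
Let gp : R -> S -> \bar R := fun _ a => (gpos a)%:E.

Lemma nnmeas_clock : nnmeas clock.
Proof.
split => [b|s b]; last by rewrite lee_fin le_max lexx orbT.
by apply/measurable_EFinP; apply: measurable_maxr.
Qed.

Let ngp : nnmeas gp.
Proof. by split => [a|u a]; [exact: measurable_cst|rewrite lee_fin gpos_ge0]. Qed.

Let nn0 : nnmeas nil0. Proof. exact: nnmeas_cst. Qed.

Lemma jump_kernel_infty_const a x F : (forall b, 0 <= F b) ->
  jump_kernel q a +oo x (fun _ => F) = after_jump q a F.
Proof.
move=> F0.
transitivity (\int[sojourn_law qI a]_s (cst (after_jump q a F) s)).
  by congr (integral _ _ _); apply/funext => s; rewrite leey.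
rewrite (integral_cst (sojourn_law qI a) measurableT).
by rewrite [X in _ * X](_ : _ = 1) ?mule1//; exact: (@probability_setT _ _ _ (sojourn_law qI a)).
Qed.

(** The mean sojourn time in [a] is [(rate q a)^-1]. *)
Lemma jump_kernel_clock a u : (0 <= u)%R ->
  jump_kernel q a +oo 0 (fun s _ => clock (u + s)%R a) = (u + (rate q a)^-1)%:E.
Proof.
move=> u0; have r0 := rate_gt0 qI a.
have T1 : jump_kernel q a +oo 0 (fun s _ => (Num.max s 0)%:E) = ((rate q a)^-1)%:E.
  have := jump_kernel_time qI a (leey 0); rewrite /=.
  rewrite [X in _ = X](jump_kernel_infty q a 0 1) (jump_kernel_cst qI)//.
  move=> /(congr1 (fun x => (rate q a)^-1%:E * x)).
  by rewrite muleA -EFinM mulVf ?gt_eqF// mul1e mule1.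
rewrite (_ : jump_kernel _ _ _ _ _ = jump_kernel q a +oo (u%:E + 0)
    (fun s _ => u%:E + (Num.max s 0)%:E)).
  rewrite (jump_kernelD qI) ?lee_fin//; last exact: nnmeas_clock.
  rewrite (jump_kernel_cst qI) ?lee_fin//.
  by rewrite T1 -EFinD.
rewrite adde0 (jump_kernel_infty q a u%:E 0); apply: (eq_jump_kernel qI) => //.
- exact: nnmeas_shift nnmeas_clock.
- apply: nnmeasD; last exact: nnmeas_clock.
  by apply: nnmeas_cst; rewrite lee_fin.
- move=> s b s0; rewrite /clock !max_l ?addr_ge0//.
Qed.

(** The rules of [iterate n] stop by the [n]th jump and wait only in finitely
    many states, whose mean sojourn times are bounded. *)
Lemma nested_clock_fin n : exists B : R, (0 <= B)%R /\ forall u a, (0 <= u)%R ->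
  nested q n.+1 (iterate_rule n) clock nil0 u a <= (u + B)%:E.
Proof.
have nck := nnmeas_clock.
elim: n => [|n [B [B0 IH]]].
  exists 0%R; split => // u a u0; rewrite /= (step_stop qI)//.
  by rewrite /clock max_l// addr0.
pose M := (\sum_(m < n) oapp (fun b : S => (rate q b)^-1) 0 (pickle_inv m))%R.
have term0 m : (0 <= oapp (fun b : S => (rate q b)^-1) 0 (@pickle_inv S m))%R.
  by case: pickle_inv => //= b; rewrite invr_ge0 ltW// (rate_gt0 qI).
have MP a : (pickle a < n)%N -> ((rate q a)^-1 <= M)%R.
  move=> an; rewrite /M (bigD1 (Ordinal an))//= pickleK_inv/= lerDl.
  by apply: sumr_ge0.
have M0 : (0 <= M)%R by apply: sumr_ge0.
exists (B + M)%R; split => [|u a u0]; first by rewrite addr_ge0.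
have ntail k : nnmeas (iterate_rule n.+1 k.+1) by exact: nnmeas_iterate_rule.
set r := iterate_rule n.+1; set N := nested q n.+1 (fun k => r k.+1) clock nil0.
have nN : nnmeas N by exact: nnmeas_nested.
change (step q (r 0%N) clock N u a <= (u + (B + M))%:E).
have [mo|mo] := boolP (moves_on n.+1 a); last first.
  rewrite (step_stop qI)//; last by rewrite /r /iterate_rule subn0 (negbTE mo).
  by rewrite /clock max_l// lee_fin lerDl addr_ge0.
rewrite /step {1}/r /iterate_rule subn0 mo.
rewrite (jump_kernel_infty q a _ (0 + B%:E)).
apply: (@le_trans _ _ (jump_kernel q a +oo (0 + B%:E)
    (fun s _ => clock (u + s)%R a + B%:E))).
  apply: (le_jump_kernel qI).
  - by rewrite add0e lee_fin.
  - exact: nnmeas_shift.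
  - apply: nnmeasD; first exact: (nnmeas_shift u nck).
    by apply: nnmeas_cst; rewrite lee_fin.
  - by [].
  - move=> s b s0; apply: (le_trans (IH _ _ _)); first by rewrite addr_ge0.
    by rewrite /clock max_l ?addr_ge0.
rewrite (jump_kernelD qI) ?lee_fin//; last exact: (nnmeas_shift u nck).
rewrite (jump_kernel_cst qI) ?lee_fin// jump_kernel_clock// -EFinD lee_fin.
rewrite -addrA lerD2l addrC lerD2l MP//.
by move: mo => /andP[].
Qed.

Lemma iterate_le_nested n u a : (0 <= u)%R ->
  iterate n a + c%:E * nested q n.+1 (iterate_rule n) clock nil0 u a <=
  nested q n.+1 (iterate_rule n) gp nil0 u a + (c * u)%:E.
Proof.
have nck := nnmeas_clock.
elim: n u a => [|n IH] u a u0.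
  by rewrite /= !(step_stop qI)// /clock max_l.
set r := iterate_rule n.+1.
have ntail k : nnmeas (r k.+1) by exact: nnmeas_iterate_rule.
set T := nested q n.+1 (fun k => r k.+1) clock nil0.
set G := nested q n.+1 (fun k => r k.+1) gp nil0.
change (iterate n.+1 a + c%:E * step q (r 0%N) clock T u a <=
  step q (r 0%N) gp G u a + (c * u)%:E).
have nT : nnmeas T by apply: nnmeas_nested.
have nG : nnmeas G by apply: nnmeas_nested.
have [mo|mo] := boolP (moves_on n.+1 a); last first.
  have r0 : r 0%N u a = 0 by rewrite /r /iterate_rule subn0 (negbTE mo).
  rewrite !(step_stop qI)// /clock max_l//.
  rewrite (_ : iterate n.+1 a = (gpos a)%:E)//=; case: ifPn => // an.
  by apply/max_idPl; move: mo; rewrite /= an/= -leNgt.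
have /andP[an /ltW gle] := mo.
have rr : r 0%N u a = +oo by rewrite /r /iterate_rule subn0 mo.
rewrite [iterate _ _]/= an (max_idPr gle) /step rr.
rewrite (jump_kernel_infty q a _ 0) [in leRHS](jump_kernel_infty q a _ 0).
have cT0 v b : 0 <= c%:E * T v b.
  by rewrite mule_ge0 ?lee_fin ?(ltW c_gt0)//; case: nT.
have ncT : nnmeas (fun v b => c%:E * T v b).
  by split => // b; apply: emeasurable_funM; [exact: measurable_cst|case: nT].
have nK : nnmeas (fun _ => iterate n).
  by split => [b|_ b]; [exact: measurable_cst|exact: iterate_ge0].
have r0 := rate_gt0 qI a.
have main : after_jump q a (iterate n) + c%:E * jump_kernel q a +oo 0 (fun s => T (u + s)%R)
    <= jump_kernel q a +oo 0 (fun s => G (u + s)%R) + (c * (u + (rate q a)^-1))%:E.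
  have -> : after_jump q a (iterate n) = jump_kernel q a +oo 0 (fun _ => iterate n).
    by rewrite jump_kernel_infty_const//; exact: iterate_ge0.
  have c0 := ltW c_gt0.
  have nT' := nnmeas_shift u nT; have nck' := nnmeas_shift u nck.
  have nG' := nnmeas_shift u nG; have ncT' := nnmeas_shift u ncT.
  have ncck' : nnmeas (fun s b => c%:E * clock (u + s)%R b).
    split => [b|s b]; last by rewrite mule_ge0// (proj2 nck).
    by apply: emeasurable_funM; [exact: measurable_cst|exact: (proj1 nck' b)].
  have e1 := jump_kernelZl qI a +oo c0 (lexx 0) nT'.
  have e2 := jump_kernelZl qI a +oo c0 (lexx 0) nck'.
  have e3 := jump_kernelD qI a +oo (lexx 0) (lexx 0) nK ncT'.
  have e4 := jump_kernelD qI a +oo (lexx 0) (lexx 0) nG' ncck'.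
  rewrite mule0 in e1; rewrite mule0 in e2; rewrite adde0 in e3; rewrite adde0 in e4.
  rewrite EFinM -(jump_kernel_clock a u0) -[X in _ <= _ + X]e2 -e1 -e3 -e4.
  apply: (le_jump_kernel qI) => //.
  - exact: (nnmeasD nK ncT').
  - exact: (nnmeasD nG' ncck').
  - move=> s b s0; apply: (le_trans (IH _ _ _)); first by rewrite addr_ge0.
    by rewrite /clock max_l ?addr_ge0// -EFinM.
by rewrite addeAC leeBlDr// (le_trans main)// mulrDr EFinD addeA.
Qed.

(** (A1) bounds the net reward of the stopping time which attains the iterate;
    its expected cost is finite, so that reward and cost can be separated. *)
Lemma iterate_bounded a : exists M : R, forall n, iterate n a <= M%:E.
Proof.
have nck := nnmeas_clock.
have := hA1 a; set sup := ereal_sup _ => supy.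
suff H n : iterate n a <= sup.
  have := le_trans (iterate_ge0 0 a) (H 0%N).
  by case: sup supy H => // M _ H _; exists M.
have nr k : nnmeas (iterate_rule n k) by exact: nnmeas_iterate_rule.
set h := iterate_rule n; pose tau := markov_time X J h 0.
have fin w : tau w < +oo.
  rewrite /tau; apply/(markov_time_finite X J _ nr); apply: contrapT => nf.
  have [//|ns] := first_or_never X J h 0 w.
  apply: (ns n); rewrite /stops /= /stops_at /h /iterate_rule subnn adde0.
  by rewrite lte_fin (mc_jump_lt chain).
have fT : [set w | tau w < +oo] = setT by apply/seteqP; split => w //= _; exact: fin.
have st : stopping_time P X tau.
  apply: (stopping_time_markov chain) => // i.
  by rewrite -/tau fT probability_setT.
have ev phi : nnmeas phi -> \int[P a]_w reward X J h 0 phi w = nested q n.+1 h phi nil0 0%R a.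
  move=> nphi; rewrite (integral_reward chain)//; last by rewrite -/tau fT probability_setT.
  by apply: (eventual_horizon qI) => // u b; rewrite /h /iterate_rule subnn.
have clockE w : reward X J h 0 clock w = tau w.
  have t0 : 0 <= tau w by exact: (markov_time_ge0 chain).
  rewrite /reward /clock add0r -/tau max_l ?fine_ge0// fineK//.
  by rewrite ge0_fin_numE.
have mrw phi : nnmeas phi -> measurable_fun setT (reward X J h 0 phi).
  by move=> nphi; apply: (measurable_reward chain) => //; case: nphi.
have [B [B0 HB]] := nested_clock_fin n.
have T_fin : nested q n.+1 h clock nil0 0%R a < +oo.
  by rewrite (le_lt_trans (HB 0%R a (lexx _)))// ltry.
have T0 : 0 <= nested q n.+1 h clock nil0 0%R a.
  by case: (nnmeas_nested qI n.+1 nr nck nn0) => _; exact.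
have intc : \int[P a]_w (c%:E * tau w) = c%:E * nested q n.+1 h clock nil0 0%R a.
  rewrite -ev//; rewrite -ge0_integralZl ?lee_fin ?(ltW c_gt0)//.
  - by apply: eq_integral => w _; rewrite clockE.
  - exact: mrw.
  - by move=> w _; rewrite clockE (markov_time_ge0 chain).
apply: (@le_trans _ _ (nested q n.+1 h gp nil0 0%R a - c%:E * nested q n.+1 h clock nil0 0%R a)).
  rewrite leeBrDr; last by apply: fin_numM => //; rewrite ge0_fin_numE.
  by have := iterate_le_nested n a (lexx 0%R); rewrite mulr0 adde0.
apply: ereal_sup_ubound; exists tau => //.
rewrite -intc -ev// ge0_integralB_cond//.
- exact: (mrw gp).
- apply: emeasurable_funM; first exact: measurable_cst.
  by apply: (eq_measurable_fun (reward X J h 0 clock)) (mrw _ nck) => w _; rewrite clockE.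
- by move=> w _; rewrite lee_fin gpos_ge0.
- by move=> w _; rewrite mule_ge0 ?lee_fin ?(ltW c_gt0)// (markov_time_ge0 chain).
- by apply/orP; right; rewrite intc lte_mul_pinfty// lee_fin ltW.
Qed.

(** The limit of value iteration. Every state is eventually among those from
    which moving on is allowed, and the inequality between successive iterates
    passes to the limit by monotone convergence. *)
Lemma exists_superharmonic : exists K : S -> R,
  (forall a, (Num.max (g a) 0 <= K a)%R) /\
  forall a, after_jump q a (fun b => (K b)%:E) <= (K a + c / rate q a)%:E.
Proof.
pose K a := limn (iterate ^~ a).
have cvgK a : iterate ^~ a @ \oo --> K a.
  by apply: ereal_nondecreasing_is_cvgn; exact: iterate_nd.
have leK n a : iterate n a <= K a.
  rewrite /K (cvg_lim _ (ereal_nondecreasing_cvgn (@iterate_nd a)))//.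
  by apply: ereal_sup_ubound; exists n.
have Kfin a : K a \is a fin_num.
  rewrite ge0_fin_numE; last exact: le_trans (iterate_ge0 0 a) (leK 0%N a).
  have [M HM] := iterate_bounded a; rewrite (@le_lt_trans _ _ M%:E) ?ltry//.
  by apply: lime_le; [exact: cvgP (cvgK a)|exact: nearW].
exists (fun a => fine (K a)); split => a.
  by rewrite -lee_fin fineK// (le_trans _ (leK 0%N a))//=.
rewrite (_ : (fun b => (fine (K b))%:E) = K); last by apply/funext => b; rewrite fineK.
rewrite /K (limn_after_jump qI)//; last 2 first.
- by move=> n b; exact: iterate_ge0.
- exact: iterate_nd.
apply: lime_le.
  apply: ereal_nondecreasing_is_cvgn => m n mn; apply: (le_after_jump qI) => b.
    exact: iterate_ge0.
  exact: iterate_nd.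
exists (pickle a).+1 => // n /= an.
rewrite EFinD (fineK (Kfin a)) -leeBlDr//; apply: le_trans (leK n.+1 a).
by rewrite /= an le_max lexx orbT.
Qed.

End Superharmonic.

(** * Affine majorants of a concave utility *)

Section UtilityFacts.
Context {R : realType} {S : countType}.
Variables (g : S -> R) (D : utility_domain R) (U : R -> \bar R).
Hypothesis utilU : utility g D U.
Local Open Scope ereal_scope.

Let Ufin x : dom D x -> U x \is a fin_num. Proof. by case: utilU => + _ _ _ _; apply. Qed.
Let Uout x : ~ dom D x -> U x = -oo. Proof. by case: utilU => _ + _ _ _; apply. Qed.

Definition inner (D0 : utility_domain R) (x : R) : Prop :=
  match D0 with
  | FullLine => True
  | ClosedHalfLine a => (a < x)%R
  | OpenHalfLine a => (a < x)%R
  end.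

Lemma inner_dom x : inner D x -> dom D x.
Proof. by case: (D) => //= a ax; rewrite in_itv/= andbT// ltW. Qed.

Lemma dom_up x y : dom D x -> (x <= y)%R -> dom D y.
Proof.
case: (D) => //= a; rewrite !in_itv/= !andbT => ax xy.
  exact: le_trans xy.
exact: lt_le_trans xy.
Qed.

Lemma inner_below x : inner D x -> exists2 z, dom D z & (z < x)%R.
Proof.
case: (D) => [_|a ax|a ax] /=.
- by exists (x - 1)%R => //; rewrite ltrBlDr ltrDl.
- by exists a => //; rewrite in_itv/= lexx.
- by exists ((a + x) / 2)%R; rewrite ?in_itv/= ?andbT ?midf_lt.
Qed.

Lemma utility_nd x y : (x <= y)%R -> U x <= U y.
Proof.
have [Dx xy|nDx _] := pselect (dom D x); last by rewrite Uout// leNye.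
move: xy; rewrite le_eqVlt => /predU1P[->//|xy].
case: utilU => _ _ /(_ x y Dx (dom_up Dx (ltW xy)) xy) /ltW.
by [].
Qed.

Lemma utility_lty x : U x < +oo.
Proof.
have [Dx|nDx] := pselect (dom D x); last by rewrite Uout.
by have := Ufin Dx; case: (U x) => // r _; rewrite ltry.
Qed.

Definition majorant (C s : R) : Prop := forall y, U y <= (C + s * y)%:E.

Let u (x : R) : R := fine (U x).
Let uE x : dom D x -> U x = (u x)%:E. Proof. by move=> Dx; rewrite /u fineK// Ufin. Qed.

Lemma utility_slopes z x y : dom D z -> (z < x)%R -> (x < y)%R ->
  ((u y - u x) / (y - x) < (u x - u z) / (x - z))%R.
Proof.
move=> Dz zx xy; have Dx := dom_up Dz (ltW zx); have Dy := dom_up Dx (ltW xy).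
have zy := lt_trans zx xy.
pose l := ((y - x) / (y - z))%R.
have yz0 : (0 < y - z)%R by rewrite subr_gt0.
have l01 : (0 < l < 1)%R.
  by rewrite /l divr_gt0 ?subr_gt0//= ltr_pdivrMr// mul1r ltrD2l ltrN2.
case: utilU => _ _ _ /(_ z y l Dz Dy) + _.
rewrite lt_eqF// => /(_ isT l01).
have -> : (l * z + (1 - l) * y)%R = x.
  rewrite /l; field; exact: lt0r_neq0.
rewrite !uE// -!EFinM -EFinD lte_fin => H.
rewrite ltr_pdivrMr ?subr_gt0// mulrAC ltr_pdivlMr ?subr_gt0//.
have : (l * (y - z) = y - x)%R by rewrite /l divfK// gt_eqF.
have xz0 : (0 < x - z)%R by rewrite subr_gt0.
move: H yz0; clear -xz0.
move: (u z) (u y) (u x) => uz uy ux H yz0 lE.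
have := ltr_pM2r yz0 (l * uz + (1 - l) * uy)%R ux; rewrite H => /idP.
have -> : ((l * uz + (1 - l) * uy) * (y - z) = (l * (y - z)) * uz + ((y - z) - l * (y - z)) * uy)%R by ring.
rewrite lE; nra.
Qed.

Lemma utility_increasing x y : dom D x -> (x < y)%R -> (u x < u y)%R.
Proof.
move=> Dx xy; have Dy := dom_up Dx (ltW xy).
by case: utilU => _ _ /(_ x y Dx Dy xy) + _ _; rewrite !uE// lte_fin.
Qed.

(** The supremum of the slopes to the right of [x] is a supergradient: it is
    bounded by the slope of any chord on the left. *)
Lemma supergradient x : inner D x -> exists2 s : R, (0 < s)%R &
  forall y, U y <= (u x + s * (y - x))%:E.
Proof.
move=> ix; have Dx := inner_dom ix; have [z Dz zx] := inner_below ix.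
pose A := [set ((u y - u x) / (y - x))%R | y in [set y | (x < y)%R]].
have A1 : A ((u (x + 1) - u x) / (x + 1 - x))%R.
  by exists (x + 1)%R => //=; rewrite ltrDl.
have ubA w : dom D w -> (w < x)%R -> ubound A ((u x - u w) / (x - w))%R.
  by move=> Dw wx _ [y /= xy <-]; exact/ltW/utility_slopes.
have hsA : has_sup A by split; [exists ((u (x + 1) - u x) / (x + 1 - x))%R|exists ((u x - u z) / (x - z))%R; exact: ubA].
exists (sup A).
  apply: lt_le_trans (ub_le_sup hsA.2 A1).
  have x1 : (x < x + 1)%R by rewrite ltrDl.
  by rewrite divr_gt0 ?subr_gt0//; exact: utility_increasing.
move=> y; have [Dy|nDy] := pselect (dom D y); last by rewrite Uout// leNye.
rewrite uE// lee_fin; have [xy|yx|->] := ltgtP x y.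
- have Ay : A ((u y - u x) / (y - x))%R by exists y.
  have := ub_le_sup hsA.2 Ay; rewrite ler_pdivrMr ?subr_gt0//.
  by lra.
- have := ge_sup hsA.1 (ubA y Dy yx).
  by rewrite ler_pdivlMr ?subr_gt0//; lra.
- by rewrite subrr mulr0 addr0.
Qed.

Lemma majorant_supergradient x s : (forall y, U y <= (u x + s * (y - x))%:E) ->
  majorant (u x - s * x) s.
Proof.
move=> H y; rewrite (le_trans (H y))// lee_fin; lra.
Qed.

Lemma exists_inner : exists x, inner D x.
Proof.
case: (D) => [|a|a] /=; first by exists 0%R.
- by exists (a + 1)%R; rewrite ltrDl.
- by exists (a + 1)%R; rewrite ltrDl.
Qed.

(** Supergradients at two points, whose slopes are separated by strict
    concavity. *)
Lemma two_majorants : exists C1 s1 C2 s2 : R,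
  [/\ (0 < s2)%R, (s2 < s1)%R, majorant C1 s1 & majorant C2 s2].
Proof.
have [x ix] := exists_inner; have Dx := inner_dom ix.
have iy : inner D (x + 2)%R.
  have x2 : (x < x + 2)%R by rewrite ltrDl.
  by case: (D) ix => //= a ax; exact: lt_trans x2.
have [s1 s10 H1] := supergradient ix; have [s2 s20 H2] := supergradient iy.
exists (u x - s1 * x)%R, s1, (u (x + 2) - s2 * (x + 2))%R, s2.
split => //; try exact: majorant_supergradient.
have Dm : dom D (x + 1)%R by apply: (dom_up Dx); rewrite lerDl.
have := @utility_slopes x (x + 1)%R (x + 2)%R Dx; rewrite ltrDl ltrD2l ltr1n.
move=> /(_ ltr01 isT).
have := H1 (x + 1)%R; have := H2 (x + 1)%R; rewrite uE// !lee_fin.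
rewrite (_ : x + 2 - (x + 1) = 1)%R; last by ring.
rewrite (_ : x + 1 - x = 1)%R; last by ring.
rewrite (_ : x + 1 - (x + 2) = - 1)%R; last by ring.
by rewrite !divr1; lra.
Qed.

(** Below the domain of [U], affine majorants of large slope are arbitrarily
    negative. *)
Lemma steep_majorant (x M : R) : ~ inner D (x + 1)%R ->
  exists C s : R, [/\ (0 < s)%R, majorant C s & (C + s * x <= M)%R].
Proof.
move=> nix.
have [a Da xa] : exists2 a, (forall y, dom D y -> (a <= y)%R) & (x + 1 <= a)%R.
  case: (D) nix => //= a /negP; rewrite -leNgt => xa; exists a => // y;
    by rewrite in_itv/= andbT// => /ltW.
have [C1 [s1 [C2 [s2 [s20 s21 m1 m2]]]]] := two_majorants.
pose k := Num.max s2 (C2 + s2 * a - M)%R.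
have k0 : (s2 <= k)%R by rewrite le_max lexx.
have kM : (C2 + s2 * a - M <= k)%R by rewrite le_max lexx orbT.
exists (C2 + s2 * a - k * a)%R, k; split.
- exact: lt_le_trans k0.
- move=> y; have [Dy|nDy] := pselect (dom D y); last by rewrite Uout// leNye.
  rewrite (le_trans (m2 y))// lee_fin; have := Da y Dy.
  by move: k0; nra.
- by have k00 := lt_le_trans s20 k0; move: kM xa k00; nra.
Qed.

(** Optimizing over the majorants recovers [U]. The shift by [1] avoids the
    boundary of the domain, where supergradients need not exist. *)
Lemma le_utility_majorants (v : \bar R) (x : R) :
  (forall C s : R, (0 < s)%R -> majorant C s -> v <= (C + s * x)%:E) ->
  v <= U (x + 1)%R.
Proof.
move=> H; have [ix|nix] := pselect (inner D (x + 1)%R).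
  have [s s0 Hs] := supergradient ix.
  apply: (le_trans (H _ _ s0 (majorant_supergradient Hs))).
  rewrite (uE (inner_dom ix)) lee_fin; move: s0; lra.
suff -> : v = -oo by rewrite leNye.
case: v H => [v||] // H.
- have [C [s [s0 m sM]]] := steep_majorant (v - 1)%R nix.
  by exfalso; have := H _ _ s0 m; rewrite lee_fin; lra.
- have [C [s [s0 m sM]]] := steep_majorant 0%R nix.
  by have := H _ _ s0 m.
Qed.

Lemma time_domainE c t i : (0 < c)%R -> time_domain g c D t i <->
  (0 <= t)%R /\ dom D (g i - c * t)%R.
Proof.
move=> c0; rewrite /time_domain; case: (D) => [|a|a] //=.
- by rewrite in_itv/= andbT lerBrDr -lerBrDl ler_pdivlMr// [(t * _)%R]mulrC lerBrDr addrC -lerBrDr.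
- by rewrite in_itv/= andbT ltr_pdivlMr// [(t * _)%R]mulrC ltrBrDr addrC -ltrBrDr.
Qed.

End UtilityFacts.

(** * Bounds and regularity of the value function *)

Section ValueBounds.
Context {R : realType} {S : countType} {d : measure_display}
  {Omega : measurableType d}.
Variables (q : S -> S -> R) (P : S -> probability Omega R)
  (X : R -> Omega -> S) (J : nat -> Omega -> R) (g : S -> R) (c : R)
  (D : utility_domain R) (U : R -> \bar R).
Hypothesis chain : markov_chain q P X J.
Hypothesis c_gt0 : 0 < c.
Hypothesis utilU : utility g D U.
Hypothesis hA2 : A2 P X J g c U.
Variable K : S -> R.
Hypothesis gK : forall a, (Num.max (g a) 0 <= K a)%R.
Hypothesis K_super : forall a,
  (after_jump q a (fun b => (K b)%:E) <= (K a + c / rate q a)%:E)%E.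
Let qI : intensity_matrix q := mc_intensity chain.
Local Open Scope ereal_scope.
Local Notation nil0 := (fun (_ : R) (_ : S) => 0 : \bar R).
Local Notation value := (value P X J g c D U).

Definition gain (v : R) (a : S) : \bar R := maxe (U (g a - c * v)%R) 0.
Definition loss (v : R) (a : S) : \bar R := maxe (- U (g a - c * v)%R) 0.

Lemma measurable_utility_time a : measurable_fun setT (fun v => U (g a - c * v)%R).
Proof.
apply: measurable_fun_nonincreasing_ereal => // x y _ _ xy.
by apply: (utility_nd utilU); rewrite lerD2l lerN2 ler_pM2l.
Qed.

Lemma nnmeas_gain : nnmeas gain.
Proof.
split => [a|v a]; last by rewrite le_max lexx orbT.
by apply: measurable_maxe; [exact: measurable_utility_time|exact: measurable_cst].
Qed.

Lemma nnmeas_loss : nnmeas loss.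
Proof.
split => [a|v a]; last by rewrite le_max lexx orbT.
apply: measurable_maxe; last exact: measurable_cst.
by apply: measurableT_comp => //; exact: measurable_utility_time.
Qed.

(** Also where the utility is [-oo], the gain being [0] there. *)
Lemma gainB v a : gain v a - loss v a = U (g a - c * v)%R.
Proof.
have := congr1 (fun F => F tt) (funeposneg (fun _ : unit => U (g a - c * v)%R)).
by rewrite funeposE funenegE.
Qed.

Hint Resolve nnmeas_gain nnmeas_loss : core.

(** The expected utility as computed by the recursion over jumps. *)
Definition net h (t : R) (i : S) : \bar R := eventual q h gain t i - eventual q h loss t i.

Lemma expected_utility_net i h t : (forall k, nnmeas (h k)) ->
  P i [set w | markov_time X J h t w < +oo] = 1 ->
  expected_utility P X g c U i t (markov_time X J h t) = net h t i.
Proof.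
move=> nh P1; rewrite /expected_utility integralE /net.
rewrite -(integral_reward chain nh nnmeas_gain P1).
rewrite -(integral_reward chain nh nnmeas_loss P1).
by congr (_ - _); apply: eq_integral => w _; rewrite ?funeposE ?funenegE.
Qed.

Definition truncate (n : nat) (h : nat -> R -> S -> \bar R) (k : nat) : R -> S -> \bar R :=
  if (k < n)%N then h k else nil0.

Lemma nnmeas_truncate n h k : (forall k, nnmeas (h k)) -> nnmeas (truncate n h k).
Proof. by move=> nh; rewrite /truncate; case: ifP => // _; exact: nnmeas_cst. Qed.

Lemma markov_time_truncate n h t w : (forall k, nnmeas (h k)) ->
  markov_time X J (truncate n h) t w = mine (markov_time X J h t w) (J n w)%:E.
Proof.
move=> nh; have nt k := nnmeas_truncate n k nh.
have E k : (k < n)%N -> stops X J (truncate n h) t k w = stops X J h t k w.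
  by move=> kn; rewrite /stops /= /stops_at /truncate kn.
have AE m : (m <= n)%N -> alive X J (truncate n h) t m w = alive X J h t m w.
  move=> mn; apply/propext; split => H k /= km; have := H k km;
  by rewrite /setC /= E// (leq_trans km).
have [An|nAn] := pselect (alive X J h t n w).
  have := An => /(alive_le_markov_time chain t nh) Jn; rewrite (min_idPr Jn).
  have fn : first_stop X J (truncate n h) t n w.
    split; first by rewrite AE.
    rewrite /stops /= /stops_at /truncate ltnn adde0 lte_fin.
    exact: (mc_jump_lt chain).
  by rewrite (markov_time_first fn) /wait /truncate ltnn adde0.
have [[k fk]|ns] := first_or_never X J h t w; last first.
  by exfalso; apply: nAn => k _; exact: ns.
have kn : (k < n)%N.
  rewrite ltnNge; apply/negP => nk; apply: nAn => m /= mn.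
  by apply: fk.1 => /=; exact: leq_trans nk.
have fk' : first_stop X J (truncate n h) t k w.
  by split; [rewrite AE ?(ltnW kn)//; exact: fk.1|rewrite E//; exact: fk.2].
rewrite (markov_time_first fk') (markov_time_first fk) /wait /truncate kn.
rewrite (min_idPl _)//; apply: ltW; apply: lt_le_trans fk.2 _.
by rewrite lee_fin (jump_mono chain).
Qed.

Lemma markov_time_truncate_finite i n h t : (forall k, nnmeas (h k)) ->
  P i [set w | markov_time X J (truncate n h) t w < +oo] = 1.
Proof.
move=> nh; rewrite (_ : [set w | _] = setT) ?probability_setT//.
apply/seteqP; split => w //= _; rewrite markov_time_truncate//.
by rewrite (le_lt_trans (_ : _ <= (J n w)%:E)) ?ltry// ge_min lexx orbT.
Qed.

(** Use the rules [h] from the single point [(u, a)], and stop at once elsewhere: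
    this turns rules which stop almost surely from [(u, a)] into rules which do
    so from everywhere. *)
Definition only_from (u : R) (a : S) (h : nat -> R -> S -> \bar R) (k : nat) : R -> S -> \bar R :=
  if k is 0%N then fun v b => if (v == u) && (b == a) then h 0%N v b else 0 else h k.

Lemma nnmeas_only_from u a h k : (forall k, nnmeas (h k)) -> nnmeas (only_from u a h k).
Proof.
move=> nh; case: k => [|k] //=; split => [b|v b]; last first.
  by case: ifP => // _; exact: (proj2 (nh 0%N)).
case: (b == a); last first.
  by apply: (eq_measurable_fun (cst 0)) => // v _; rewrite andbF.
apply: measurable_fun_ifT => //; last exact: (proj1 (nh 0%N)).
apply: (measurable_fun_bool true) => //; rewrite setTI.
rewrite (_ : _ @^-1` _ = [set u])//; apply/seteqP; split => v /=; rewrite andbT.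
  by move/eqP.
by move=> ->; rewrite eqxx.
Qed.

Lemma eventual_only_from u a h phi : (forall k, nnmeas (h k)) -> nnmeas phi ->
  eventual q (only_from u a h) phi u a = eventual q h phi u a.
Proof.
move=> nh nphi; have no k := nnmeas_only_from u a k nh.
by rewrite (eventual_step qI)// [RHS](eventual_step qI)// /step /= !eqxx.
Qed.

Lemma net_only_from u a h : (forall k, nnmeas (h k)) ->
  net (only_from u a h) u a = net h u a.
Proof. by move=> nh; rewrite /net !eventual_only_from. Qed.

Lemma only_from_finite u a h t i : (forall k, nnmeas (h k)) ->
  P a [set w | markov_time X J h u w < +oo] = 1 ->
  P i [set w | markov_time X J (only_from u a h) t w < +oo] = 1.
Proof.
move=> nh P1; have no k := nnmeas_only_from u a k nh.
have n1 : nnmeas (fun (_ : R) (_ : S) => 1 : \bar R) by exact: nnmeas_cst.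
rewrite (probability_markov_time_finite chain)//.
have [/andP[/eqP-> /eqP->]|ne] := boolP ((t == u) && (i == a)).
  by rewrite eventual_only_from// -(probability_markov_time_finite chain).
rewrite (eventual_step qI)// (step_stop qI)//.
  by apply: (nnmeas_eventual qI) => // k; exact: (no k.+1).
by rewrite /only_from (negbTE ne).
Qed.

(** Backward induction: rules which stop after boundedly many jumps cannot beat
    an affine majorant of [U] evaluated at the superharmonic function [K]. *)
Lemma nested_truncate_le n h C s v b : (forall k, nnmeas (h k)) -> (0 <= v)%R ->
  (0 < s)%R -> majorant U C s ->
  nested q n.+1 (truncate n h) gain nil0 v b +
    (`|C| - C + s * c * Num.max v 0)%:E <=
  nested q n.+1 (truncate n h) loss nil0 v b + (`|C| + s * K b)%:E.
Proof.
move=> nh v0 s0 m.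
pose rhoA (_ : R) a : \bar R := (`|C| + s * K a)%:E.
pose rhoG (_ : R) a : \bar R := (`|C| + s * gpos g a)%:E.
pose rhoB (r : R) (_ : S) : \bar R := (`|C| - C + s * c * Num.max r 0)%:E.
have s00 := ltW s0; have c0 := ltW c_gt0.
have A0 : (0 <= `|C|)%R by [].
have B0 : (0 <= `|C| - C)%R by rewrite subr_ge0 ler_norm.
have K0 a : (0 <= K a)%R by rewrite (le_trans (gpos_ge0 g a)) ?gK.
have nA : nnmeas rhoA.
  split => [b0|r b0]; [exact: measurable_cst|].
  by rewrite lee_fin addr_ge0// mulr_ge0.
have nG : nnmeas rhoG.
  split => [b0|r b0]; [exact: measurable_cst|].
  by rewrite lee_fin addr_ge0// mulr_ge0// gpos_ge0.
have nB : nnmeas rhoB.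
  split => [b0|r b0]; last first.
    by rewrite lee_fin addr_ge0// mulr_ge0 ?mulr_ge0// le_max lexx orbT.
  apply/measurable_EFinP; apply: measurable_funD => //.
  by apply: measurable_funM => //; apply: measurable_maxr.
have pay r b0 : (0 <= r)%R -> gain r b0 + rhoB r b0 <= loss r b0 + rhoG r b0.
  move=> r0; rewrite /gain /loss /rhoB /rhoG (max_l r0).
  have := m (g b0 - c * r)%R.
  have gp : (g b0 <= gpos g b0)%R by rewrite /gpos le_max lexx.
  have := @utility_lty _ _ _ _ _ utilU (g b0 - c * r)%R.
  case: (U _) => [x||] // _; last first.
    by move=> _; rewrite [- -oo]/= maxye addye// leey.
  rewrite lee_fin -EFinN -!EFin_max -!EFinD lee_fin => xl.
  have xl' : (x <= C + s * gpos g b0 - s * c * r)%R.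
    by rewrite (le_trans xl)// mulrBr addrA mulrA lerD2r lerD2l ler_pM2l.
  have [x0|x0] := leP 0%R x.
    by rewrite max_r ?oppr_le0//; lra.
  by rewrite max_l ?oppr_ge0 ?(ltW x0)//; lra.
have nn0 : nnmeas nil0 by exact: nnmeas_cst.
rewrite -/(rhoB v b) -/(rhoA v b).
move: h nh v b v0. elim: n => [|n IH] h nh v b v0.
  rewrite /= !(step_stop qI)//.
  rewrite (le_trans (pay _ _ v0))// leeD2l// lee_fin lerD2l ler_pM2l//.
  exact: gK.
set h' := truncate n (fun k => h k.+1).
have nh' k : nnmeas (h' k) by apply: nnmeas_truncate => l; exact: nh.
have ng := nnmeas_nested qI n.+1 nh' nnmeas_gain nn0.
have nl := nnmeas_nested qI n.+1 nh' nnmeas_loss nn0.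
set G := nested q n.+1 h' gain nil0 in ng *.
set L := nested q n.+1 h' loss nil0 in nl *.
change (step q (h 0%N) gain G v b + rhoB v b <= step q (h 0%N) loss L v b + rhoA v b).
have [Bfin] := step_supermartingale qI c0 A0 B0 s00 v0 (gpos_ge0 g) gK (K_super b) (nh 0%N).
rewrite -/rhoA -/rhoB -/rhoG => sup.
have := @le_step _ _ _ qI (h 0%N) _ _ _ _ v b (nh 0%N)
  (nnmeasD nnmeas_gain nB) (nnmeasD ng nB) (nnmeasD nl nA)
  (fun r b0 vr => pay r b0 (le_trans v0 vr))
  (fun r b0 vr => IH (fun k => h k.+1) (fun k => nh k.+1) r b0 (le_trans v0 vr)).
rewrite -/h' -/G -/L !(stepD qI)// => step_le.
apply: (@lee_cancel_add _ _ _ (step q (h 0%N) rhoB rhoB v b) (step q (h 0%N) rhoG rhoA v b)) => //.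
- by case: (nnmeas_step qI (nh 0%N) nnmeas_gain ng) => _; exact.
- by case: (nnmeas_step qI (nh 0%N) nnmeas_loss nl) => _; exact.
- by case: (nnmeas_step qI (nh 0%N) nG nA) => _; exact.
- by case: (nnmeas_step qI (nh 0%N) nB nB) => _; exact.
- by case: nA => _; exact.
- by case: nB => _; exact.
Qed.

Lemma net_truncate_le n i h t C s : (forall k, nnmeas (h k)) -> (0 <= t)%R ->
  (0 < s)%R -> majorant U C s ->
  net (truncate n h) t i <= (C + s * (K i - c * t))%:E.
Proof.
move=> nh t0 s0 m; have nt k := nnmeas_truncate n k nh.
have c0 := ltW c_gt0; have s00 := ltW s0.
have K0 : (0 <= K i)%R by rewrite (le_trans (gpos_ge0 g i)) ?gK.
have tn v b : truncate n h n v b = 0 by rewrite /truncate ltnn.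
rewrite /net !(eventual_horizon qI (n := n))//.
have -> : (C + s * (K i - c * t))%:E =
    (`|C| + s * K i)%:E - (`|C| - C + s * c * Num.max t 0)%:E.
  by rewrite max_l// -EFinB; congr (_%:E); ring.
have nn0 : nnmeas nil0 by exact: nnmeas_cst.
apply: ge0_lee_sub.
- by case: (nnmeas_nested qI n.+1 nt nnmeas_gain nn0) => _; exact.
- by case: (nnmeas_nested qI n.+1 nt nnmeas_loss nn0) => _; exact.
- by rewrite lee_fin addr_ge0// mulr_ge0.
- by rewrite lee_fin addr_ge0 ?subr_ge0 ?ler_norm// max_l// !mulr_ge0.
- exact: ltry.
- exact: nested_truncate_le.
Qed.

(** By (A2) the bound passes to rules without a horizon. *)
Lemma net_le_majorant i h t C s : (forall k, nnmeas (h k)) -> (0 <= t)%R ->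
  P i [set w | markov_time X J h t w < +oo] = 1 ->
  (0 < s)%R -> majorant U C s -> net h t i <= (C + s * (K i - c * t))%:E.
Proof.
move=> nh t0 P1 s0 m; rewrite -(net_only_from t i nh).
have no k := nnmeas_only_from t i k nh.
have fin j : P j [set w | markov_time X J (only_from t i h) t w < +oo] = 1.
  exact: only_from_finite.
have st := stopping_time_markov chain no fin.
rewrite -(expected_utility_net no (fin i)); apply: (le_trans (hA2 i t0 st)).
rewrite limn_einf_lim; apply: lime_le; first exact: is_cvg_einfs.
apply: nearW => n.
have le_n : expected_utility P X g c U i t
    (fun w => mine (markov_time X J (only_from t i h) t w) (J n w)%:E) <=
    (C + s * (K i - c * t))%:E.
  rewrite (_ : (fun w => _) = markov_time X J (truncate n (only_from t i h)) t).
    rewrite expected_utility_net//; [exact: net_truncate_le| |].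
      by move=> k; exact: nnmeas_truncate.
    exact: markov_time_truncate_finite.
  by apply/funext => w; rewrite markov_time_truncate.
by apply: le_trans le_n; apply: ereal_inf_lbound; exists n => /=.
Qed.

(** Optimizing the previous bound over the affine majorants. *)
Lemma net_le_utility i h t : (forall k, nnmeas (h k)) -> (0 <= t)%R ->
  P i [set w | markov_time X J h t w < +oo] = 1 ->
  net h t i <= U (K i - c * t + 1)%R.
Proof.
move=> nh t0 P1; apply: (le_utility_majorants utilU) => C s s0 m.
exact: net_le_majorant.
Qed.

Lemma value_le t i (v : \bar R) : (0 <= t)%R ->
  (forall h, (forall k, nnmeas (h k)) ->
    P i [set w | markov_time X J h t w < +oo] = 1 -> net h t i <= v) ->
  value t i <= v.
Proof.
move=> t0 H; rewrite /Defs.value; case: ifP => _; last by rewrite leNye.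
apply: ge_ereal_sup => _ [h [mh hfin] <-].
have nh k : nnmeas (total_rule (h k)) by exact: nnmeas_total_rule.
have E : markov_time X J (fun k => total_rule (h k)) t = markov_time X J h t.
  by apply/funext => w; exact: (markov_time_total chain).
have P1 : P i [set w | markov_time X J (fun k => total_rule (h k)) t w < +oo] = 1.
  by rewrite E hfin.
by rewrite -E expected_utility_net//; exact: H.
Qed.

Lemma value_ge h t i : time_domain g c D t i -> (forall k, nnmeas (h k)) ->
  P i [set w | markov_time X J h t w < +oo] = 1 -> net h t i <= value t i.
Proof.
move=> td nh P1; rewrite /Defs.value asboolT//; apply: ereal_sup_ubound.
have no k := nnmeas_only_from t i k nh.
exists (only_from t i h).
  split => [k|j u u0]; first exact: measurable_rule_nnmeas.
  exact: only_from_finite.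
by rewrite expected_utility_net ?net_only_from//; exact: only_from_finite.
Qed.

Lemma value_le_majorant t i C s : (0 <= t)%R -> (0 < s)%R -> majorant U C s ->
  value t i <= (C + s * (K i - c * t))%:E.
Proof. by move=> t0 s0 m; apply: value_le => // h nh P1; exact: net_le_majorant. Qed.

Lemma value_le_utility t i : (0 <= t)%R -> value t i <= U (K i - c * t + 1)%R.
Proof. by move=> t0; apply: value_le => // h nh P1; exact: net_le_utility. Qed.

Lemma value_out t i : ~ time_domain g c D t i -> value t i = -oo.
Proof. by move=> td; rewrite /Defs.value asboolF. Qed.

(** Starting earlier and using the same rules as later saves time at each
    outcome. Monotonicity is what makes the value function measurable. *)
Lemma value_noninc u v i : (0 <= u)%R -> (u <= v)%R -> value v i <= value u i.
Proof.
move=> u0 uv; have v0 := le_trans u0 uv.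
have [tv|ntv] := pselect (time_domain g c D v i); last by rewrite value_out// leNye.
have tu : time_domain g c D u i.
  move: tv => /(time_domainE g D v i c_gt0)[_ Dv].
  apply/(time_domainE g D u i c_gt0); split => //; apply: dom_up Dv _.
  by rewrite lerD2l lerN2 ler_pM2l.
apply: value_le => // h nh P1.
pose h' k := fun r => h k ((v - u) + r)%R.
have nh' k : nnmeas (h' k) by exact: nnmeas_shift.
have E : markov_time X J h' u = markov_time X J h v.
  have e k w : h' k (u + J k w)%R = h k (v + J k w)%R by rewrite /h' addrA subrK.
  apply/funext => w; rewrite /markov_time.
  rewrite (_ : stops_at X J h' u w = stops_at X J h v w).
    by case: pselect => // ex; rewrite e.
  by apply/funext => k; rewrite /stops_at e.
have P1' : P i [set w | markov_time X J h' u w < +oo] = 1 by rewrite E.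
apply: le_trans (value_ge tu nh' P1').
rewrite -!expected_utility_net// E /expected_utility.
apply: le_integral_ereal => //.
- exact: (measurable_reward chain v nh (phi := fun r a => U (g a - c * r)%R)
    measurable_utility_time).
- rewrite -E; exact: (measurable_reward chain u nh' (phi := fun r a => U (g a - c * r)%R)
    measurable_utility_time).
- by move=> w _; apply: (utility_nd utilU); rewrite lerD2l lerN2 ler_pM2l// lerD2r.
Qed.

Lemma measurable_value i : measurable_fun setT (value ^~ i).
Proof.
rewrite (_ : value ^~ i = fun t => if (0 <= t)%R then value t i else -oo); last first.
  apply/funext => t; case: ifPn => // t0; apply: value_out.
  by case => t1 _; rewrite t1 in t0.
apply: measurable_fun_if => //; first exact: measurable_fun_ler.
rewrite setTI; apply: measurable_fun_nonincreasing_ereal.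
  move=> x y /= x0 _ z /andP[xz _]; exact: le_trans xz.
by move=> x y /= x0 _ xy; exact: value_noninc.
Qed.

Definition value_pos (t : R) (i : S) : \bar R := maxe (value t i) 0.
Definition value_neg (t : R) (i : S) : \bar R := maxe (- value t i) 0.

Lemma nnmeas_value_pos : nnmeas value_pos.
Proof.
split => [a|v a]; last by rewrite le_max lexx orbT.
by apply: measurable_maxe; [exact: measurable_value|exact: measurable_cst].
Qed.

Lemma nnmeas_value_neg : nnmeas value_neg.
Proof.
split => [a|v a]; last by rewrite le_max lexx orbT.
apply: measurable_maxe; last exact: measurable_cst.
by apply: measurableT_comp => //; exact: measurable_value.
Qed.

End ValueBounds.

(** * The first jump as a Lebesgue integral *)

Section LebesgueForm.
Context {R : realType} {S : countType}.
Variable q : S -> S -> R.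
Hypothesis qI : intensity_matrix q.
Local Open Scope ereal_scope.
Local Notation rate := (rate q).
Local Notation mu := lebesgue_measure.

Definition jump_sum (a : S) (F : S -> \bar R) : \bar R :=
  \esum_(b in [set b | b != a]) ((q a b)%:E * F b).

Lemma jump_sumE a F : (forall b, 0 <= F b) ->
  jump_sum a F = (rate a)%:E * after_jump q a F.
Proof.
move=> F0; have r0 := rate_gt0 qI a.
rewrite /jump_sum /after_jump -esumZl ?(ltW r0)//; last first.
  by move=> b; rewrite mule_ge0// lee_fin (jump_prob_ge0 qI).
rewrite esum_mkcond; apply: eq_esum => b _; rewrite /jump_prob.
case: ifPn => [/set_mem /= ba|ba].
  by rewrite (negbTE ba) muleA -EFinM mulrC divfK// gt_eqF.
rewrite ifT ?mul0e ?mule0//; move: ba; rewrite notin_setE /=.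
by move/negP; rewrite negbK.
Qed.

(** The exponential law has no atoms. *)
Lemma sojourn_tail_strict a (x : R) : (0 <= x)%R ->
  sojourn_law qI a [set s | (x < s)%R] = (expR (- (rate a * x)))%:E.
Proof.
move=> x0; rewrite -(sojourn_tail qI a x0).
have E : sojourn_law qI a [set x] = 0 by rewrite /= /exponential_prob integral_set1.
have m1 : measurable [set s : R | (x < s)%R].
  by rewrite (_ : [set s | _] = `]x, +oo[%classic)//; apply/seteqP; split => s /=; rewrite in_itv/= andbT.
have -> : [set s : R | (x <= s)%R] = [set s | (x < s)%R] `|` [set x].
  apply/seteqP; split => s /=.
    by rewrite le_eqVlt => /predU1P[->|]; [right|left].
  by move=> [/ltW//|->].
rewrite measureU//; last first.
  by apply/seteqP; split => // s /= [+ sx]; rewrite sx ltxx.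
by rewrite [X in _ = _ + X]E adde0.
Qed.

Lemma sojourn_integral a (A : R -> \bar R) (I : set R) : measurable I ->
  I `<=` `[0%R, +oo[ -> measurable_fun setT A -> (forall s, 0 <= A s) ->
  \int[sojourn_law qI a]_s (if s \in I then A s else 0) =
  \int[mu]_(s in I) ((expR (- (rate a * s)))%:E * ((rate a)%:E * A s)).
Proof.
move=> mI I0 mA A0; have r0 := rate_gt0 qI a.
have mif : measurable_fun setT (fun s => if s \in I then A s else 0).
  apply: measurable_fun_ifT => //.
  apply: (measurable_fun_bool true) => //; rewrite setTI.
  by rewrite (_ : _ @^-1` _ = I)//; apply/seteqP; split => w /=; [move=> /set_mem|move=> /mem_set].
rewrite (@ge0_integral_density R _ (measurableTypeR R) (sojourn_law qI a) mu
  (exponential_pdf (rate a)))//.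
- rewrite [RHS]integral_mkcond; apply: eq_integral => s _; rewrite patchE.
  case: ifPn => sI; last by rewrite mule0.
  have := I0 s (set_mem sI); rewrite /= in_itv/= andbT => s0.
  by rewrite exponential_pdfE// EFinM mulNr [RHS]muleA [in RHS](muleC (expR _)%:E).
- exact: measurable_exponential_pdf.
- by move=> x; apply: exponential_pdf_ge0; exact: ltW.
- by move=> s; case: ifP.
Qed.

Lemma jump_kernel_lebesgue_set a (theta : \bar R) F (I : set R) : nnmeas F -> measurable I ->
  (forall s : R, I s <-> (0 <= s)%R /\ s%:E <= theta) ->
  jump_kernel q a theta 0 F =
  \int[mu]_(s in I) ((expR (- (rate a * s)))%:E * jump_sum a (F s)).
Proof.
move=> nF mI IE; have [mF F0] := nF; rewrite /jump_kernel.
transitivity (\int[sojourn_law qI a]_s (if s \in I then after_jump q a (F s) else 0)).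
  pose N : set R := `]-oo, 0%R[%classic.
  have N0 : sojourn_law qI a N = 0.
    rewrite /= /exponential_prob integral0_eq// => s; rewrite /N/= in_itv/= => s0.
    by rewrite lt0_exponential_pdf.
  have mA : measurable_fun setT (fun s => after_jump q a (F s)).
    exact: (measurable_after_jump qI).
  rewrite (@ge0_negligible_integral _ _ _ (sojourn_law qI a) setT N)//=; last 3 first.
  - exact: measurable_itv.
  - exact: (measurable_jump_kernel qI).
  - by move=> s _; exact: (jump_kernel_integrand_ge0 qI).
  rewrite [RHS](@ge0_negligible_integral _ _ _ (sojourn_law qI a) setT N)//=; last 3 first.
  - exact: measurable_itv.
  - apply: measurable_fun_ifT => //; apply: (measurable_fun_bool true) => //; rewrite setTI.
    by rewrite (_ : _ @^-1` _ = I)//; apply/seteqP; split => w /=; [move=> /set_mem|move=> /mem_set].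
  - by move=> s _; case: ifP => // _; exact: (after_jump_ge0 qI).
  apply: (@eq_integral _ _ _ (sojourn_law qI a)) => s /set_mem [_].
  rewrite /N/= in_itv/= => /negP; rewrite -leNgt => s0.
  case: leP => sth; first by rewrite mem_set//; apply/IE.
  by rewrite memNset// => /IE[_]; rewrite leNgt sth.
apply: (@etrans _ _ _ _ (sojourn_integral a (A := fun s => after_jump q a (F s)) mI _ _ _)).
- by move=> s /IE[s0 _]; rewrite /= in_itv/= s0.
- exact: (measurable_after_jump qI).
- by move=> s; exact: (after_jump_ge0 qI).
- by apply: eq_integral => s _; rewrite jump_sumE.
Qed.

Lemma jump_kernel_lebesgue a (theta : R) x F : (0 <= theta)%R -> 0 <= x -> nnmeas F ->
  jump_kernel q a theta%:E x F = x * (expR (- (rate a * theta)))%:E +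
  \int[mu]_(s in `[0%R, theta]) ((expR (- (rate a * s)))%:E * jump_sum a (F s)).
Proof.
move=> th0 x0 nF; have [mF F0] := nF; have r0 := rate_gt0 qI a.
have n0 : nnmeas (fun (_ : R) (_ : S) => 0 : \bar R) by exact: nnmeas_cst.
have mtail : measurable [set s : R | (theta < s)%R].
  by rewrite (_ : [set s | _] = `]theta, +oo[%classic)//; apply/seteqP; split => s /=; rewrite in_itv/= andbT.
transitivity (jump_kernel q a theta%:E x (fun _ _ => 0) + jump_kernel q a theta%:E 0 F).
  rewrite -(jump_kernelD qI)//; congr (jump_kernel _ _ _ _ _); rewrite ?adde0//.
  by apply/funext => s; apply/funext => b; rewrite add0e.
congr (_ + _).
  rewrite -(sojourn_tail_strict a th0) -[X in _ = x * _ X]setIT -integral_indic//.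
  rewrite -ge0_integralZl//; last first.
    by apply/(@measurable_EFinP _ R); exact: measurable_indic.
  rewrite /jump_kernel; congr (integral _ _ _); apply/funext => s /=; rewrite (after_jump_cst qI)// indicE lee_fin.
  case: leP => ths; first by rewrite memNset ?mule0//= ltNge ths.
  by rewrite mem_set ?mule1.
apply: jump_kernel_lebesgue_set => // s; rewrite /= in_itv/= lee_fin.
by split => [/andP|[-> ->]].
Qed.

Lemma jump_kernel_split a (theta : R) x F : (0 <= theta)%R -> 0 <= x -> nnmeas F ->
  jump_kernel q a theta%:E x F =
  x * (expR (- (rate a * theta)))%:E + jump_kernel q a theta%:E 0 F.
Proof.
move=> th0 x0 nF; rewrite !jump_kernel_lebesgue//.
by rewrite mul0e add0e.
Qed.

Lemma jump_kernel_infty_lebesgue a x F : nnmeas F ->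
  jump_kernel q a +oo x F =
  \int[mu]_(s in `[0%R, +oo[) ((expR (- (rate a * s)))%:E * jump_sum a (F s)).
Proof.
move=> nF; rewrite (jump_kernel_infty q a x 0).
apply: jump_kernel_lebesgue_set => // s; rewrite /= in_itv/= andbT leey.
by split => [->|[]].
Qed.

Lemma le_jump_kernel_horizon a (theta theta' : \bar R) F : nnmeas F -> theta <= theta' ->
  jump_kernel q a theta 0 F <= jump_kernel q a theta' 0 F.
Proof.
move=> nF le_theta; apply: (@ge0_le_integral _ _ _ (sojourn_law qI a)) => //.
- by move=> s _; exact: (jump_kernel_integrand_ge0 qI).
- exact: (measurable_jump_kernel qI).
- exact: (measurable_jump_kernel qI).
- move=> s _; case: ifPn => [sth|_]; first by rewrite (le_trans sth).
  exact: (jump_kernel_integrand_ge0 qI).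
Qed.

(** Waiting for ever is the monotone limit of waiting up to fixed dates, at the
    end of which nothing is collected. *)
Lemma jump_kernel_horizon a x F : nnmeas F ->
  jump_kernel q a +oo x F = limn (fun n => jump_kernel q a n%:R%:E 0 F).
Proof.
move=> nF; rewrite (jump_kernel_infty q a x 0) /jump_kernel.
rewrite -(@monotone_convergence _ _ _ (sojourn_law qI a))//.
- apply: eq_integral => s _; rewrite leey; apply/esym/cvg_lim => //.
  apply: cvg_near_cst; near=> n; rewrite ifT// lee_fin; near: n.
  exact: nbhs_infty_ger.
- by move=> n; exact: (measurable_jump_kernel qI).
- by move=> n s _; exact: (jump_kernel_integrand_ge0 qI).
- move=> s _ m n mn; case: ifPn => [sm|_]; last exact: (jump_kernel_integrand_ge0 qI).
  by rewrite ifT// (le_trans sm)// lee_fin ler_nat.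
Unshelve. all: by end_near. Qed.

Lemma ge_after_jump a b F : (jump_prob q a b)%:E * F b <= after_jump q a F.
Proof.
apply: esum_ge; exists [set b]; last by rewrite fsbig_set1.
by split => //; exact: finite_set1.
Qed.

End LebesgueForm.

(** A large number below the flatter of two lines is far below the steeper one,
    by an amount proportional to it. *)
Lemma flatter_majorant_bound (R : realType) (s1 s2 C1 C2 x y N : R) :
  0 <= s1 -> x <= C2 + s2 * y -> s1 * C2 - s2 * C1 <= N ->
  x * (s1 - s2) <= s2 * (C1 + s1 * y - x) + N.
Proof.
move=> s10 /(ler_wpM2l s10); lra.
Qed.

(** The passage to the limit in the verification argument: [v] is the value,
    [pn] and [mn] are the expected gain and loss collected before the [n]th jump,
    and [ip - im] is the expected value left at that jump. *)
Lemma lee_of_small_remainder (R : realType) (v vp vn eg pn mn ip im : \bar R) (e : R) :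
  (v \is a fin_num -> eg \is a fin_num -> vp \is a fin_num ->
  0 <= vn -> 0 <= mn -> 0 <= pn -> 0 <= im -> 0 <= ip ->
  vp - vn = v -> pn <= eg -> vp + (mn + im) <= vn + (pn + ip) ->
  ip - im \is a fin_num -> (fine (ip - im) < e)%R -> mn + v <= eg + e%:E)%E.
Proof.
case: v => [v||]//; case: vp => [vp||]//; case: vn => [vn||]//; case: eg => [eg||]//.
case: pn => [pn||]//; case: mn => [mn||]//; case: ip => [ip||]//; case: im => [im||]//.
rewrite -?EFinN -!EFinD !lee_fin /= => _ _ _ _ _ _ _ _ [e1] e2 e3 _ e4.
by move: e1 e2 e3 e4; clear; lra.
Qed.

(** * Dynamic programming *)

Section DynamicProgramming.
Context {R : realType} {S : countType} {d : measure_display}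
  {Omega : measurableType d}.
Variables (q : S -> S -> R) (P : S -> probability Omega R)
  (X : R -> Omega -> S) (J : nat -> Omega -> R) (g : S -> R) (c : R)
  (D : utility_domain R) (U : R -> \bar R).
Hypothesis chain : markov_chain q P X J.
Hypothesis c_gt0 : 0 < c.
Hypothesis utilU : utility g D U.
Hypothesis hA2 : A2 P X J g c U.
Variable K : S -> R.
Hypothesis gK : forall a, (Num.max (g a) 0 <= K a)%R.
Hypothesis K_super : forall a,
  (after_jump q a (fun b => (K b)%:E) <= (K a + c / rate q a)%:E)%E.
Let qI : intensity_matrix q := mc_intensity chain.
Local Open Scope ereal_scope.
Local Notation value := (value P X J g c D U).
Local Notation bellman := (bellman q P X J g c D U).
Local Notation bellman_sup := (bellman_sup q P X J g c D U).
Local Notation vpos := (value_pos P X J g c D U).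
Local Notation vneg := (value_neg P X J g c D U).
Local Notation gain := (gain g c U).
Local Notation loss := (loss g c U).
Local Notation net := (net q g c U).
Local Notation mu := lebesgue_measure.
Let npos : nnmeas vpos. Proof. exact: (nnmeas_value_pos chain c_gt0 utilU). Qed.
Let nneg : nnmeas vneg. Proof. exact: (nnmeas_value_neg chain c_gt0 utilU). Qed.
Let ngain : nnmeas gain. Proof. exact: (nnmeas_gain c_gt0 utilU). Qed.
Let nloss : nnmeas loss. Proof. exact: (nnmeas_loss c_gt0 utilU). Qed.

Let vpos_ge0 v a : 0 <= vpos v a. Proof. by case: npos => _; exact. Qed.
Let vneg_ge0 v a : 0 <= vneg v a. Proof. by case: nneg => _; exact. Qed.
Let gain_ge0 v a : 0 <= gain v a. Proof. by case: ngain => _; exact. Qed.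
Let loss_ge0 v a : 0 <= loss v a. Proof. by case: nloss => _; exact. Qed.

Lemma value_posneg t i : vpos t i - vneg t i = value t i.
Proof.
have := congr1 (fun F => F tt) (funeposneg (fun _ : unit => value t i)).
by rewrite funeposE funenegE.
Qed.

Lemma gain_lty v a : gain v a < +oo.
Proof.
by rewrite gt_max ltry andbT (utility_lty utilU).
Qed.

(** The expected positive part of the value after a jump is bounded uniformly in
    time by the superharmonic majorant. This keeps one of the two parts of every
    signed sum and integral finite. *)
Lemma after_jump_value_pos t i : (0 <= t)%R ->
  exists2 M : R, (0 <= M)%R &
    forall s, (0 <= s)%R -> after_jump q i (vpos (t + s)%R) <= M%:E.
Proof.
move=> t0; have [C [s [C2 [s2 [s20 s21 m _]]]]] := two_majorants utilU.
have s0 := lt_trans s20 s21; have s00 := ltW s0; have r0 := rate_gt0 qI i.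
have K0 b : (0 <= K b)%R by rewrite (le_trans (gpos_ge0 g b)) ?gK.
exists (`|C| + s * (K i + c / rate q i))%R.
  by rewrite addr_ge0// mulr_ge0// addr_ge0// divr_ge0 ?ltW.
move=> u u0; apply: (@le_trans _ _ (after_jump q i (fun b => `|C|%:E + s%:E * (K b)%:E))).
  apply: (le_after_jump qI) => // b.
  rewrite ge_max -EFinM -EFinD lee_fin addr_ge0 ?mulr_ge0// andbT.
  have tu0 : (0 <= t + u)%R by exact: addr_ge0.
  rewrite (le_trans (value_le_majorant chain c_gt0 utilU hA2 gK K_super b tu0 s0 m))//.
  rewrite lee_fin lerD// ?ler_norm// ler_pM2l// lerBlDr lerDl.
  by rewrite mulr_ge0// ltW.
rewrite (after_jumpD qI)//; last by move=> b; rewrite lee_fin mulr_ge0.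
rewrite (after_jump_cst qI)// (after_jumpZl qI)// EFinD leeD2l// EFinM.
by rewrite lee_wpmul2l.
Qed.

Lemma kernel_value_pos_lty t i theta x : (0 <= t)%R -> 0 <= x -> x < +oo ->
  jump_kernel q i theta x (fun s => vpos (t + s)%R) < +oo.
Proof.
move=> t0 x0 xoo; have [M M0 leM] := after_jump_value_pos i t0.
case: x x0 xoo => // x x0 _; rewrite lee_fin in x0.
have xM0 : 0 <= (x + M)%:E by rewrite lee_fin addr_ge0.
apply: (@le_lt_trans _ _ (x + M)%:E); last exact: ltry.
rewrite -[leRHS](jump_kernel_cst qI i theta xM0).
apply: (le_jump_kernel_after qI).
- by rewrite lee_fin.
- exact: (nnmeas_shift t npos).
- exact: nnmeas_cst.
- by rewrite lee_fin lerDl.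
- move=> s s0; rewrite (after_jump_cst qI)// (le_trans (leM s s0))//.
  by rewrite lee_fin lerDr.
Qed.

Lemma signed_jump_sum t i : (0 <= t)%R ->
  signed_esum [set j | j != i] (fun j => (q i j)%:E * value t j) =
  jump_sum q i (vpos t) - jump_sum q i (vneg t).
Proof.
move=> t0; rewrite /signed_esum /jump_sum.
have q0 j : j \in [set j | j != i] -> (0 <= q i j)%R.
  by rewrite inE /=; case: (qI i) => _ + _; apply.
congr (_ - _); apply: eq_esum => j /mem_set /q0 qj.
  by rewrite funeposE /value_pos maxe_pMr// mule0.
by rewrite funenegE /value_neg maxe_pMr// mule0 muleN.
Qed.

(** The signed sum and integral split along the positive and negative parts of
    the value function because those of the positive part are finite. *)
Lemma bellmanE t i theta : (0 <= t)%R -> (0 <= theta)%R ->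
  bellman t i theta =
  jump_kernel q i theta%:E (gain (t + theta)%R i) (fun s => vpos (t + s)%R) -
  jump_kernel q i theta%:E (loss (t + theta)%R i) (fun s => vneg (t + s)%R).
Proof.
move=> t0 th0; have r0 := rate_gt0 qI i.
have np := nnmeas_shift t npos; have nn := nnmeas_shift t nneg.
have js0 F : (forall b, 0 <= F b) -> 0 <= jump_sum q i F.
  move=> F0; rewrite (jump_sumE qI)// mule_ge0 ?lee_fin ?(ltW r0)//.
  exact: (after_jump_ge0 qI).
pose I F := \int[mu]_(s in `[0%R, theta]) ((expR (- (rate q i * s)))%:E * jump_sum q i (F (t + s)%R)).
have mjs F : nnmeas F -> measurable_fun setT (fun s : R =>
    (expR (- (rate q i * s)))%:E * jump_sum q i (F (t + s)%R)).
  move=> nF; apply: emeasurable_funM.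
    apply/measurable_EFinP; apply: measurableT_comp => //.
    by apply: measurableT_comp => //; exact: measurable_funM.
  rewrite (_ : (fun s => _) = fun s => (rate q i)%:E * after_jump q i (F (t + s)%R)).
    apply: emeasurable_funM => //; apply: (measurable_after_jump qI).
      by case: (nnmeas_shift t nF).
    by move=> s b; case: nF.
  by apply/funext => s; rewrite (jump_sumE qI)//; case: nF.
have Ip : I vpos < +oo.
  have := @kernel_value_pos_lty t i theta%:E 0 t0 (lexx 0) (ltry 0).
  by rewrite (jump_kernel_lebesgue qI)// mul0e add0e.
have -> : bellman t i theta = U (g i - c * (t + theta))%R *
    (expR (- (rate q i * theta)))%:E + (I vpos - I vneg).
  congr (_ + _); rewrite -ge0_integralB_cond//; first last.
  - by rewrite Ip.
  - by move=> s _; rewrite mule_ge0 ?lee_fin ?expR_ge0// js0.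
  - by move=> s _; rewrite mule_ge0 ?lee_fin ?expR_ge0// js0.
  - by apply: measurable_funTS; exact: mjs.
  - by apply: measurable_funTS; exact: mjs.
  apply: eq_integral => s /set_mem /=; rewrite in_itv/= => /andP[s0 _].
  rewrite signed_jump_sum ?addr_ge0// muleBr//.
  apply: fin_num_adde_defr; rewrite ge0_fin_numE ?js0//.
  have [M _ /(_ s s0) leM] := after_jump_value_pos i t0.
  rewrite (jump_sumE qI)// (le_lt_trans (lee_wpmul2l _ leM))// ?lee_fin ?(ltW r0)//.
  by rewrite -EFinM ltry.
rewrite !(jump_kernel_lebesgue qI)// -/(I vpos) -/(I vneg).
rewrite -(gainB g c U (t + theta)%R i).
have In0 : 0 <= I vneg.
  by apply: integral_ge0 => s _; rewrite mule_ge0 ?lee_fin ?expR_ge0// js0.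
have Ip0 : 0 <= I vpos.
  by apply: integral_ge0 => s _; rewrite mule_ge0 ?lee_fin ?expR_ge0// js0.
have := gain_lty (t + theta)%R i; have := gain_ge0 (t + theta)%R i.
have := loss_ge0 (t + theta)%R i; have := expR_gt0 (- (rate q i * theta)).
move: (gain _ _) (loss _ _) (I vpos) (I vneg) (expR _) Ip Ip0 In0.
move=> [x||] [y||] [p||] [n||] e //= _ p0 n0 e0 y0 x0 _.
- by rewrite -!EFinD; congr (_%:E); ring.
- by rewrite addeNy gt0_mulNye ?lte_fin// gt0_mulye ?lte_fin// addNye addye// addeNy.
- by rewrite !addeNy gt0_mulye ?lte_fin// addye// addeNy.
Qed.

Local Notation one := (fun (_ : R) (_ : S) => 1 : \bar R).
Let none1 : nnmeas one. Proof. exact: nnmeas_cst. Qed.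

(** Stopping very late may cost a huge loss, which counts with the probability
    of still waiting. If this weighted loss did not become small, neither would
    the expectation of [f] after a jump: [f] dominates the loss of being in a
    reachable state [b], which dominates the loss in [i] a fixed time earlier. *)
Lemma exists_small_loss t i f (N e : R) : (0 <= t)%R -> (0 <= N)%R -> (0 < e)%R ->
  nnmeas f -> (forall v b, (0 <= v)%R -> - U (K b - c * v + 1)%R <= f v b) ->
  jump_kernel q i +oo 0 (fun s => f (t + s)%R) < +oo ->
  exists2 theta, (N <= theta)%R &
    loss (t + theta)%R i * (expR (- (rate q i * theta)))%:E < e%:E.
Proof.
move=> t0 N0 e0 nf lef; have [mf f0] := nf; have r0 := rate_gt0 qI i.
apply: contraPP => /forall2NP H; apply/negP; rewrite -leNgt.
have {}H theta : (N <= theta)%R ->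
    e%:E <= loss (t + theta)%R i * (expR (- (rate q i * theta)))%:E.
  by move=> Nt; have [//|/negP] := H theta; rewrite -leNgt.
have [b pb] := exists_jump qI i.
(* the delay that outweighs the better reward of [b] *)
pose dl := Num.max 0%R ((K b + 1 - g i) / c)%R.
have dl0 : (0 <= dl)%R by rewrite le_max lexx.
have dlK : (K b + 1 - g i <= c * dl)%R.
  by rewrite mulrC -ler_pdivrMr// le_max lexx orbT.
pose k := (rate q i * jump_prob q i b * e * expR (- (rate q i * dl)))%R.
have k0 : (0 < k)%R by rewrite !mulr_gt0// expR_gt0.
rewrite (jump_kernel_infty_lebesgue qI); last exact: nnmeas_shift.
pose B : set R := `[(N + dl)%R, +oo[%classic.
have mB : measurable B by exact: measurable_itv.
apply: (@le_trans _ _ (\int[mu]_(s in B) cst k%:E s)).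
  rewrite integral_cst//=; have -> : mu B = +oo by rewrite /B lebesgue_measure_itv/= ltry.
  by rewrite gt0_muley ?lte_fin.
have js0 s : 0 <= (expR (- (rate q i * s)))%:E * jump_sum q i (f (t + s)%R).
  rewrite mule_ge0 ?lee_fin ?expR_ge0// (jump_sumE qI)// mule_ge0 ?lee_fin ?(ltW r0)//.
  exact: (after_jump_ge0 qI).
have mjs : measurable_fun setT (fun s : R =>
    (expR (- (rate q i * s)))%:E * jump_sum q i (f (t + s)%R)).
  apply: emeasurable_funM.
    apply/measurable_EFinP; apply: measurableT_comp => //.
    by apply: measurableT_comp => //; exact: measurable_funM.
  rewrite (_ : (fun s => _) = fun s => (rate q i)%:E * after_jump q i (f (t + s)%R)).
    apply: emeasurable_funM => //; apply: (measurable_after_jump qI) => //.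
    by case: (nnmeas_shift t nf).
  by apply/funext => s; rewrite (jump_sumE qI).
apply: (@le_trans _ _ (\int[mu]_(s in B) ((expR (- (rate q i * s)))%:E * jump_sum q i (f (t + s)%R)))).
  apply: ge0_le_integral => //.
  - by move=> s _; rewrite lee_fin ltW.
  - exact: measurable_funTS.
  move=> s; rewrite /B/= in_itv/= andbT => Ns.
  have sd : (N <= s - dl)%R by rewrite lerBrDr.
  have s0 : (0 <= s)%R by rewrite (le_trans _ Ns)// addr_ge0.
  rewrite (jump_sumE qI)//.
  apply: (@le_trans _ _ ((expR (- (rate q i * s)))%:E *
      ((rate q i)%:E * ((jump_prob q i b)%:E * loss (t + (s - dl))%R i)))); last first.
    rewrite lee_wpmul2l ?lee_fin ?expR_ge0// lee_wpmul2l ?lee_fin ?(ltW r0)//.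
    apply: le_trans (ge_after_jump _ _ b _).
    rewrite lee_wpmul2l ?lee_fin ?(ltW pb)// /loss ge_max f0 andbT.
    apply: le_trans (lef _ b _); last exact: addr_ge0.
    rewrite leeN2; apply: (utility_nd utilU).
    by move: dlK; rewrite !mulrDr mulrN; lra.
  have := H _ sd; have := loss_ge0 (t + (s - dl))%R i.
  case: (loss _ _) => [l l0||//]; last first.
    move=> _ _; rewrite gt0_muley ?lte_fin// gt0_muley ?lte_fin// gt0_muley ?lte_fin ?expR_gt0//.
    by rewrite leey.
  rewrite -!EFinM !lee_fin => el.
  have -> : (expR (- (rate q i * s)) * (rate q i * (jump_prob q i b * l)) =
     rate q i * jump_prob q i b * (l * expR (- (rate q i * (s - dl)))) * expR (- (rate q i * dl)))%R.
    have -> : (- (rate q i * s) = - (rate q i * (s - dl)) + - (rate q i * dl))%R by ring.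
    by rewrite expRD; ring.
  rewrite /k ler_pM2r ?expR_gt0// ler_pM2l//.
  by rewrite mulr_gt0.
apply: ge0_subset_integral => //.
- exact: measurable_funTS.
- by move=> s; rewrite /B/= !in_itv/= !andbT; apply: le_trans; exact: addr_ge0.
Qed.

(** Infinite exactly where the rules [h] fail to stop almost surely. *)
Definition unstopped h (v : R) (b : S) : \bar R :=
  limn (fun n => n%:R%:E * (1 - eventual q h one v b)).

Lemma eventual_le1 h v b : (forall k, nnmeas (h k)) -> eventual q h one v b <= 1.
Proof.
move=> nh; rewrite -(probability_markov_time_finite chain)// probability_le1//.
rewrite (finite_markov_timeE X J v nh); apply: bigcupT_measurable => k.
exact: (measurable_first_stop chain).
Qed.

Lemma nnmeas_not_eventual h : (forall k, nnmeas (h k)) ->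
  nnmeas (fun v b => 1 - eventual q h one v b).
Proof.
move=> nh; split => [a|v a].
  apply: emeasurable_funB; first exact: measurable_cst.
  by case: (nnmeas_eventual qI nh none1).
by rewrite sube_ge0 ?eventual_le1// orbT.
Qed.

Let natmul_nd h s b : (forall k, nnmeas (h k)) ->
  {homo (fun n => n%:R%:E * (1 - eventual q h one s b)) : m n / (m <= n)%N >-> m <= n}.
Proof.
move=> nh m n mn; rewrite lee_wpmul2r ?lee_fin ?ler_nat//.
by rewrite sube_ge0 ?eventual_le1// orbT.
Qed.

Let nnmeas_natmul h n : (forall k, nnmeas (h k)) ->
  nnmeas (fun v b => n%:R%:E * (1 - eventual q h one v b)).
Proof.
move=> nh; have [m0 g0] := nnmeas_not_eventual nh; split => [a|v a].
  by apply: emeasurable_funM => //; exact: measurable_cst.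
by rewrite mule_ge0 ?lee_fin.
Qed.

Lemma nnmeas_unstopped h : (forall k, nnmeas (h k)) -> nnmeas (unstopped h).
Proof.
by move=> nh; apply: nnmeas_limn => [n|s b]; [exact: nnmeas_natmul|exact: natmul_nd].
Qed.

Lemma unstoppedE h v b : (forall k, nnmeas (h k)) ->
  eventual q h one v b = 1 \/ unstopped h v b = +oo.
Proof.
move=> nh; have := eventual_le1 v b nh; rewrite le_eqVlt => /predU1P[->|lt1]; first by left.
right; rewrite /unstopped; have [m0 /(_ v b)] := nnmeas_not_eventual nh.
have : 0 < 1 - eventual q h one v b by rewrite sube_gt0.
have [_ /(_ v b)] := nnmeas_eventual qI nh none1.
move: lt1; case: (eventual _ _ _ _ _) => [x||]// _ _; rewrite -EFinB lte_fin => x0 _.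
apply/cvg_lim => //; apply/cvgeryP; apply/cvgryPge => A; near=> n.
rewrite -ler_pdivrMr//; near: n; exact: nbhs_infty_ger.
Unshelve. all: by end_near. Qed.

(** Rules which stop almost surely still do so after the first jump, for almost
    every date and state of that jump. *)
Lemma jump_kernel_unstopped h t i : (forall k, nnmeas (h k)) ->
  eventual q h one t i = 1 ->
  jump_kernel q i (h 0%N t i) 0 (fun s => unstopped (fun k => h k.+1) (t + s)%R) = 0.
Proof.
move=> nh E1; have nh' k : nnmeas (h k.+1) by [].
have nE := nnmeas_eventual qI nh' none1; have nN := nnmeas_not_eventual nh'.
have E0 : jump_kernel q i (h 0%N t i) 0
    (fun s b => 1 - eventual q (fun k => h k.+1) one (t + s)%R b) = 0.
  have := jump_kernelD qI i (h 0%N t i) lee01 (lexx 0) (nnmeas_shift t nE) (nnmeas_shift t nN).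
  rewrite -[X in _ = X + _](eventual_step qI t i nh none1) E1.
  have -> : (fun s b => eventual q (fun k => h k.+1) one (t + s)%R b +
      (1 - eventual q (fun k => h k.+1) one (t + s)%R b)) = one.
    apply/funext => s; apply/funext => b; rewrite addeC subeK//.
    rewrite ge0_fin_numE; first by rewrite (le_lt_trans (eventual_le1 _ _ _)) ?ltry.
    by case: nE => _; exact.
  rewrite adde0 (jump_kernel_cst qI)//.
  have : 0 <= jump_kernel q i (h 0%N t i) 0
    (fun s b => 1 - eventual q (fun k => h k.+1) one (t + s)%R b).
    by apply: (jump_kernel_ge0 qI) => //; exact: (nnmeas_shift t nN).
  case: (jump_kernel _ _ _ _ _) => [x||]//= _ [] x1.
  by rewrite -[x](addKr 1%R) -x1 addNr.
rewrite /unstopped (limn_jump_kernel qI)//.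
- apply/cvg_lim => //; apply: cvg_near_cst; apply: nearW => n.
  rewrite -[X in jump_kernel _ _ _ X](mule0 n%:R%:E).
  rewrite (jump_kernelZl qI) ?E0 ?mule0//.
  exact: (nnmeas_shift t nN).
- by move=> n; exact: (nnmeas_shift t (nnmeas_natmul n nh')).
- by move=> s b; exact: natmul_nd.
Qed.

Local Notation tail h := (fun k => h k.+1).

Lemma stopsE h v b : (forall k, nnmeas (h k)) ->
  P b [set w | markov_time X J h v w < +oo] = 1 \/ unstopped h v b = +oo.
Proof.
move=> nh; rewrite (probability_markov_time_finite chain)//.
exact: (unstoppedE).
Qed.

Let eventual_ge0 h phi v b : (forall k, nnmeas (h k)) -> nnmeas phi ->
  0 <= eventual q h phi v b.
Proof. by move=> nh nphi; case: (nnmeas_eventual qI nh nphi) => _; exact. Qed.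

Let unstopped_ge0 h v b : (forall k, nnmeas (h k)) -> 0 <= unstopped h v b.
Proof. by move=> nh; case: (nnmeas_unstopped nh) => _; exact. Qed.

(** What [exists_small_loss] asks of [f], for the losses of the continuation of
    a rule; the value function satisfies it by [value_le_utility]. *)
Lemma utility_le_loss_unstopped h v b : (forall k, nnmeas (h k)) -> (0 <= v)%R ->
  - U (K b - c * v + 1)%R <= eventual q h loss v b + unstopped h v b.
Proof.
move=> nh v0; have [P1|->] := stopsE v b nh; last first.
  by rewrite addey ?leey// -ltNye (lt_le_trans _ (eventual_ge0 v b nh nloss)).
have := net_le_utility chain c_gt0 utilU hA2 gK K_super nh v0 P1.
rewrite /net => le1; apply: (@le_trans _ _ (eventual q h loss v b)).
  rewrite leeNl; apply: le_trans le1.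
  by rewrite -[leLHS]add0e leeD2r// eventual_ge0.
by rewrite leeDl// unstopped_ge0.
Qed.

(** Outside the domain of the utility, whatever one does costs an infinite loss. *)
Lemma eventual_loss_out h v b : (forall k, nnmeas (h k)) -> (0 <= v)%R ->
  ~ time_domain g c D v b ->
  P b [set w | markov_time X J h v w < +oo] = 1 ->
  eventual q h loss v b = +oo.
Proof.
move=> nh v0 nd P1; have nh' k : nnmeas (h k.+1) by [].
have out th : (0 <= th)%R -> loss (v + th)%R b = +oo.
  move=> th0; rewrite /loss; case: utilU => _ Uout _ _ _.
  rewrite Uout//= => Dv; apply: nd; apply/(time_domainE g D v b c_gt0); split => //.
  by apply: dom_up Dv _; rewrite lerD2l lerN2 ler_pM2l// lerDl.
have nl := nnmeas_eventual qI nh' nloss.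
have nu := nnmeas_unstopped nh'.
rewrite (eventual_step qI)// /step.
have : 0 <= h 0%N v b by case: (nh 0%N) => _; exact.
rewrite (probability_markov_time_finite chain)// in P1.
have := jump_kernel_unstopped nh P1.
case: (h 0%N v b) => [th||]//= ku th0.
  rewrite (jump_kernel_split qI)//; last exact: nnmeas_shift.
  rewrite out// gt0_mulye ?lte_fin ?expR_gt0// addye// -ltNye.
  apply: lt_le_trans (ltNy0) _; apply: (jump_kernel_ge0 qI) => //.
  exact: nnmeas_shift.
apply/eqP; rewrite -leye_eq leNgt; apply/negP => fin.
have nlu := nnmeasD nl nu.
have Lfin : jump_kernel q b +oo 0 (fun s c' => eventual q (tail h) loss (v + s)%R c' +
    unstopped (tail h) (v + s)%R c') < +oo.
  rewrite -[X in jump_kernel _ _ _ X](adde0 0).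
  rewrite (jump_kernelD qI)//; [|exact: nnmeas_shift|exact: nnmeas_shift].
  by rewrite ku adde0 (jump_kernel_infty _ _ 0 (loss (v + 0)%R b)).
have [th th1] := exists_small_loss v0 (lexx 0%R) ltr01 nlu
  (fun r c' r0 => utility_le_loss_unstopped c' nh' r0) Lfin.
by rewrite out// gt0_mulye ?lte_fin ?expR_gt0.
Qed.

(** Comparison with the value function, without differences of infinities. *)
Lemma eventual_le_value h v b : (forall k, nnmeas (h k)) -> (0 <= v)%R ->
  eventual q h gain v b + vneg v b <=
  eventual q h loss v b + vpos v b + unstopped h v b.
Proof.
move=> nh v0; have [P1|->] := stopsE v b nh; last first.
  rewrite addey ?leey// -ltNye (lt_le_trans (ltNy0))//.
  by rewrite adde_ge0 ?eventual_ge0.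
rewrite (le_trans _ (leeDl _ (unstopped_ge0 v b nh)))//.
have [td|ntd] := pselect (time_domain g c D v b); last first.
  rewrite eventual_loss_out// addye ?leey// -ltNye.
  exact: lt_le_trans (vpos_ge0 _ _).
apply: lee_sub_ge0 => //; try exact: eventual_ge0.
  rewrite gt_max ltry andbT.
  exact: le_lt_trans (value_le_utility chain c_gt0 utilU hA2 gK K_super b v0) (utility_lty utilU _).
by rewrite value_posneg; exact: (value_ge chain).
Qed.

(** The first decision of a Markovian rule is one of those which the Bellman
    supremum ranges over, and the continuation cannot beat the value function. *)
Lemma net_le_kernel h t i : (forall k, nnmeas (h k)) -> (0 <= t)%R ->
  P i [set w | markov_time X J h t w < +oo] = 1 ->
  net h t i <=
    step q (h 0%N) gain vpos t i - step q (h 0%N) loss vneg t i.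
Proof.
move=> nh t0 P1; have nh' k : nnmeas (h k.+1) by [].
have ng := nnmeas_eventual qI nh' ngain.
have nl := nnmeas_eventual qI nh' nloss.
have nu := nnmeas_unstopped nh'.
have n0 : nnmeas (fun (_ : R) (_ : S) => 0 : \bar R) by exact: nnmeas_cst.
have h0 := nh 0%N.
rewrite /net !(eventual_step qI)//.
have step_ge0 phi f : nnmeas phi -> nnmeas f -> 0 <= step q (h 0%N) phi f t i.
  by move=> nphi nf; case: (nnmeas_step qI h0 nphi nf) => _; exact.
apply: ge0_lee_sub; try exact: step_ge0.
  apply: (kernel_value_pos_lty) => //.
  exact: (gain_lty).
have ku : step q (h 0%N) (fun _ _ => 0) (unstopped (tail h)) t i = 0.
  apply: (jump_kernel_unstopped) => //.
  by rewrite -(probability_markov_time_finite chain).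
rewrite -[leRHS]adde0 -ku.
rewrite -[leLHS](congr1 (fun F => F t i) (stepD qI (h 0%N) ngain nloss ng nneg)).
rewrite -(congr1 (fun F => F t i) (stepD qI (h 0%N) nloss ngain nl npos)).
rewrite -(congr1 (fun F => F t i) (stepD qI (h 0%N) (nnmeasD nloss ngain) n0 (nnmeasD nl npos) nu)).
apply: (le_step qI) => //.
- exact: nnmeasD.
- exact: nnmeasD.
- by apply: nnmeasD => //; exact: nnmeasD.
- by move=> v b _; rewrite adde0 addeC.
- by move=> v b tv; apply: eventual_le_value => //; exact: le_trans tv.
Qed.

(** Along dates at which the weighted loss of stopping is small, the Bellman
    expression is at least almost its value for an infinite wait. *)
Lemma kernel_infty_le_bellman_sup t i x y : (0 <= t)%R ->
  jump_kernel q i +oo x (fun s => vpos (t + s)%R) -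
  jump_kernel q i +oo y (fun s => vneg (t + s)%R) <= bellman_sup t i.
Proof.
move=> t0; have np := nnmeas_shift t npos; have nn := nnmeas_shift t nneg.
rewrite (jump_kernel_infty _ _ y 0).
set In := jump_kernel q i +oo 0 (fun s => vneg (t + s)%R).
have In0 : 0 <= In by exact: (jump_kernel_ge0 qI).
have [->|Infin] := eqVneq In +oo; first by rewrite addeNy leNye.
have fIn : In \is a fin_num by rewrite ge0_fin_numE// ltey.
rewrite leeBlDr// (jump_kernel_horizon qI)//.
apply: lime_le.
  apply: ereal_nondecreasing_is_cvgn => m n mn; apply: (le_jump_kernel_horizon qI) => //.
  by rewrite lee_fin ler_nat.
apply: nearW => n; apply/lee_addgt0Pr => e e0.
have lef v b : (0 <= v)%R -> - U (K b - c * v + 1)%R <= vneg v b.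
  move=> v0; rewrite /vneg le_max leeN2.
  by rewrite (value_le_utility chain c_gt0 utilU hA2 gK K_super).
have Inlt : In < +oo by rewrite ltey.
have [th nth small] := exists_small_loss t0 (ler0n R n) e0 nneg lef Inlt.
have th0 : (0 <= th)%R by exact: le_trans nth.
have le_sup : bellman t i th <= bellman_sup t i by apply: ereal_sup_ubound; exists th.
apply: (@le_trans _ _ (jump_kernel q i th%:E (gain (t + th)%R i) (fun s => vpos (t + s)%R))).
  rewrite [leRHS](jump_kernel_split qI)//.
  apply: (@le_trans _ _ (jump_kernel q i th%:E 0 (fun s => vpos (t + s)%R))).
    by apply: (le_jump_kernel_horizon qI) => //; rewrite lee_fin.
  by rewrite leeDr// mule_ge0// lee_fin expR_ge0.
rewrite -addeA -leeBlDr; last by rewrite fin_numD fIn.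
apply: le_trans le_sup; rewrite (bellmanE)//.
rewrite leeD2l// leeN2 (jump_kernel_split qI)// addeC leeD//.
  exact: ltW.
by apply: (le_jump_kernel_horizon qI); rewrite ?leey.
Qed.

(** The half of the dynamic programming equation on which the verification
    rests. *)
Lemma value_le_bellman_sup t i : (0 <= t)%R -> value t i <= bellman_sup t i.
Proof.
move=> t0; apply: (value_le chain c_gt0 utilU) => // h nh P1.
apply: (le_trans (net_le_kernel nh t0 P1)); rewrite /step.
have : 0 <= h 0%N t i by case: (nh 0%N) => _; exact.
case: (h 0%N t i) => [th||]//= th0; last exact: kernel_infty_le_bellman_sup.
rewrite -(bellmanE)//.
by apply: ereal_sup_ubound; exists th.
Qed.

(** One step of a maximizer: the value is at most what is obtained by following
    it until the first jump and continuing optimally. *)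
Lemma value_le_step_maximizer h t i : maximizer q P X J g c D U h -> (0 <= t)%R ->
  vpos t i + step q (total_rule h) loss vneg t i <=
  vneg t i + step q (total_rule h) gain vpos t i.
Proof.
move=> [mh hmax] t0; have nh := nnmeas_total_rule mh.
have [td|ntd] := pselect (time_domain g c D t i); last first.
  rewrite {2}/vneg (value_out _ _ _ _ ntd) maxye addye ?leey// -ltNye.
  apply: lt_le_trans (ltNy0) _.
  by case: (nnmeas_step qI nh ngain npos) => _; exact.
have ht : total_rule h t i = h t i by rewrite /total_rule t0.
have h0 : 0 <= h t i by case: (mh i) => + _; exact.
have le_sup := value_le_bellman_sup i t0.
have np := nnmeas_shift t npos; have nn := nnmeas_shift t nneg.
have fin x theta : 0 <= x -> x < +oo ->
    jump_kernel q i theta x (fun s => vpos (t + s)%R) < +oo.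
  exact: (kernel_value_pos_lty).
rewrite /step ht; have := hmax t i td.
case: (h t i) h0 => [th||]//= th0 => [bE|limE].
  apply: lee_sub_ge0 => //; try exact: (jump_kernel_ge0 qI).
    by apply: fin => //; exact: (gain_lty).
  rewrite value_posneg (le_trans le_sup)// -bE.
  by rewrite (bellmanE).
rewrite (jump_kernel_infty _ _ (loss _ _) 0) (jump_kernel_infty _ _ (gain _ _) 0).
set Ip := jump_kernel q i +oo 0 (fun s => vpos (t + s)%R).
have Ip0 : 0 <= Ip by exact: (jump_kernel_ge0 qI).
have vfin : vpos t i \is a fin_num.
  rewrite ge0_fin_numE// gt_max ltry andbT.
  exact: le_lt_trans (value_le_utility chain c_gt0 utilU hA2 gK K_super i t0) (utility_lty utilU _).
have r0 := rate_gt0 qI i.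
have key n (e : R) : (0 < e)%R ->
    vpos t i + jump_kernel q i n%:R%:E 0 (fun s => vneg (t + s)%R) <= vneg t i + (Ip + e%:E).
  move=> e0; apply: lee_sub_ge0 => //; try exact: (jump_kernel_ge0 qI).
  - by rewrite adde_ge0// lee_fin ltW.
  - by rewrite lte_add_pinfty ?ltry// fin.
  rewrite value_posneg (le_trans le_sup)// -limE.
  (* beyond [N] the gain weighted by the probability of waiting is at most [e] *)
pose N := Num.max n%:R (fine (gain t i) / (e * rate q i))%R.
  apply: (@le_trans _ _ (ereal_sup [set bellman t i th | th in [set th | (N < th)%R]])).
    apply: ereal_inf_lbound; exists [set th | (N < th)%R]; last by [].
    by exists N; split => //; exact: num_real.
  apply: ge_ereal_sup => _ [th /= Nth <-].
  have nth : (n%:R <= th)%R by rewrite (le_trans _ (ltW Nth))// le_max lexx.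
  have th0' : (0 <= th)%R by exact: le_trans nth.
  rewrite (bellmanE)//; apply: leeB.
    rewrite (jump_kernel_split qI)// addeC leeD//.
      by apply: (le_jump_kernel_horizon qI); rewrite ?leey.
    apply: (@le_trans _ _ (gain t i * (expR (- (rate q i * th)))%:E)).
      rewrite lee_wpmul2r ?lee_fin ?expR_ge0// /gain ge_max !le_max lexx orbT andbT.
      by rewrite (utility_nd utilU)// lerD2l lerN2 ler_pM2l// lerDl.
    have gf : gain t i \is a fin_num by rewrite ge0_fin_numE// (gain_lty).
    rewrite -(fineK gf) -EFinM lee_fin expRN ler_pdivrMr ?expR_gt0//.
    have : (fine (gain t i) / (e * rate q i) <= th)%R.
      by rewrite (le_trans _ (ltW Nth))// le_max lexx orbT.
    rewrite ler_pdivrMr ?mulr_gt0// => /le_trans; apply.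
    rewrite mulrCA ler_pM2l// mulrC (le_trans _ (expR_ge1Dx _))//.
    by rewrite lerDr.
  rewrite [leRHS](jump_kernel_split qI)//.
  apply: (@le_trans _ _ (jump_kernel q i th%:E 0 (fun s => vneg (t + s)%R))).
    by apply: (le_jump_kernel_horizon qI); rewrite ?lee_fin.
  by rewrite leeDr// mule_ge0// lee_fin expR_ge0.
rewrite -leeBrDl// (jump_kernel_horizon qI)//; apply: lime_le.
  apply: ereal_nondecreasing_is_cvgn => m n mn; apply: (le_jump_kernel_horizon qI) => //.
  by rewrite lee_fin ler_nat.
apply: nearW => n; rewrite leeBrDl//.
by apply/lee_addgt0Pr => e e0; rewrite -addeA; exact: key.
Qed.

(** * Verification of a maximizer *)

Section Maximizer.
Variable h : R -> S -> \bar R.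
Hypothesis hmax : maximizer q P X J g c D U h.
Let H := total_rule h.
Let nH : nnmeas H. Proof. exact: nnmeas_total_rule hmax.1. Qed.
Local Notation star := (fun _ : nat => H).

Let vpos_fin t i : (0 <= t)%R -> vpos t i \is a fin_num.
Proof.
move=> t0; rewrite ge0_fin_numE// gt_max ltry andbT.
exact: le_lt_trans (value_le_utility chain c_gt0 utilU hA2 gK K_super i t0) (utility_lty utilU _).
Qed.

Let step_gain_lty t i : (0 <= t)%R -> step q H gain vpos t i < +oo.
Proof.
move=> t0; apply: (kernel_value_pos_lty) => //.
exact: (gain_lty).
Qed.

Let step_ge0 phi f t i : nnmeas phi -> nnmeas f -> 0 <= step q H phi f t i.
Proof. by move=> nphi nf; case: (nnmeas_step qI nH nphi nf) => _; exact. Qed.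

Let star_step t i : (0 <= t)%R ->
  vpos t i + step q H loss vneg t i <= vneg t i + step q H gain vpos t i.
Proof. by move=> t0; exact: (value_le_step_maximizer). Qed.

(** The value at [t] is at most the net gain collected before the [n]th jump
    plus the expected value left at that jump. An infinite expected loss in one
    step forces an infinite negative part of the value; otherwise the
    intermediate terms cancel. *)
Lemma value_le_nested_maximizer n t i : (0 <= t)%R ->
  vpos t i + nested q n star loss vneg t i <= vneg t i + nested q n star gain vpos t i.
Proof.
elim: n t i => [|n IH] t i t0; first by rewrite /= addeC.
have nL := nnmeas_nested qI n (fun _ => nH) nloss nneg.
have nG := nnmeas_nested qI n (fun _ => nH) ngain npos.
have := @le_step _ _ _ qI H _ _ _ _ t i nH (nnmeasD ngain nloss)
  (nnmeasD npos nL) (nnmeasD nneg nG)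
  (fun v b _ => (lexx (gain v b + loss v b)))
  (fun v b tv => IH v b (le_trans t0 tv)).
rewrite (congr1 (fun F => F t i) (stepD qI H ngain nloss npos nL)).
rewrite (_ : (fun u a => gain u a + loss u a) = fun u a => loss u a + gain u a); last first.
  by apply/funext => u; apply/funext => a; rewrite addeC.
rewrite (congr1 (fun F => F t i) (stepD qI H nloss ngain nneg nG)) => le1.
have star1 := star_step i t0; have Aoo := step_gain_lty i t0.
have [Boo|Boo] := eqVneq (step q H loss vneg t i) +oo.
  move: star1; rewrite Boo addey; last by rewrite -ltNye (lt_le_trans (ltNy0)).
  rewrite leye_eq; have [->|vn] := eqVneq (vneg t i) +oo.
    move=> _; rewrite addye ?leey// -ltNye (lt_le_trans (ltNy0))//.
    exact: (step_ge0 _ _ ngain nG).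
  by rewrite -(negbK (_ == _)) -ltey lte_add_pinfty// ltey.
apply: (lee_cancel_add _ _ _ _ _ _ _ star1 le1) => //; try exact: step_ge0.
by rewrite ltey.
Qed.

(** The gap [Dv] between the affine majorant [C1 + s1 (K - c u)] and the value is
    a nonnegative supermartingale under the maximizer, with gap [Dg] collected
    on stopping. As the utility is also below a flatter line, its positive part
    is at most a multiple of [Dg] plus a constant, and a finite initial gap
    bounds its expectation over all horizons. *)
Lemma eventual_gain_lty t i : (0 <= t)%R -> value t i != -oo ->
  eventual q star gain t i < +oo.
Proof.
move=> t0 vNy.
have [C1 [s1 [C2 [s2 [s20 s21 m1 m2]]]]] := two_majorants utilU.
have s10 := lt_trans s20 s21; have s100 := ltW s10; have c0 := ltW c_gt0.
pose rA (a : S) := (`|C1| + s1 * K a)%R.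
pose rG (a : S) := (`|C1| + s1 * gpos g a)%R.
pose rB (r : R) := (`|C1| - C1 + s1 * c * Num.max r 0)%R.
have B0 : (0 <= `|C1| - C1)%R by rewrite subr_ge0 ler_norm.
have K0 a : (0 <= K a)%R by rewrite (le_trans (gpos_ge0 g a)) ?gK.
have rB0 r : (0 <= rB r)%R.
  by rewrite /rB addr_ge0// mulr_ge0 ?mulr_ge0// le_max lexx orbT.
have nA : nnmeas (fun (_ : R) a => (rA a)%:E).
  split => [b0|r b0]; [exact: measurable_cst|].
  by rewrite lee_fin addr_ge0// mulr_ge0.
have nG : nnmeas (fun (_ : R) a => (rG a)%:E).
  split => [b0|r b0]; [exact: measurable_cst|].
  by rewrite lee_fin addr_ge0// mulr_ge0// gpos_ge0.
have mB : measurable_fun setT rB.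
  apply: measurable_funD => //.
  by apply: measurable_funM => //; apply: measurable_maxr.
have nB : nnmeas (fun r (_ : S) => (rB r)%:E).
  by split => [b0|r b0]; [apply/measurable_EFinP|rewrite lee_fin].
pose Dv (v : R) (b : S) : \bar R := maxe ((rA b - rB v)%R%:E - value v b) 0.
pose Dg (v : R) (b : S) : \bar R := maxe ((rG b - rB v)%R%:E - U (g b - c * v)%R) 0.
have nDv : nnmeas Dv.
  split => [b|v b]; last by rewrite le_max lexx orbT.
  apply: measurable_maxe; last exact: measurable_cst.
  apply: emeasurable_funB; last exact: (measurable_value chain c_gt0 utilU).
  by apply/measurable_EFinP; apply: measurable_funB.
have nDg : nnmeas Dg.
  split => [b|v b]; last by rewrite le_max lexx orbT.
  apply: measurable_maxe; last exact: measurable_cst.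
  apply: emeasurable_funB; last exact: (measurable_utility_time c_gt0 utilU).
  by apply/measurable_EFinP; apply: measurable_funB.
have DvE v b : (0 <= v)%R -> Dv v b + (rB v)%:E + vpos v b = (rA b)%:E + vneg v b.
  move=> v0; rewrite /Dv /value_pos /value_neg.
  have := value_le_majorant chain c_gt0 utilU hA2 gK K_super b v0 s10 m1.
  rewrite (_ : (C1 + _)%R = (rA b - rB v)%R); last by rewrite /rA /rB max_l//; ring.
  case: (value v b) => [x||]//; last by rewrite (_ : - -oo = +oo)// addey// !maxye maxNye adde0 addye// addey.
  rewrite lee_fin -EFinB -EFinN -!EFin_max -!EFinD => xle; congr (_%:E).
  rewrite max_l ?subr_ge0//; have [x0|x0] := leP 0%R x.
    by rewrite max_r ?oppr_le0//; lra.
  by rewrite max_l ?oppr_ge0 ?(ltW x0)//; lra.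
have DgE v b : (0 <= v)%R -> Dg v b + (rB v)%:E + gain v b = (rG b)%:E + loss v b.
  move=> v0; rewrite /Dg /gain /loss.
  have : U (g b - c * v)%R <= (rG b - rB v)%:E.
    rewrite (le_trans (m1 _))// lee_fin /rG /rB (max_l v0).
    have : (s1 * g b <= s1 * gpos g b)%R by rewrite ler_pM2l// /gpos le_max lexx.
    by rewrite mulrBr; lra.
  case: (U _) => [x||]//; last by rewrite (_ : - -oo = +oo)// addey// !maxye maxNye adde0 addye// addey.
  rewrite lee_fin -EFinB -EFinN -!EFin_max -!EFinD => xle; congr (_%:E).
  rewrite max_l ?subr_ge0//; have [x0|x0] := leP 0%R x.
    by rewrite max_r ?oppr_le0//; lra.
  by rewrite max_l ?oppr_ge0 ?(ltW x0)//; lra.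
have super v b : (0 <= v)%R -> step q H Dg Dv v b <= Dv v b.
  move=> v0; have star1 := star_step b v0; have Goo := step_gain_lty b v0.
  have [Boo sup] := step_supermartingale qI c0 (normr_ge0 C1) B0 s100 v0 (gpos_ge0 g) gK (K_super b) nH.
  have E : step q H Dg Dv v b + step q H (fun r _ => (rB r)%:E) (fun r _ => (rB r)%:E) v b +
      step q H gain vpos v b =
      step q H (fun _ a => (rG a)%:E) (fun _ a => (rA a)%:E) v b + step q H loss vneg v b.
    rewrite -(congr1 (fun F => F v b) (stepD qI H nDg nB nDv nB)).
    rewrite -(congr1 (fun F => F v b) (stepD qI H (nnmeasD nDg nB) ngain (nnmeasD nDv nB) npos)).
    rewrite -(congr1 (fun F => F v b) (stepD qI H nG nloss nA nneg)).
    apply/eqP; rewrite eq_le; apply/andP; split; apply: (le_step qI) => //;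
      do ?[by do ?apply: nnmeasD]; move=> r a vr; rewrite ?DgE ?DvE//;
      exact: le_trans vr.
  apply: (lee_of_balance _ _ _ _ _ _ _ (vpos_fin b v0) Boo Goo E star1 sup (DvE v b v0));
    by [exact: step_ge0|case: nDv => _; exact|exact: vneg_ge0].
have s12 : (0 < s1 - s2)%R by rewrite subr_gt0.
pose k := (s2 / (s1 - s2))%R; pose k' := (`|s1 * C2 - s2 * C1| / (s1 - s2))%R.
have k0 : (0 <= k)%R by rewrite divr_ge0 ?(ltW s12) ?(ltW s20).
have k'0 : (0 <= k')%R by rewrite divr_ge0 ?(ltW s12).
have gain_le v b : (0 <= v)%R -> gain v b <= k%:E * Dg v b + k'%:E.
  move=> v0; rewrite /gain /Dg ge_max; apply/andP; split; last first.
    by rewrite adde_ge0// mule_ge0// le_max lexx orbT.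
  have := m2 (g b - c * v)%R; case: (U _) => [x||]//; last by move=> _; rewrite leNye.
  rewrite lee_fin -EFinB -EFin_max -EFinM -EFinD lee_fin => x2.
  have Dle : (rG b - rB v - x <= Num.max (rG b - rB v - x) 0)%R by rewrite le_max lexx.
  apply: (@le_trans _ _ (k * (rG b - rB v - x) + k')%R); last by rewrite lerD2r ler_wpM2l.
  rewrite /k /k' mulrAC -mulrDl ler_pdivlMr// /rG /rB (max_l v0).
  have x3 : (x <= C2 + s2 * (gpos g b - c * v))%R.
    by rewrite (le_trans x2)// lerD2l ler_pM2l// lerD2r /gpos le_max lexx.
  have -> : (`|C1| + s1 * gpos g b - (`|C1| - C1 + s1 * c * v) - x =
      C1 + s1 * (gpos g b - c * v) - x)%R by ring.
  by apply: flatter_majorant_bound x3 _ => //; exact: ler_norm.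
have nk' : nnmeas (fun (_ : R) (_ : S) => k'%:E) by exact: nnmeas_cst.
have nk (F : R -> S -> \bar R) : nnmeas F -> nnmeas (fun u a => k%:E * F u a).
  move=> [mF F0]; split => [a|u a]; last by rewrite mule_ge0.
  by apply: emeasurable_funM => //; exact: measurable_cst.
have bound n v b : (0 <= v)%R ->
    nested q n star gain (fun _ _ => 0) v b <= k%:E * Dv v b + k'%:E.
  have n0 : nnmeas (fun (_ : R) (_ : S) => 0 : \bar R) by exact: nnmeas_cst.
  have Dv0 u a : 0 <= Dv u a by case: nDv => _; exact.
  elim: n v b => [|n IH] v b v0; first by rewrite /= adde_ge0// mule_ge0.
  apply: (@le_trans _ _ (step q H (fun u a => k%:E * Dg u a + k'%:E)
      (fun u a => k%:E * Dv u a + k'%:E) v b)).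
    apply: (le_step qI) => //.
    - by apply: (nnmeas_nested qI).
    - exact: (nnmeasD (nk _ nDv) nk').
    - by move=> u a vu; apply: gain_le; exact: le_trans vu.
    - by move=> u a vu; apply: IH; exact: le_trans vu.
  rewrite (congr1 (fun F => F v b) (stepD qI H (nk _ nDg) nk' (nk _ nDv) nk')).
  rewrite /step (jump_kernel_cst qI)// leeD2r//.
  rewrite (jump_kernelZl qI b (H v b) k0 (nDg.2 _ _) (nnmeas_shift v nDv)).
  by rewrite lee_wpmul2l// super.
apply: (@le_lt_trans _ _ (k%:E * Dv t i + k'%:E)).
  apply: lime_le; last by apply: nearW => n; exact: bound.
  apply: ereal_nondecreasing_is_cvgn => m n mn.
  exact: (nested_nd qI t i (fun _ => nH) ngain).
rewrite /Dv; move: vNy; have := vpos_fin i t0; rewrite /value_pos.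
case: (value t i) => [x||]// _ _.
by rewrite -EFinB -EFin_max -EFinM -EFinD ltry.
Qed.

(** The expected value left at the [n]th jump vanishes in the limit, and the
    gains and losses collected before it increase to their totals, of which
    the gains are finite. *)
Lemma net_maximizer_ge_value t i : (0 <= t)%R ->
  P i [set w | markov_time X J star t w < +oo] = 1 ->
  (\int[P i]_w (value (J n w + t)%R (jump_chain X J n w) *
     (\1_[set w' | ((J n w')%:E <= markov_time X J star t w')%E] w)%:E)) @[n --> \oo] --> 0 ->
  value t i <= net star t i.
Proof.
move=> t0 P1 lim0; have [->|vNy] := eqVneq (value t i) -oo; first exact: leNye.
have nstar k : nnmeas (star k) by [].
have n0 : nnmeas (fun (_ : R) (_ : S) => 0 : \bar R) by exact: nnmeas_cst.
pose A n := alive X J star t n.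
pose I F n := \int[P i]_(w in A n) F (t + J n w)%R (jump_chain X J n w).
have I0 F n : nnmeas F -> 0 <= I F n.
  by move=> [_ F0]; apply: integral_ge0.
have limE n : \int[P i]_w (value (J n w + t)%R (jump_chain X J n w) *
    (\1_[set w' | ((J n w')%:E <= markov_time X J star t w')%E] w)%:E) = I vpos n - I vneg n.
  rewrite integralE; congr (_ - _); rewrite [RHS]integral_mkcond;
  apply: eq_integral => w _; rewrite patchE ?funeposE ?funenegE indicE.
    have [Aw|nAw] := pselect (A n w).
      by rewrite !mem_set ?mule1 1?addrC//=; apply/(alive_le_markov_time chain t nstar).
    rewrite !memNset ?mule0 ?maxxx//=.
    by move=> /(alive_le_markov_time chain t nstar).
  have [Aw|nAw] := pselect (A n w).
    by rewrite !mem_set ?mule1 1?addrC//=; apply/(alive_le_markov_time chain t nstar).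
  rewrite !memNset ?mule0 ?oppe0 ?maxxx//=.
  by move=> /(alive_le_markov_time chain t nstar).
have lim1 : I vpos n - I vneg n @[n --> \oo] --> 0%:E.
  by move: lim0; rewrite (_ : (fun n => _) = fun n => I vpos n - I vneg n)//; exact/funext.
have vfin : value t i \is a fin_num.
  rewrite fin_numE vNy -ltey /=.
  exact: le_lt_trans (value_le_utility chain c_gt0 utilU hA2 gK K_super i t0) (utility_lty utilU _).
have Goo := eventual_gain_lty t0 vNy.
pose p n := nested q n star gain (fun _ _ => 0) t i.
pose m n := nested q n star loss (fun _ _ => 0) t i.
have nestedI n phi F : nnmeas phi -> nnmeas F ->
    nested q n star phi F t i = nested q n star phi (fun _ _ => 0) t i + I F n.
  move=> nphi nF; rewrite (nestedE chain)// (nestedE chain n i t nstar nphi n0).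
  by rewrite [X in _ = _ + X + _]integral0_eq// adde0.
have p0 n : 0 <= p n by case: (nnmeas_nested qI n nstar ngain n0) => _; exact.
have m0 n : 0 <= m n by case: (nnmeas_nested qI n nstar nloss n0) => _; exact.
have cvp := ereal_nondecreasing_is_cvgn (nested_nd qI t i nstar ngain).
have cvm := ereal_nondecreasing_is_cvgn (nested_nd qI t i nstar nloss).
have ple n : p n <= eventual q star gain t i.
  rewrite /eventual (cvg_lim _ (ereal_nondecreasing_cvgn (nested_nd qI t i nstar ngain)))//.
  by apply: ereal_sup_ubound; exists n.
have gfin : eventual q star gain t i \is a fin_num.
  by rewrite ge0_fin_numE// (le_trans (p0 0%N)).
have lee e : (0 < e)%R -> eventual q star loss t i + value t i <=
    eventual q star gain t i + e%:E.
  move=> e0; rewrite -leeBrDr//; apply: lime_le => //.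
  move/fine_cvgP: (lim1) => [near_fin /cvgr_lt /(_ e e0) near_lt].
  near=> n; rewrite leeBrDr//.
  have := value_le_nested_maximizer n i t0.
  rewrite (nestedI n loss vneg)// (nestedI n gain vpos)// => le_n.
  apply: (lee_of_small_remainder vfin gfin (vpos_fin i t0) _ (m0 n) (p0 n)
    (I0 _ n nneg) (I0 _ n npos) (value_posneg t i) (ple n) le_n) => //.
    by near: n.
  by near: n.
have lfin : eventual q star loss t i \is a fin_num.
  rewrite ge0_fin_numE; last by case: (nnmeas_eventual qI nstar nloss) => _; exact.
  have := lee 1%R ltr01; move: vfin gfin.
  case: (value t i) => [v||]//; case: (eventual q star gain t i) => [eg||]// _ _.
  by case: (eventual _ _ _ _ _) => [l||]// _; rewrite ltry.
by rewrite /net leeBrDr// addeC; apply/lee_addgt0Pr.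
Unshelve. all: by end_near. Qed.

End Maximizer.

End DynamicProgramming.

Theorem theorem5p2 (R : realType) (S : countType) (d : measure_display)
    (Omega : measurableType d) (q : S -> S -> R)
    (P : S -> probability Omega R) (X : R -> Omega -> S)
    (J : nat -> Omega -> R) (g : S -> R) (c : R)
    (D : utility_domain R) (U : R -> \bar R)
    (chain : markov_chain q P X J)
    (c_gt0 : 0 < c) (utilU : utility g D U)
    (hA1 : A1 P X g c) (hA2 : A2 P X J g c U)
    (h : R -> S -> \bar R) (hmax : maximizer q P X J g c D U h)
    (h_finite : forall i t, time_domain g c D t i ->
      P i [set w | (markov_time X J (fun _ => h) t w < +oo)%E] = 1%E)
    (h_limit : forall i t, time_domain g c D t i ->
      (\int[P i]_w
         (value P X J g c D U (J n w + t)%R (jump_chain X J n w) *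
          (\1_[set w' | ((J n w')%:E <= markov_time X J (fun _ => h) t w')%E]
             w)%:E))%E @[n --> \oo] --> 0%E) :
  forall i t, time_domain g c D t i ->
    expected_utility P X g c U i t (markov_time X J (fun _ => h) t) =
    value P X J g c D U t i.
Proof.
move=> i t td; have [t0 _] := iffLR (time_domainE g D t i c_gt0) td.
have [K [gK K_super]] := exists_superharmonic chain c_gt0 hA1.
pose H := total_rule h.
have nH : nnmeas H by exact: nnmeas_total_rule hmax.1.
have E : markov_time X J (fun _ => H) t = markov_time X J (fun _ => h) t.
  by apply/funext => w; exact: (markov_time_total chain).
have fin := h_finite i t td; have lim := h_limit i t td; rewrite -E in fin lim *.
rewrite (expected_utility_net chain c_gt0 utilU)//.
apply/eqP; rewrite eq_le (value_ge chain c_gt0 utilU)//=.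
exact: (net_maximizer_ge_value chain c_gt0 utilU hA2 gK K_super).
Qed.
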